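(* Let $0<\alpha_0\le\alpha<2$, $c_l,c_K>0$, and assume that $k$ satisfies condition (E$_\ge$) with constant $c_l$ and condition (U2) with constant $c_K$. For any $q>1$ there exists a constant $C$, depending only on $d,q,c_l,c_K$ and $\alpha_0$, such that for every $x_0\in\mathbb{R}^d$, $r>0$ and every $u\in H(\mathbb{R}^d;k)$ satisfying $\mathcal{E}(u,\varphi)\le0$ for every nonnegative $\varphi\in H_{B_r(x_0)}(\mathbb{R}^d;k)$, $$\operatorname*{ess\,sup}_{B_{r/2}(x_0)}u\le C\left(\fint_{B_r(x_0)}u_+^q(x)\,dx\right)^{1/q}+r^\alpha\int_{\mathbb{R}^d\setminus B_{r/2}(x_0)}\frac{u_+(y)}{|y-x_0|^{d+\alpha}}\,dy.$$
   Context: Throughout, $d\ge 3$ and $k:(\mathbb{R}^d\times\mathbb{R}^d)\setminus\{x=y\}\to[0,\infty)$ is a measurable function with $k(x,y)=k(y,x)$ and $\sup_{x\in\mathbb{R}^d}\int_{\mathbb{R}^d}(1\wedge|y-x|^2)k(x,y)\,dy<\infty$. For an open set $U\subset\mathbb{R}^d$ and measurable $u,v$, $\mathcal{E}_U(u,v)=\int_U\int_U(u(y)-u(x))(v(y)-v(x))k(x,y)\,dy\,dx$ (when finite), and $\mathcal{E}=\mathcal{E}_{\mathbb{R}^d}$. For $0<\alpha<2$ let $k^{(\alpha)}(x,y)=\frac{2^\alpha\Gamma((d+\alpha)/2)}{\pi^{d/2}|\Gamma(-\alpha/2)|}|y-x|^{-d-\alpha}$ and let $\mathcal{E}^\alpha_U$,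 $\mathcal{E}^\alpha$ denote the same forms with $k$ replaced by $k^{(\alpha)}$. $H(\mathbb{R}^d;k)=\{u\in L^2(\mathbb{R}^d):\mathcal{E}(u,u)<\infty\}$ and, for open $\Omega$, $H_\Omega(\mathbb{R}^d;k)=\{u\in H(\mathbb{R}^d;k): u=0\text{ a.e. on }\mathbb{R}^d\setminus\Omega\}$. $u_+=\max\{u,0\}$. Condition (E$_\ge$) with constant $c_l>0$: for every ball $B=B_r(x_0)\subset\mathbb{R}^d$ and every $u\in L^2(B)$, $\mathcal{E}_B(u,u)\ge c_l\,\mathcal{E}^\alpha_B(u,u)$. Condition (U2) with constant $c_K>0$: $k(x,y)\le c_K(2-\alpha)|y-x|^{-d-\alpha}$ for a.e. $x,y\in\mathbb{R}^d$. *)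

(* Defs.v *)
From HB Require Import structures.
From mathcomp Require Import all_boot all_order all_algebra.
From mathcomp Require Import all_classical all_reals all_analysis.
Set Implicit Arguments. Unset Strict Implicit. Unset Printing Implicit Defensive.
Import Order.TTheory GRing.Theory Num.Theory.
Import numFieldNormedType.Exports.
Local Open Scope classical_set_scope.
Local Open Scope ring_scope.

(* Euclidean space R^(n+1) as the iterated product ((R * R) * ...) * R
   with its product sigma-algebra, and Lebesgue measure on it as the
   iterated product of the one-dimensional Lebesgue measure.          *)

Fixpoint spc (R : realType) (n : nat) : {dsp : measure_display & measurableType dsp} :=
  match n with
  | 0 => existT (fun dsp => measurableType dsp) _ (measurableTypeR R)
  | n'.+1 => existT (fun dsp => measurableType dsp) _ (projT2 (spc R n') * measurableTypeR R)%type
  end.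

Definition pt (R : realType) (n : nat) : measurableType (projT1 (spc R n)) := projT2 (spc R n).

Fixpoint lebn (R : realType) (n : nat) : {measure set (pt R n) -> \bar R} :=
  match n return {measure set (pt R n) -> \bar R} with
  | 0 => [the measure _ _ of @lebesgue_measure R]
  | n'.+1 => [the measure _ _ of (lebn R n' \x (@lebesgue_measure R))%E]
  end.

Lemma lebn_sigma_finite (R : realType) (n : nat) : sigma_finite setT (lebn R n).
Proof.
elim: n => [|n IH]; first exact: sigma_finiteT.
have /sigma_finiteP[F [TF ndF Foo]] := IH.
have /sigma_finiteP[G [TG ndG Goo]] := sigma_finiteT (@lebesgue_measure R).
exists (fun n => F n `*` G n).
  rewrite -setXTT TF TG predeqE => -[x y]; split.
    move=> [/= [n1 _ Fnx] [k _ Gky]]; exists (maxn n1 k) => //; split.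
    - by move: x Fnx; exact/subsetPset/ndF/leq_maxl.
    - by move: y Gky; exact/subsetPset/ndG/leq_maxr.
  by move=> [n1 _ []/= ? ?]; split; exists n1.
move=> k; have [? ?] := Foo k; have [? ?] := Goo k.
split; first exact: measurableX.
by rewrite /= product_measure1E// lte_mul_pinfty// ge0_fin_numE.
Qed.

Definition lebd (R : realType) (n : nat) : set (pt R n) -> \bar R := lebn R n.
Arguments lebd R n : clear implicits.
HB.instance Definition _ (K : realType) (m : nat) :=
  Measure.copy (lebd K m) (lebn K m).
HB.instance Definition _ (K : realType) (m : nat) :=
  Measure_isSigmaFinite.Build _ _ _ (lebd K m) (lebn_sigma_finite K m).


(* The space R^d (d >= 1) and its Lebesgue measure.                   *)
Definition Rsp (R : realType) (d : nat) := pt R d.-1.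
Definition leb (R : realType) (d : nat) : {sigma_finite_measure set (Rsp R d) -> \bar R} :=
  [the {sigma_finite_measure set _ -> \bar R} of lebd R d.-1].
Arguments leb R d : clear implicits.

Fixpoint sqdist (R : realType) (n : nat) : pt R n -> pt R n -> R :=
  match n return pt R n -> pt R n -> R with
  | 0 => fun x y => ((x : R) - (y : R)) ^+ 2
  | n'.+1 => fun x y => sqdist x.1 y.1 + ((x.2 : R) - (y.2 : R)) ^+ 2
  end.

Definition eudist (R : realType) (d : nat) (x y : Rsp R d) : R := Num.sqrt (sqdist x y).

Definition eball (R : realType) (d : nat) (x0 : Rsp R d) (r : R) : set (Rsp R d) :=
  [set x | eudist x x0 < r].

(* Euler's Gamma function; Gamma0 is the integral formula (s > 0), and
   Gamma extends it to -1 < s < 0 by Gamma(s) = Gamma(s+1)/s.         *)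
Definition Gamma0 (R : realType) (s : R) : R :=
  fine (\int[@lebesgue_measure R]_(t in [set t : R | (0 < t)%R])
          ((powR t (s - 1)) * expR (- t))%R%:E)%E.
Definition Gamma (R : realType) (s : R) : R :=
  if 0 < s then Gamma0 s else Gamma0 (s + 1) / s.

Definition kalpha (R : realType) (d : nat) (alpha : R) (x y : Rsp R d) : R :=
  (powR 2 alpha * Gamma ((d%:R + alpha) / 2))
    / (powR pi (d%:R / 2) * `|Gamma (- alpha / 2)|)
  * powR (eudist y x) (- (d%:R + alpha)).

Definition Eform (R : realType) (d : nat) (k : Rsp R d -> Rsp R d -> R)
    (U : set (Rsp R d)) (u v : Rsp R d -> R) : \bar R :=
  (\int[leb R d]_(x in U) \int[leb R d]_(y in U)
      ((u y - u x) * (v y - v x) * k x y)%R%:E)%E.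

Definition admissible_kernel (R : realType) (d : nat) (k : Rsp R d -> Rsp R d -> R) : Prop :=
  [/\ measurable_fun setT (fun p : Rsp R d * Rsp R d => k p.1 p.2),
      (forall x y, 0 <= k x y),
      (forall x y, k x y = k y x) &
      exists M : R, forall x : Rsp R d,
        (\int[leb R d]_y ((Num.min 1 (eudist y x ^+ 2)) * k x y)%R%:E <= M%:E)%E].

Definition L2on (R : realType) (d : nat) (U : set (Rsp R d)) (u : Rsp R d -> R) : Prop :=
  measurable_fun U u /\ (\int[leb R d]_(x in U) (u x ^+ 2)%R%:E < +oo)%E.

Definition E_ge (R : realType) (d : nat) (cl alpha : R) (k : Rsp R d -> Rsp R d -> R) : Prop :=
  forall (x0 : Rsp R d) (r : R), 0 < r ->
  forall u : Rsp R d -> R, L2on (eball x0 r) u ->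
    (cl%:E * Eform (@kalpha R d alpha) (eball x0 r) u u <= Eform k (eball x0 r) u u)%E.

Definition U2 (R : realType) (d : nat) (cK alpha : R) (k : Rsp R d -> Rsp R d -> R) : Prop :=
  {ae (leb R d \x leb R d)%E, forall p : Rsp R d * Rsp R d,
     k p.1 p.2 <= cK * (2 - alpha) * powR (eudist p.2 p.1) (- (d%:R + alpha))}.

Definition inH (R : realType) (d : nat) (k : Rsp R d -> Rsp R d -> R) (u : Rsp R d -> R) : Prop :=
  [/\ measurable_fun setT u,
      (\int[leb R d]_x (u x ^+ 2)%R%:E < +oo)%E &
      (Eform k setT u u < +oo)%E].

Definition inH_on (R : realType) (d : nat) (k : Rsp R d -> Rsp R d -> R)
    (Omega : set (Rsp R d)) (u : Rsp R d -> R) : Prop :=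
  inH k u /\ {ae leb R d, forall x, ~ Omega x -> u x = 0}.

Definition esssup_on (R : realType) (d : nat) (B : set (Rsp R d)) (u : Rsp R d -> R) : \bar R :=
  ereal_inf [set y : \bar R | \forall x \ae leb R d, B x -> ((u x)%:E <= y)%E].

(* Main.v *)
(** De Giorgi iteration with constants that do not degenerate as alpha -> 2.

    Testing the subsolution inequality with [eta^2 (u - l)_+] and using
    [(a - b) (s^2 a - t^2 b) = (s a - t b)^2 - a b (s - t)^2], the energy of
    [eta (u - l)_+] is bounded by the double integral of
    [(u - l)_+(x) (u - l)_+(y) (eta x - eta y)^2 k(x, y)], hence, by (U2), by an
    L^2 term on the larger ball plus a tail term.  The factor [2 - alpha] in (U2)
    cancels the divergence of the integral of [|y - x|^(2 - d - alpha)] at [x].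

    In place of a Sobolev inequality a Faber-Krahn inequality suffices:
    [int w^2 <= C rho^alpha E(w, w)] whenever [|{w <> 0}| <= rho^d / 2].  For
    [D(h) = int (w(x + h) - w(x))^2 dx] one has [D(2 h) <= 4 D(h)], so each of the
    [~ 1 / (2 - alpha)] dyadic cubes [2^-j (rho, 2 rho)^d] contributes to the
    fractional energy at least half of what the cube [j = 0] does; on that cube
    [w(x + h) = 0] for at least half of the [h].

    Iterating over levels [lev (1 - 2^-j)] on shrinking balls bounds [u] by the L^2
    average plus an arbitrarily small multiple of the tail.  For [q >= 2] the L^q
    average controls the L^2 average; for [q < 2] the L^2 norm is interpolated
    between L^q and the supremum over a larger ball, and the latter is absorbed by
    iterating over radii between [r / 2] and [3 r / 4]. *)

(* Two demands shape the constants. The tail must come with coefficient 1. The iteration therefore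
   carries a parameter [de] and asks of the top level only [de * tail <= lev]; a smaller [de] is
   paid by a power of [de^-1] in front of the integral average. With [de = 1/2], half of the tail
   stays free to absorb what is inherited from larger radii.

   The constants must also be uniform in [alpha]. Exponents [N + al] are replaced by [N + 2], the
   normalising constant of the fractional kernel is bounded below by a multiple of [2 - al], and an
   integer [m] with [m * alpha0 >= 1] stands for [1 / al].

   No gain of integrability is available, so smallness of supports drives the recursion. Chebyshev
   bounds the set where the truncation at [l'] is nonzero by [X / (l' - l)^2], with [X] the squared
   norm at level [l]; this makes a small [rho] admissible, and the factor [rho^alpha] makes the
   recursion superlinear.

   Condition (E_ge) compares energies on one ball at a time, but exhaustion by balls makes it
   global, so the Faber-Krahn inequality is proved on the whole space, where translations and
   dilations are available. *)
Require Import Defs.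
From HB Require Import structures.
From mathcomp Require Import all_boot all_order all_algebra.
From mathcomp Require Import all_classical all_reals all_analysis.
From mathcomp Require Import measurable_realfun ring lra.
Import Order.TTheory GRing.Theory Num.Theory.
Import numFieldNormedType.Exports.
Local Open Scope classical_set_scope.
Local Open Scope ring_scope.
Set Implicit Arguments. Unset Strict Implicit. Unset Printing Implicit Defensive.

(** * Lebesgue measure on the iterated products [pt R n] *)

Section EuclideanSpace.
Variable R : realType.
Local Notation lam := (@lebesgue_measure R).

Lemma integral_lebd_succ n (f : pt R n.+1 -> \bar R) :
  measurable_fun setT f -> (forall x, 0 <= f x)%E ->
  (\int[lebd R n.+1]_z f z = \int[lebd R n]_x \int[lam]_t f (x, t))%E.
Proof.
move=> mf f0.
exact: (@fubini_tonelli1 _ _ (pt R n) (measurableTypeR R) R (lebd R n) lam f).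
Qed.

Fixpoint padd n : pt R n -> pt R n -> pt R n :=
  match n return pt R n -> pt R n -> pt R n with
  | 0 => fun x y => (x : R) + (y : R)
  | n'.+1 => fun x y => (padd x.1 y.1, (x.2 : R) + (y.2 : R))
  end.

Fixpoint pscale (c : R) n : pt R n -> pt R n :=
  match n return pt R n -> pt R n with
  | 0 => fun x => c * (x : R)
  | n'.+1 => fun x => (pscale c x.1, c * (x.2 : R))
  end.

Lemma measurable_padd n (d : measure_display) (T : measurableType d)
    (f g : T -> pt R n) :
  measurable_fun setT f -> measurable_fun setT g ->
  measurable_fun setT (fun x => padd (f x) (g x)).
Proof.
elim: n f g => [|n IH] f g mf mg; first exact: measurable_funD.
apply/measurable_fun_pairP; split => /=.
- apply: IH; exact: measurableT_comp.
- by apply: measurable_funD; apply: measurableT_comp => //;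
    exact: measurable_snd.
Qed.

Lemma measurable_pscale c n (d : measure_display) (T : measurableType d)
    (f : T -> pt R n) :
  measurable_fun setT f -> measurable_fun setT (fun x => pscale c (f x)).
Proof.
elim: n f => [|n IH] f mf; first exact: measurable_funM.
apply/measurable_fun_pairP; split => /=.
- apply: IH; exact: measurableT_comp.
- by apply: measurable_funM => //; apply: measurableT_comp => //;
    exact: measurable_snd.
Qed.

Lemma pscale1 n (x : pt R n) : pscale 1 x = x.
Proof. by elim: n x => [|n IH] x /=; rewrite mul1r ?IH//; case: x. Qed.

Lemma paddA n : associative (@padd n).
Proof. by elim: n => [|n IH] x y z /=; rewrite addrA ?IH. Qed.

Lemma paddC n : commutative (@padd n).
Proof.
elim: n => [|n IH] x y /=; first exact: (@addrC R).
by rewrite IH (@addrC R x.2).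
Qed.

(** The image of Lebesgue measure under [x -> c * x + b], multiplied by [c], gives every interval
    []a, e]] its length, hence is Lebesgue measure. *)
Lemma integral_lebesgue_affine (c b : R) (f : R -> \bar R) : 0 < c ->
  measurable_fun setT f -> (forall x, 0 <= f x)%E ->
  (\int[lam]_x f (c * x + b)%R = (c^-1)%:E * \int[lam]_x f x)%E.
Proof.
move=> c0 mf f0.
pose phi : measurableTypeR R -> measurableTypeR R := fun x => c * x + b.
have mphi : measurable_fun setT phi.
  by apply: measurable_funD => //; exact: measurable_funM.
pose push : {measure set (measurableTypeR R) -> \bar R} :=
  measure_function_pushforward__canonical__measure_function_Measure lam mphi.
pose nu := mscale (NngNum (ltW c0)) push.
have H (A : set (measurableTypeR R)) : measurable A -> lam A = nu A.
  move=> mA; apply: (@lebesgue_measure_unique R nu) => // _ [[a e]] _ <-.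
  change (lam `]a, e]%classic = c%:E * lam (phi @^-1` `]a, e]))%E.
  have -> : phi @^-1` `]a, e] = `](c^-1 * (a - b)), (c^-1 * (e - b))]%classic.
    apply/seteqP; split => x /=; rewrite !in_itv/= ltr_pdivrMl// ler_pdivlMl//;
      rewrite /phi => /andP[h1 h2]; apply/andP; split; lra.
  rewrite !lebesgue_measure_itv/= !lte_fin ltr_pM2l ?invr_gt0// ltrD2r.
  case: ifPn => _; last by rewrite mule0.
  rewrite -!EFinD -EFinM; congr EFin.
  by field; exact: lt0r_neq0.
have -> : (\int[lam]_x f (c * x + b)%R = \int[push]_x f x)%E.
  by rewrite [RHS](@ge0_integral_pushforward _ _ _ _ R phi mphi lam setT f).
rewrite [X in (_ * X)%E](@eq_measure_integral _ _ _ setT nu); last first.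
  by move=> A mA _; exact: H.
rewrite ge0_integral_mscale//= muleA -EFinM mulVf ?mul1e//; exact: lt0r_neq0.
Qed.

Lemma integral_lebd_affine n (c : R) (b : pt R n) (f : pt R n -> \bar R) :
  0 < c -> measurable_fun setT f -> (forall x, 0 <= f x)%E ->
  (\int[lebd R n]_x f (padd (pscale c x) b) =
   ((c^-1) ^+ n.+1)%:E * \int[lebd R n]_x f x)%E.
Proof.
move=> c0; elim: n b f => [|n IH] b f mf f0.
  by rewrite expr1; exact: integral_lebesgue_affine.
have mf1 (x : pt R n) : measurable_fun setT (fun t : measurableTypeR R => f (x, t)).
  by apply: (measurableT_comp mf); exact: measurable_pair1.
have mF : measurable_fun setT (fun x : pt R n => \int[lam]_t f (x, t))%E.
  exact: (@measurable_fun_fubini_tonelli_F _ _ (pt R n) (measurableTypeR R) R lam f).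
have F0 (x : pt R n) : (0 <= \int[lam]_t f (x, t))%E by exact: integral_ge0.
have mg : measurable_fun setT (fun x : pt R n.+1 => f (padd (pscale c x) b)).
  apply: (measurableT_comp mf); apply: (@measurable_padd n.+1) => //.
  exact: (@measurable_pscale _ n.+1).
rewrite (integral_lebd_succ mg)// (integral_lebd_succ mf)//.
set F := (fun x : pt R n => \int[lam]_t f (x, t))%E in mF F0 *.
transitivity (\int[lebd R n]_x ((c^-1)%:E * F (padd (pscale c x) b.1)))%E.
  apply: eq_integral => x _.
  exact: (@integral_lebesgue_affine c b.2 (fun t => f (padd (pscale c x) b.1, t))
    c0 (mf1 _) (fun=> f0 _)).
have mG : measurable_fun setT (fun x : pt R n => F (padd (pscale c x) b.1)).
  apply: (measurableT_comp mF) => /=.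
  by apply: measurable_padd => //; exact: measurable_pscale.
have c'0 : 0 <= c^-1 by rewrite invr_ge0 ltW.
rewrite (ge0_integralZl_EFin (lebd R n) measurableT (fun x _ => F0 _) mG c'0).
by rewrite (IH b.1 _ mF F0) muleA -EFinM -exprS.
Qed.

Lemma integral_lebd_shift n (b : pt R n) (f : pt R n -> \bar R) :
  measurable_fun setT f -> (forall x, 0 <= f x)%E ->
  (\int[lebd R n]_x f (padd x b) = \int[lebd R n]_x f x)%E.
Proof.
move=> mf f0; have := integral_lebd_affine b ltr01 mf f0.
by under eq_integral do rewrite pscale1; rewrite invr1 expr1n mul1e.
Qed.

End EuclideanSpace.

(** * Euclidean distance, boxes and dyadic cubes *)

Section EuclideanGeometry.
Variable R : realType.
Local Notation lam := (@lebesgue_measure R).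

Lemma sqdist_ge0 n (x y : pt R n) : 0 <= sqdist x y.
Proof. by elim: n x y => [|n IH] x y /=; rewrite ?addr_ge0 ?sqr_ge0. Qed.

Lemma sqdistC n (x y : pt R n) : sqdist x y = sqdist y x.
Proof.
elim: n x y => [|n IH] x y /=; first by ring.
by rewrite IH; ring.
Qed.

(** Adds one coordinate to the triangle inequality: after squaring, what remains is Cauchy-Schwarz
    for the plane vectors [(sqrt B, b)] and [(sqrt C, c)]. *)
Lemma sqrt_triangle (A B C b c : R) : 0 <= A -> 0 <= B -> 0 <= C ->
  Num.sqrt A <= Num.sqrt B + Num.sqrt C ->
  Num.sqrt (A + (b + c) ^+ 2) <=
  Num.sqrt (B + b ^+ 2) + Num.sqrt (C + c ^+ 2).
Proof.
move=> A0 B0 C0 h.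
set p := Num.sqrt (B + _); set q := Num.sqrt (C + _).
have p0 : 0 <= p by exact: sqrtr_ge0.
have q0 : 0 <= q by exact: sqrtr_ge0.
have pE : p ^+ 2 = B + b ^+ 2 by rewrite sqr_sqrtr// addr_ge0// sqr_ge0.
have qE : q ^+ 2 = C + c ^+ 2 by rewrite sqr_sqrtr// addr_ge0// sqr_ge0.
set be := Num.sqrt B in h; set ga := Num.sqrt C in h.
have be0 : 0 <= be by exact: sqrtr_ge0.
have ga0 : 0 <= ga by exact: sqrtr_ge0.
have beE : be ^+ 2 = B by rewrite sqr_sqrtr.
have gaE : ga ^+ 2 = C by rewrite sqr_sqrtr.
have AE : A <= (be + ga) ^+ 2.
  by rewrite -[A]sqr_sqrtr// ler_sqr ?nnegrE ?sqrtr_ge0// addr_ge0.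
have cs : be * ga + b * c <= p * q.
  have [lt0|ge0] := ltP (be * ga + b * c) 0.
    by apply: le_trans (ltW lt0) _; exact: mulr_ge0.
  rewrite -ler_sqr ?nnegrE ?mulr_ge0// exprMn pE qE -beE -gaE.
  have := sqr_ge0 (be * c - b * ga); nra.
rewrite -(ger0_norm (addr_ge0 p0 q0)) -sqrtr_sqr ler_wsqrtr//.
rewrite !sqrrD pE qE; move: AE; rewrite sqrrD beE gaE => AE.
by clearbody p q be ga; lra.
Qed.

Lemma sqdist_triangle n (x y z : pt R n) :
  Num.sqrt (sqdist x z) <= Num.sqrt (sqdist x y) + Num.sqrt (sqdist y z).
Proof.
elim: n x y z => [|n IH] x y z /=.
  have := @sqrt_triangle 0 0 0 ((x : R) - (y : R)) ((y : R) - (z : R)) (lexx 0) (lexx 0) (lexx 0).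
  rewrite !add0r sqrtr0 addr0 lexx => /(_ isT).
  by rewrite (_ : (x : R) - y + (y - z) = x - z)//; ring.
have := @sqrt_triangle _ _ _ ((x.2 : R) - (y.2 : R)) ((y.2 : R) - (z.2 : R))
  (sqdist_ge0 _ _) (sqdist_ge0 _ _) (sqdist_ge0 _ _) (IH x.1 y.1 z.1).
by rewrite (_ : (x.2 : R) - y.2 + (y.2 - z.2) = x.2 - z.2)//; ring.
Qed.

Lemma measurable_sqdist n (d : measure_display) (T : measurableType d)
    (f g : T -> pt R n) :
  measurable_fun setT f -> measurable_fun setT g ->
  measurable_fun setT (fun x => sqdist (f x) (g x)).
Proof.
elim: n f g => [|n IH] f g mf mg.
  by apply: measurable_funX; exact: measurable_funB.
apply: measurable_funD.
- by apply: IH; exact: measurableT_comp.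
- apply: measurable_funX; apply: measurable_funB; apply: measurableT_comp => //;
  exact: measurable_snd.
Qed.

Lemma measurable_sqrt : measurable_fun setT (@Num.sqrt R).
Proof.
apply: nondecreasing_measurable => // x y.
by move=> xy; exact: ler_wsqrtr.
Qed.

(** Boxes follow the recursion of [pt], so their measure is an explicit product. Balls are only
    compared with boxes, which avoids the exact volume of the unit ball. *)
Fixpoint pbox n (x : pt R n) (s : R) : set (pt R n) :=
  match n return pt R n -> set (pt R n) with
  | 0 => fun x => [set y : R | (x : R) - s < y < (x : R) + s]
  | n'.+1 => fun x => @pbox n' x.1 s `*`
      [set y : R | (x.2 : R) - s < y < (x.2 : R) + s]
  end x.

Lemma measurable_pbox n (x : pt R n) s : measurable (pbox x s).
Proof.
have mI (a : R) : measurable [set y : measurableTypeR R | a - s < y < a + s].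
  rewrite (_ : [set _ | _] = `]a - s, a + s[%classic); first exact: measurable_itv.
  by apply/seteqP; split => y /=; rewrite in_itv.
elim: n x => [|n IH] x; first exact: mI.
by apply: measurableX; [exact: IH|exact: mI].
Qed.

Lemma lebd_pbox n (x : pt R n) s : 0 <= s ->
  lebd R n (pbox x s) = ((2 * s) ^+ n.+1)%:E.
Proof.
move=> s0.
have lI (a : R) : lam [set y : R | a - s < y < a + s] = (2 * s)%:E.
  rewrite (_ : [set _ | _] = `]a - s, a + s[%classic); last first.
    by apply/seteqP; split => y /=; rewrite in_itv.
  rewrite lebesgue_measure_itv/= lte_fin.
  have [h|h] := ltP (a - s) (a + s).
    by rewrite -EFinD; congr EFin; ring.
  by congr EFin; lra.
have mI (a : R) : measurable [set y : measurableTypeR R | a - s < y < a + s].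
  exact: (@measurable_pbox 0 a s).
elim: n x => [|n IH] x; first by rewrite expr1; exact: lI.
have := @product_measure1E _ _ (pt R n) (measurableTypeR R) R (lebd R n) lam
  (pbox x.1 s) [set y : R | (x.2 : R) - s < y < (x.2 : R) + s]
  (@measurable_pbox n x.1 s) (mI _).
move=> E; rewrite exprSr EFinM -(IH x.1) -(lI x.2); exact: E.
Qed.

Lemma sqdist_lt_pbox n (x y : pt R n) s : 0 < s ->
  sqdist y x < s ^+ 2 -> pbox x s y.
Proof.
move=> s0; elim: n x y => [|n IH] x y /= h.
  by rewrite -ltr_distlC -ltr_sqr ?nnegrE ?normr_ge0 ?ltW// real_normK ?num_real// -sqrrN opprB.
have h1 := sqdist_ge0 y.1 x.1; have h2 := sqr_ge0 ((y.2 : R) - (x.2 : R)).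
split; first by apply: IH; lra.
rewrite /= -ltr_distlC -ltr_sqr ?nnegrE ?normr_ge0 ?ltW// real_normK ?num_real//.
rewrite -sqrrN opprB; lra.
Qed.

Lemma pbox_sqdist n (x y : pt R n) s : 0 < s ->
  pbox x s y -> sqdist y x < n.+1%:R * s ^+ 2.
Proof.
move=> s0.
have H (a b : R) : a - s < b < a + s -> (b - a) ^+ 2 < s ^+ 2.
  move=> /andP[h1 h2]; rewrite -subr_gt0 subr_sqr mulr_gt0//; lra.
elim: n x y => [|n IH] x y /= => [/H|[/IH h1 /H h2]]; first by rewrite mul1r.
by rewrite -(natr1 n.+1) mulrDl mul1r ltrD.
Qed.

Fixpoint pcst (a : R) n : pt R n :=
  match n return pt R n with
  | 0 => a
  | n'.+1 => (pcst a n', a)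
  end.

(** Centre [3/2 rho] and half-side [rho/2] give the open cube [(rho, 2 rho)^(n+1)]. It stays away
    from the origin, so a shift in it has length comparable to [rho], and its dyadic dilates are
    disjoint. *)
Definition pcube n (rho : R) : set (pt R n) := pbox (pcst (3 / 2 * rho) n) (rho / 2).
Arguments pcube : clear implicits.

Lemma measurable_pcube n rho : measurable (pcube n rho).
Proof. exact: measurable_pbox. Qed.

Lemma lebd_pcube n rho : 0 <= rho -> lebd R n (pcube n rho) = (rho ^+ n.+1)%:E.
Proof.
move=> rho0; rewrite lebd_pbox ?divr_ge0//.
by congr ((_ ^+ _)%:E); field.
Qed.

Lemma pcube_scale n (c rho : R) (h : pt R n) : 0 < c ->
  pcube n (c * rho) (pscale c h) <-> pcube n rho h.
Proof.
rewrite /pcube => c0.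
have H (a : R) : 3 / 2 * (c * rho) - c * rho / 2 < c * a <
    3 / 2 * (c * rho) + c * rho / 2 <->
   3 / 2 * rho - rho / 2 < a < 3 / 2 * rho + rho / 2.
  rewrite (_ : 3 / 2 * (c * rho) - c * rho / 2 = c * (3 / 2 * rho - rho / 2)); last by field.
  rewrite (_ : 3 / 2 * (c * rho) + c * rho / 2 = c * (3 / 2 * rho + rho / 2)); last by field.
  by rewrite !ltr_pM2l.
elim: n h => [|n IH] h /=; first exact: H.
by split=> -[/IH h1 /H h2].
Qed.

(** Used in both orders: two cubes that meet have a ratio of scales strictly between 1/2 and 2, so
    distinct dyadic ones never meet. *)
Lemma pcube_disjoint n (rho rho' : R) (h : pt R n) :
  pcube n rho h -> pcube n rho' h -> rho' < 2 * rho.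
Proof.
rewrite /pcube; elim: n h => [|n IH] h /=.
  by move=> /andP[? ?] /andP[? ?]; lra.
by move=> [/IH + _] [+ _]; exact.
Qed.

Lemma sqdist_padd_pcube n (rho : R) (x h : pt R n) : 0 < rho ->
  pcube n rho h -> 0 < sqdist (padd x h) x <= n.+1%:R * (2 * rho) ^+ 2.
Proof.
move=> rho0; rewrite /pcube.
have H (a b : R) : 3 / 2 * rho - rho / 2 < b < 3 / 2 * rho + rho / 2 ->
    0 < (a + b - a) ^+ 2 <= (2 * rho) ^+ 2.
  move=> /andP[h1 h2]; rewrite addrAC subrr add0r exprn_gt0/=; last by lra.
  by rewrite ler_sqr ?nnegrE; lra.
elim: n x h => [|n IH] x h /=; first by move=> /(H x); rewrite mul1r.
move=> [/(IH x.1)/andP[h1 h2] /(H x.2)/andP[h3 h4]].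
by rewrite addr_gt0//= -(natr1 n.+1) mulrDl mul1r lerD.
Qed.

Lemma pscale_double n (c : R) (h : pt R n) :
  pscale (2 * c) h = padd (pscale c h) (pscale c h).
Proof. by elim: n h => [|n IH] h /=; rewrite ?IH; [ring|congr pair; ring]. Qed.

End EuclideanGeometry.

(** * Integrals of negative powers, and the constant of the fractional kernel *)

Section DyadicIntegral.
Variable R : realType.

Lemma expr_half_lt (x : R) : 0 < x -> exists n : nat, 2^-1 ^+ n < x.
Proof.
move=> x0; exists (Num.bound x^-1).
rewrite exprVn invf_plt ?posrE ?exprn_gt0//.
apply: (lt_le_trans (archi_boundP _)); first by rewrite invr_ge0 ltW.
by rewrite -natrX ler_nat ltnW// ltn_expl.
Qed.

Lemma dyadic_scale (x rho : R) : 0 < x -> x < rho ->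
  exists j : nat, rho * 2^-1 ^+ j.+1 <= x < rho * 2^-1 ^+ j.
Proof.
move=> x0 xr; have rho0 : 0 < rho by exact: lt_trans xr.
have ex : exists j, rho * 2^-1 ^+ j <= x.
  have [n hn] := expr_half_lt (divr_gt0 x0 rho0).
  by exists n; rewrite mulrC -ler_pdivlMr// ltW.
case: (ex_minnP ex) => -[|m] hm hmin.
  by move: hm; rewrite expr0 mulr1 => /(lt_le_trans xr); rewrite ltxx.
exists m; rewrite hm/= ltNge; apply/negP => /hmin; by rewrite ltnn.
Qed.

(** Bounds the sum of the geometric series of ratio [2^-theta] by a multiple of [1 / theta]. For
    [y = theta * ln 2 <= ln 4], multiplying [1 + y <= e^y] by [e^-y >= 1/4] gives
    [y / 4 <= y e^-y <= 1 - e^-y]. *)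
Lemma powR_half_geometric (theta : R) : 0 < theta -> theta <= 2 ->
  theta * ln 2 / 4 <= 1 - 2^-1 `^ theta.
Proof.
move=> t0 t2.
have l0 : 0 < ln 2 :> R by rewrite ln_gt0// ltr1n.
have E1 : 2^-1 `^ theta = expR (- (theta * ln 2)) :> R.
  by rewrite /powR (gt_eqF (_ : (0 : R) < 2^-1))// lnV ?posrE// mulrN.
set y := theta * ln 2 in E1 *.
have y0 : 0 < y by exact: mulr_gt0.
have e4 : expR y <= 4.
  have -> : (4 : R) = expR (2 * ln 2).
    by rewrite expRM_natl lnK ?posrE// expr2; lra.
  by rewrite ler_expR ler_pM2r.
have ey : 1 + y <= expR y by exact: expR_ge1Dx.
have eN : expR (- y) * expR y = 1 by rewrite -expRD addNr expR0.
rewrite E1; set a := expR (- y) in eN *; set b := expR y in e4 ey eN *.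
have a0 : 0 < a by exact: expR_gt0.
have a4 : 1 <= a * 4 by rewrite -[leLHS]eN ler_pM2l.
rewrite ler_pdivrMr//; nra.
Qed.

Lemma ler_powRN (p a b : R) : 0 <= p -> 0 < a -> a <= b ->
  b `^ (- p) <= a `^ (- p).
Proof.
move=> p0 a0 ab; have b0 : 0 < b by exact: lt_le_trans ab.
rewrite !powRN lef_pV2 ?posrE ?powR_gt0//.
by apply: ge0_ler_powR => //; rewrite nnegrE ltW.
Qed.

Lemma powR_exprn (a p : R) n : 0 <= a -> (a ^+ n) `^ p = (a `^ p) ^+ n.
Proof.
move=> a0; rewrite -(powR_mulrn n a0) -(powR_mulrn n (powR_ge0 a p)).
by rewrite -!powRrM mulrC.
Qed.

Context (d : measure_display) (T : measurableType d).
Variable mu : {measure set T -> \bar R}.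

(** On the shell where [f] is between [s j.+1] and [s j], the integrand is at most its value at
    [s j.+1]; with the shell enlarged to the ball [B j], the contributions form a geometric sequence
    of ratio [2^-(N - p)]. The resulting [1 / (N - p)] is the rate that the kernel constants have to
    cancel. *)
Lemma dyadic_integral_le (f : T -> R) (A p : R) (N : nat) (rho : R) :
  measurable_fun setT f -> (forall x, 0 <= f x) -> 0 <= A -> 0 < rho ->
  0 < p -> p < N%:R -> N%:R - p <= 2 ->
  (forall s, 0 < s -> (mu [set x | (f x < s)%R] <= (A * s ^+ N)%:E)%E) ->
  (\int[mu]_(x in [set x | (f x < rho)%R]) (f x `^ (- p))%:E <=
   (4 / ln 2 * A * 2 `^ p * rho `^ (N%:R - p) / (N%:R - p))%:E)%E.
Proof.
move=> mf f0 A0 rho0 p0 pN Np2 vol.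
have mlt s : measurable [set x | (f x < s)%R].
  rewrite -[X in measurable X]setTI.
  by apply: measurable_fun_ltr.
set th := N%:R - p; have th0 : 0 < th by rewrite subr_gt0.
pose s j := rho * 2^-1 ^+ j.
have s0 j : 0 < s j by rewrite mulr_gt0// exprn_gt0.
pose B j := [set x | (f x < s j)%R].
pose g j x : \bar R := (((s j.+1) `^ (- p))%:E * (\1_(B j) x)%:E)%E.
have g0 j x : (0 <= g j x)%E by rewrite mule_ge0// lee_fin ?powR_ge0.
have mg j : measurable_fun setT (g j).
  apply/measurable_EFinP; apply: measurable_funM => //.
  exact/measurable_indic/mlt.
set D := [set x | (f x < rho)%R].
have mD : measurable D by exact: mlt.
apply: (@le_trans _ _ (\int[mu]_(x in D) \sum_(0 <= j <oo) g j x)%E).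
  apply: ge0_le_integral => //.
  - by move=> x _; rewrite lee_fin powR_ge0.
  - apply/measurable_EFinP; apply: measurable_funTS.
    by apply: (measurableT_comp (measurable_powR _)).
  - apply: measurable_funTS.
    by apply: ge0_emeasurable_sum.
  (* No shell contains a zero of [f]; there the integrand is 0, because 0 raised to a nonzero power
     is 0 by convention. *)
  move=> x Dx; have := f0 x; rewrite le_eqVlt => /predU1P[fx0|fx0].
    rewrite -fx0 powR0 ?oppr_eq0 ?gt_eqF//.
    by apply: nneseries_ge0 => *; exact: g0.
  have [j /andP[j1 j2]] := dyadic_scale fx0 Dx.
  apply: (@le_trans _ _ (g j x)).
    rewrite /g indicE mem_set//= mule1 lee_fin.
    by apply: ler_powRN => //; exact: ltW.
  apply: (le_trans _ (@nneseries_lim_ge _ (g ^~ x) predT 0 j.+1 _)) => //.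
  by rewrite big_nat_recr//= leeDr// sume_ge0.
rewrite integral_nneseries//; last by move=> j; exact: measurable_funTS.
set c := A * 2 `^ p * rho `^ th; set y := 2^-1 `^ th.
have c0 : 0 <= c by rewrite !mulr_ge0 ?powR_ge0.
have y0 : 0 < y by exact: powR_gt0.
have y1 := powR_half_geometric th0 Np2; rewrite -/y in y1.
have l0 : 0 < ln 2 :> R by rewrite ln_gt0// ltr1n.
have y2 : 0 < 1 - y by apply: lt_le_trans y1; rewrite !mulr_gt0.
have H j : (\int[mu]_(x in D) g j x <= (c * y ^+ j)%:E)%E.
  rewrite ge0_integralZl_EFin ?powR_ge0//; last first.
    by apply/measurable_EFinP/measurable_funTS; exact/measurable_indic/mlt.
  rewrite integral_indic//; last exact: mlt.
  apply: (@le_trans _ _ ((s j.+1 `^ (- p))%:E * (A * s j ^+ N)%:E))%E.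
    rewrite lee_wpmul2l ?lee_fin ?powR_ge0//.
    apply: le_trans (vol _ (s0 j)).
    apply: le_measure; rewrite ?inE; last exact: subIsetl.
    - by apply: measurableI => //; exact: mlt.
    - exact: mlt.
  rewrite -EFinM lee_fin.
  have -> : s j.+1 = s j * 2^-1 by rewrite /s exprS; ring.
  rewrite powRM ?(ltW (s0 j))// powRN -(powR_inv1 (ltW (ltr0n R 2)) : 2 `^ (-1) = 2^-1).
  rewrite -powRrM mulN1r opprK -powR_mulrn ?(ltW (s0 j))//.
  have -> : s j `^ N%:R = s j `^ th * s j `^ p.
    by rewrite -powRD ?subrK// (gt_eqF (s0 j)) implybT.
  have sp : s j `^ p != 0 by rewrite gt_eqF// powR_gt0.
  have -> : s j `^ th = rho `^ th * y ^+ j.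
    by rewrite /s powRM ?exprn_ge0 ?(ltW rho0)// powR_exprn.
  by rewrite /c le_eqVlt; apply/orP; left; apply/eqP; field.
apply: lime_le.
  by apply: is_cvg_nneseries => j _ _; exact: integral_ge0.
apply: nearW => n.
apply: (@le_trans _ _ (\sum_(0 <= j < n) (c * y ^+ j)%:E)%E).
  by apply: lee_sum => j _; exact: H.
rewrite sumEFin lee_fin.
have y1' : `|y| < 1 by rewrite ger0_norm ?ltW//; lra.
have := geometric_le_lim n c0 y0 y1'.
rewrite /series/= => /le_trans; apply.
have -> : 4 / ln 2 * A * 2 `^ p * rho `^ th / th = c * (4 / (ln 2 * th)).
  by rewrite /c; field; rewrite !gt_eqF.
rewrite ler_wpM2l// -[leLHS]mul1r ler_pdivrMr//.
have -> : 4 / (ln 2 * th) = (th * ln 2 / 4)^-1 by field; rewrite !gt_eqF.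
by rewrite ler_pdivlMl ?divr_gt0 ?mulr_gt0// mulr1.
Qed.
End DyadicIntegral.

(** * Comparison, linearity and Tonelli for nonnegative real integrands *)

Section IntegralComparison.
Context (R : realType) (d : measure_display) (T : measurableType d).
Variable mu : {measure set T -> \bar R}.

Lemma ge0_le_integral_setT (D : set T) (f g : T -> R) : measurable D ->
  measurable_fun setT f -> measurable_fun setT g ->
  (forall x, D x -> 0 <= f x) -> (forall x, 0 <= g x) ->
  (forall x, D x -> f x <= g x) ->
  (\int[mu]_(x in D) (f x)%:E <= \int[mu]_x (g x)%:E)%E.
Proof.
move=> mD mf mg f0 g0 fg; apply: (@le_trans _ _ (\int[mu]_(x in D) (g x)%:E)%E).
  apply: ge0_le_integral => //.
  - by apply/measurable_EFinP; exact: measurable_funTS.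
  - by apply/measurable_EFinP; exact: measurable_funTS.
apply: ge0_subset_integral => //; first exact/measurable_EFinP.
by move=> x _; rewrite lee_fin.
Qed.

Lemma ge0_le_integral_EFin (D : set T) (f g : T -> R) : measurable D ->
  measurable_fun setT f -> measurable_fun setT g ->
  (forall x, D x -> 0 <= f x) -> (forall x, D x -> f x <= g x) ->
  (\int[mu]_(x in D) (f x)%:E <= \int[mu]_(x in D) (g x)%:E)%E.
Proof.
move=> mD mf mg f0 fg; apply: ge0_le_integral => //.
- by apply/measurable_EFinP; exact: measurable_funTS.
- by apply/measurable_EFinP; exact: measurable_funTS.
Qed.

Lemma ge0_integralD_EFin (D : set T) (f g : T -> R) : measurable D ->
  measurable_fun setT f -> measurable_fun setT g ->
  (forall x, D x -> 0 <= f x) -> (forall x, D x -> 0 <= g x) ->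
  (\int[mu]_(x in D) (f x + g x)%:E =
   \int[mu]_(x in D) (f x)%:E + \int[mu]_(x in D) (g x)%:E)%E.
Proof.
move=> mD mf mg f0 g0; under eq_integral do rewrite EFinD.
apply: ge0_integralD => //.
- by apply/measurable_EFinP; exact: measurable_funTS.
- by apply/measurable_EFinP; exact: measurable_funTS.
Qed.

Lemma ge0_integralMl_EFin (D : set T) (c : R) (f : T -> R) : measurable D ->
  measurable_fun setT f -> (forall x, D x -> 0 <= f x) -> 0 <= c ->
  (\int[mu]_(x in D) (c * f x)%:E = c%:E * \int[mu]_(x in D) (f x)%:E)%E.
Proof.
move=> mD mf f0 c0; under eq_integral do rewrite EFinM.
apply: ge0_integralZl_EFin => //.
by apply/measurable_EFinP; exact: measurable_funTS.
Qed.

End IntegralComparison.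

Section TonelliReal.
Context (R : realType) (d : measure_display) (T : measurableType d).
Variable mu : {sigma_finite_measure set T -> \bar R}.
Variable f : T * T -> R.
Hypothesis mf : measurable_fun setT f.
Hypothesis f0 : forall p, 0 <= f p.

Let mEf : measurable_fun setT (EFin \o f).
Proof. exact/measurable_EFinP. Qed.

Let Ef0 p : (0 <= (EFin \o f) p)%E.
Proof. by rewrite lee_fin. Qed.

Lemma measurable_tonelli_EFin :
  measurable_fun setT (fun x => \int[mu]_y (f (x, y))%:E)%E.
Proof.
exact: (@measurable_fun_fubini_tonelli_F _ _ T T R mu (EFin \o f) mEf Ef0).
Qed.

Lemma tonelli_EFin :
  (\int[(mu \x mu)%E]_p (f p)%:E = \int[mu]_x \int[mu]_y (f (x, y))%:E)%E.
Proof. exact: (@fubini_tonelli1 _ _ T T R mu mu (EFin \o f) mEf Ef0). Qed.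

Lemma tonelli_EFin_sym :
  (\int[(mu \x mu)%E]_p (f p)%:E = \int[mu]_y \int[mu]_x (f (x, y))%:E)%E.
Proof. exact: (@fubini_tonelli2 _ _ T T R mu mu (EFin \o f) mEf Ef0). Qed.

End TonelliReal.

Section IntegralSwap.
Context (R : realType) (d : measure_display) (T : measurableType d).
Variable mu : {sigma_finite_measure set T -> \bar R}.

Lemma ge0_integral_swap (f : T * T -> R) :
  measurable_fun setT f -> (forall p, 0 <= f p) ->
  (\int[(mu \x mu)%E]_p (f (p.2, p.1))%:E = \int[(mu \x mu)%E]_p (f p)%:E)%E.
Proof.
move=> mf f0.
have mswap : measurable_fun setT (fun p : T * T => (p.2, p.1)).
  apply/measurable_fun_pairP; split.
    exact: measurable_snd.
  exact: measurable_fst.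
rewrite (@tonelli_EFin _ _ _ mu (fun p => f (p.2, p.1)))//.
  by rewrite tonelli_EFin_sym.
exact: (measurableT_comp mf mswap).
Qed.

End IntegralSwap.

(** * The normalising constant of the fractional kernel *)

Section GammaBounds.
Variable R : realType.
Local Notation lam := (@lebesgue_measure R).

Let gint (s : R) := (\int[lam]_(t in [set t : R | (0 < t)%R])
  ((powR t (s - 1)) * expR (- t))%R%:E)%E.

Let measurable_gpos : measurable [set t : measurableTypeR R | (0 < (t : R))%R].
Proof.
rewrite (_ : [set _ | _] = `]0, +oo[%classic); first exact: measurable_itv.
by apply/seteqP; split => t /=; rewrite in_itv/= andbT.
Qed.

Let measurable_gfun (s : R) :
  measurable_fun setT (fun t : measurableTypeR R => powR (t : R) (s - 1) * expR (- (t : R))).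
Proof.
apply: measurable_funM; first exact: measurable_powR.
by apply: measurableT_comp; [exact: measurable_expR|exact: oppr_measurable].
Qed.

Let gfun_ge0 (s t : R) : 0 <= powR t (s - 1) * expR (- t).
Proof. by rewrite mulr_ge0 ?powR_ge0 ?expR_ge0. Qed.

(** Uniform in [s]: on [[1, 2]] one has [t^(s - 1) >= 1/2] for every [s > 0], and [e^-t >= e^-2]. *)
Lemma Gamma_integral_ge (s : R) : 0 < s -> ((expR (-2) / 2)%:E <= gint s)%E.
Proof.
move=> s0.
have mI : measurable (`[1%R, 2%R]%classic : set R) by exact: measurable_itv.
apply: (@le_trans _ _ (\int[lam]_(t in `[1%R, 2%R]%classic) (expR (-2) / 2)%:E)%E).
  rewrite integral_cst//=.
  by rewrite lebesgue_measure_itv/= lte_fin ltr1n -EFinD -EFinM lee_fin; lra.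
apply: (@le_trans _ _ (\int[lam]_(t in `[1%R, 2%R]%classic)
    ((powR t (s - 1)) * expR (- t))%R%:E)%E).
  apply: ge0_le_integral => //.
  - by apply/measurable_EFinP; apply: measurable_funTS; exact: measurable_gfun.
  move=> t /=; rewrite in_itv/= => /andP[t1 t2]; rewrite lee_fin mulrC.
  apply: ler_pM => //; rewrite ?expR_ge0//; last by rewrite ler_expR lerN2.
  have [s1|s1] := leP 1 s.
    apply: (@le_trans _ _ 1); first by lra.
    by rewrite -[leLHS](powRr0 t) ler_powR// subr_ge0.
  rewrite -(opprB 1 s) powRN lef_pV2 ?posrE ?powR_gt0//; last lra.
  by apply: le_trans t2; apply: ler1_powR => //; lra.
apply: ge0_subset_integral => //.
- by apply/measurable_EFinP; apply: measurable_funTS; exact: measurable_gfun.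
- by move=> t _; rewrite lee_fin.
- by move=> t /=; rewrite in_itv/= => /andP[t1 _]; exact: lt_le_trans t1.
Qed.

(** Near 0 the power [t^(s - 1)] integrates to [O(1 / s)] by the dyadic bound for the absolute
    value; for [t >= 1] the integrand is below the exponential density. The rate [1 / s] is the pole
    of Gamma at 0. *)
Lemma Gamma_integral_le (s : R) : 0 < s -> s < 1 ->
  (gint s <= (16 / ln 2 / s + 1)%:E)%E.
Proof.
move=> s0 s1.
have l0 : 0 < ln 2 :> R by rewrite ln_gt0// ltr1n.
have mB : measurable [set t : R | (`|t| < 1)%R].
  rewrite -[X in measurable X]setTI.
  by apply: measurable_fun_ltr => //; exact: normr_measurable.
pose h1 (t : R) := ((fun t => `|t| `^ (- (1 - s))) \_ [set t : R | (`|t| < 1)%R]) t.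
have mh1 : measurable_fun setT h1.
  apply/(measurable_restrictT _ mB)/measurable_funTS.
  by apply: (measurableT_comp (measurable_powR _)); exact: normr_measurable.
have h10 t : 0 <= h1 t by rewrite /h1 patchE; case: ifP => // _; exact: powR_ge0.
have mh2 := @measurable_exponential_pdf R 1.
have h20 t := @exponential_pdf_ge0 R 1 ler01 t.
apply: (@le_trans _ _ (\int[lam]_t (h1 t + exponential_pdf 1 t)%:E)%E).
  apply: (@ge0_le_integral_setT R _ _ lam _ (fun t => powR t (s - 1) * expR (- t))).
  - exact: measurable_gpos.
  - exact: measurable_gfun.
  - exact: measurable_funD.
  - by move=> t _; exact: gfun_ge0.
  - by move=> t; rewrite addr_ge0.
  - move=> t /= t0; rewrite /h1 patchE exponential_pdfE ?(ltW t0)//.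
    rewrite mul1r mulN1r.
    case: ifPn => [/set_mem /= t1|].
      apply: (@le_trans _ _ (`|t| `^ (- (1 - s)))); last by rewrite lerDl expR_ge0.
      rewrite gtr0_norm// opprB ler_piMr ?powR_ge0//.
      by rewrite -expR0 ler_expR oppr_le0 ltW.
    rewrite notin_setE /= => /negP; rewrite -leNgt gtr0_norm// => t1.
    rewrite add0r ler_piMl ?expR_ge0//.
    by rewrite -[leRHS](powRr0 t) ler_powR//; lra.
under eq_integral do rewrite EFinD.
rewrite ge0_integralD//=; last 4 first.
- by move=> t _; rewrite lee_fin.
- exact/measurable_EFinP.
- by move=> t _; rewrite lee_fin.
- exact/measurable_EFinP.
rewrite integral_exponential_pdf// EFinD leeD2r//.
have -> : (\int[lam]_x (h1 x)%:E = \int[lam]_(t in [set t : R | (`|t| < 1)%R])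
    (`|t| `^ (- (1 - s)))%:E)%E.
  by rewrite [RHS]integral_mkcond restrict_EFin.
have := @dyadic_integral_le R _ _ lam (fun t => `|t|) 2 (1 - s) 1 1.
rewrite opprB addrCA subrr addr0 powR1 mulr1.
move=> /(_ (@normr_measurable R setT) (@normr_ge0 _ _)) H.
apply: (le_trans (H _ _ _ _ _ _)); rewrite ?subr_gt0//.
- by rewrite ltrBlDr ltrDl.
- by rewrite (le_trans (ltW s1))// ler1n.
- move=> r r0; rewrite expr1.
  suff E : lam [set x : R | (`|x| < r)%R] = (2 * r)%:E by rewrite -E; exact: lexx.
  rewrite (_ : [set _ | _] = `]- r, r[%classic); last first.
    by apply/seteqP; split => x /=; rewrite in_itv/= ltr_norml.
  rewrite lebesgue_measure_itv/= lte_fin -EFinD; case: ifPn => h;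
    by congr EFin; lra.
rewrite lee_fin ler_pM2r ?invr_gt0//.
have -> : 16 / ln 2 = 4 / ln 2 * 2 * 2 :> R by field; rewrite gt_eqF.
rewrite ler_pM2l ?mulr_gt0 ?invr_gt0//.
by apply: ler1_powR; rewrite ?ler1n//; lra.
Qed.

(** Needed because [fine] sends an infinite integral to 0, which would destroy the lower bound on
    [Gamma]. For [z = t / (2 p)], the inequality [ln z <= z] gives
    [t^p <= e^(p ln(2 p)) e^(t / 2)]. *)
Lemma Gamma_integral_lty (s : R) : 1 < s -> (gint s < +oo)%E.
Proof.
move=> s1; set p := s - 1; have p0 : 0 < p by rewrite subr_gt0.
set K := 2 * expR (p * ln (2 * p)).
apply: (@le_lt_trans _ _ (K%:E)); last by rewrite ltry.
have mh2 := @measurable_exponential_pdf R 2^-1.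
have h20 t : 0 <= exponential_pdf (2^-1 : R) t.
  by apply: exponential_pdf_ge0; rewrite invr_ge0.
have K0 : 0 <= K by rewrite mulr_ge0// expR_ge0.
apply: (@le_trans _ _ (\int[lam]_t (K * exponential_pdf 2^-1 t)%:E)%E).
  apply: (@ge0_le_integral_setT R _ _ lam _ (fun t => powR t (s - 1) * expR (- t))).
  - exact: measurable_gpos.
  - exact: measurable_gfun.
  - exact: measurable_funM.
  - by move=> t _; exact: gfun_ge0.
  - by move=> t; rewrite mulr_ge0// h20.
  - move=> t /= t0; rewrite exponential_pdfE ?(ltW t0)//.
    rewrite /K -/p /powR gt_eqF//.
    rewrite (_ : 2 * _ * _ = expR (p * ln (2 * p)) * expR (- 2^-1 * t)); last by field.
    rewrite -!expRD ler_expR.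
    have tp : 0 < t / (2 * p) by rewrite divr_gt0// mulr_gt0.
    have -> : t = t / (2 * p) * (2 * p) by field; rewrite gt_eqF.
    rewrite lnM ?posrE ?mulr_gt0 ?invr_gt0 ?mulr_gt0//.
    have := ltW (ln_sublinear tp); set z := t / (2 * p); set y := ln z => yz.
    have : p * y <= p * z by rewrite ler_pM2l.
    by rewrite mulrDr; lra.
under eq_integral do rewrite EFinM.
rewrite ge0_integralZl_EFin//=.
- by rewrite integral_exponential_pdf// mule1.
- by move=> t _; rewrite lee_fin h20.
- exact/measurable_EFinP.
Qed.

(** With [s = 1 - alpha / 2], the absolute value of [Gamma(- alpha / 2)] is [Gamma(s) * 2 / alpha].
    Since [s * Gamma(s)] is bounded, its reciprocal is at least a multiple of [alpha * (2 - alpha)],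
    and [alpha >= alpha0] handles the first factor. *)
Lemma kalpha_const_ge (d : nat) (alpha0 : R) : (1 < d)%N -> 0 < alpha0 ->
  exists c : R, 0 < c /\ forall alpha, alpha0 <= alpha -> alpha < 2 ->
    c * (2 - alpha) <=
    (powR 2 alpha * Gamma ((d%:R + alpha) / 2)) /
    (powR pi (d%:R / 2) * `|Gamma (- alpha / 2)|).
Proof.
move=> d0 a00.
have l0 : 0 < ln 2 :> R by rewrite ln_gt0// ltr1n.
set e := expR (-2) / 2 : R; have e0 : 0 < e by rewrite divr_gt0// expR_gt0.
set P := powR pi (d%:R / 2) : R; have P0 : 0 < P by rewrite powR_gt0// pi_gt0.
set C := 32 / ln 2 + 2 : R; have C0 : 0 < C by rewrite addr_gt0// divr_gt0.
exists (e * alpha0 / (2 * P * C)); split.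
  by rewrite divr_gt0 ?mulr_gt0.
move=> a a0a a2; have a_gt0 : 0 < a by exact: lt_le_trans a0a.
have d1 : 2 <= d%:R :> R by rewrite ler_nat.
have gint_ge0 t : (0 <= gint t)%E by apply: integral_ge0 => x _; rewrite lee_fin.
have G1 : e <= Gamma ((d%:R + a) / 2).
  rewrite /Gamma; case: ifPn => [s0|/negP[]]; last by rewrite divr_gt0//; lra.
  rewrite -lee_fin /Gamma0 fineK; first exact: Gamma_integral_ge.
  rewrite ge0_fin_numE; last exact: gint_ge0.
  apply: Gamma_integral_lty.
  by rewrite ltr_pdivlMr//; lra.
set s := - a / 2 + 1.
have s0 : 0 < s by rewrite /s; lra.
have s1 : s < 1 by rewrite /s; lra.
have fs : gint s \is a fin_num.
  rewrite ge0_fin_numE//; apply: le_lt_trans (Gamma_integral_le s0 s1) _.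
  exact: ltry.
have X0 : e <= Gamma0 s.
  by rewrite -lee_fin /Gamma0 fineK//; exact: Gamma_integral_ge.
have X1 : Gamma0 s <= 16 / ln 2 / s + 1.
  by rewrite -lee_fin /Gamma0 fineK//; exact: Gamma_integral_le.
have X2 : Gamma0 s * (2 - a) <= C.
  have -> : 2 - a = s * 2 by rewrite /s; field.
  rewrite /C; apply: (@le_trans _ _ ((16 / ln 2 / s + 1) * (s * 2))).
    by rewrite ler_pM2r// mulr_gt0.
  rewrite mulrDl mul1r lerD//; last by lra.
  by rewrite le_eqVlt; apply/orP; left; apply/eqP; field; rewrite !gt_eqF.
have -> : `|Gamma (- a / 2)| = Gamma0 s * 2 / a.
  rewrite /Gamma ifF; last by apply/negbTE; rewrite -leNgt; lra.
  rewrite -/s normrM gtr0_norm; last exact: lt_le_trans X0.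
  rewrite normfV mulNr normrN gtr0_norm; last by rewrite divr_gt0.
  by field; rewrite gt_eqF.
set X := Gamma0 s in X0 X1 X2 *; set G := Gamma _ in G1 *.
have XX : 0 < X by exact: lt_le_trans X0.
have p2 : 1 <= 2 `^ a by rewrite -[leLHS](powRr0 2) ler_powR ?ler1n// ltW.
have h : e * alpha0 <= 2 `^ a * G * a.
  apply: ler_pM => //; try exact: ltW.
  by rewrite -[leLHS]mul1r ler_pM// ltW.
have -> : 2 `^ a * G / (P * (X * 2 / a)) = (2 `^ a * G * a) / (2 * P * X).
  by field; rewrite !gt_eqF.
rewrite ler_pdivlMr ?mulr_gt0//.
apply: le_trans h.
have -> : e * alpha0 / (2 * P * C) * (2 - a) * (2 * P * X) =
  e * alpha0 * (X * (2 - a) / C) by field; rewrite !gt_eqF.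
by rewrite ler_piMr ?ler_pdivrMr ?mul1r ?(ltW (mulr_gt0 e0 a00)).
Qed.
End GammaBounds.

(** * A Faber-Krahn inequality uniform in alpha *)

Section FaberKrahn.
Context (R : realType) (dd : measure_display) (T : measurableType dd).
Variable mu : {sigma_finite_measure set T -> \bar R}.
Variables (N : nat) (dist : T -> T -> R) (add : T -> T -> T).
Variables (scale : R -> T -> T) (cube : R -> set T) (K : R).
Hypothesis mdist : measurable_fun setT (fun p : T * T => dist p.1 p.2).
Hypothesis madd : measurable_fun setT (fun p : T * T => add p.1 p.2).
Hypothesis mscale : forall c, measurable_fun setT (scale c).
Hypothesis mcube : forall rho, measurable (cube rho).
Hypothesis addA : associative add.
Hypothesis addC : commutative add.
Hypothesis scale1 : forall h, scale 1 h = h.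
Hypothesis scale_double : forall c h, scale (2 * c) h = add (scale c h) (scale c h).
Hypothesis mu_cube : forall rho, 0 <= rho -> mu (cube rho) = (rho ^+ N)%:E.
Hypothesis cube_scale : forall c rho h, 0 < c ->
  cube (c * rho) (scale c h) <-> cube rho h.
Hypothesis cube_disjoint : forall rho rho' h,
  cube rho h -> cube rho' h -> rho' < 2 * rho.
Hypothesis dist_cube : forall rho x h, 0 < rho -> cube rho h ->
  0 < dist (add x h) x <= K * rho.
Hypothesis K1 : 1 <= K.
Hypothesis integral_shift : forall b (f : T -> \bar R),
  measurable_fun setT f -> (forall x, 0 <= f x)%E ->
  (\int[mu]_x f (add x b) = \int[mu]_x f x)%E.
Hypothesis integral_scale : forall c (f : T -> \bar R), 0 < c ->
  measurable_fun setT f -> (forall x, 0 <= f x)%E ->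
  (\int[mu]_x f (scale c x) = ((c^-1) ^+ N)%:E * \int[mu]_x f x)%E.

Variable w : T -> R.
Hypothesis mw : measurable_fun setT w.

Let Q (p : T * T) : R := (w (add p.1 p.2) - w p.1) ^+ 2.

Let Q0 p : 0 <= Q p. Proof. exact: sqr_ge0. Qed.

Let mQ : measurable_fun setT Q.
Proof.
apply: measurable_funX; apply: measurable_funB.
- exact: (measurableT_comp mw madd).
- exact: (measurableT_comp mw measurable_fst).
Qed.

Let D (h : T) : \bar R := (\int[mu]_x (Q (x, h))%:E)%E.

Let D0 h : (0 <= D h)%E.
Proof. by apply: integral_ge0 => x _; rewrite lee_fin. Qed.

Let mD : measurable_fun setT D.
Proof.
apply: (@measurable_fun_fubini_tonelli_G _ _ T T R mu (fun p => (Q p)%:E)).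
- exact/measurable_EFinP.
- by move=> p; rewrite lee_fin.
Qed.

Let mQh h : measurable_fun setT (fun x => Q (x, h)).
Proof. exact: (measurableT_comp mQ (measurable_pair2 h)). Qed.

Let mQx x : measurable_fun setT (fun h => Q (x, h)).
Proof. exact: (measurableT_comp mQ (measurable_pair1 x)). Qed.

(** Split [w(x + 2 h) - w(x)] at [x + h]; by translation invariance both halves have squared norm
    [D h]. *)
Let D_double h : (D (add h h) <= 4%:E * D h)%E.
Proof.
have maddh : measurable_fun setT (fun x => add x h).
  exact: (measurableT_comp madd (measurable_pair2 h)).
have mQs : measurable_fun setT (fun x => Q (add x h, h)).
  exact: (measurableT_comp (mQh h) maddh).
have E : (D h = \int[mu]_x (Q (add x h, h))%:E)%E.
  apply/esym/(@integral_shift h (fun x => (Q (x, h))%:E)).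
  - exact/measurable_EFinP.
  - by move=> x; rewrite lee_fin.
have -> : (4%:E * D h = \int[mu]_x (2 * Q (add x h, h) + 2 * Q (x, h))%:E)%E.
  rewrite ge0_integralD_EFin//; last 4 first.
  - exact: measurable_funM.
  - exact: measurable_funM.
  - by move=> x _; rewrite mulr_ge0.
  - by move=> x _; rewrite mulr_ge0.
  rewrite !ge0_integralMl_EFin//.
  rewrite -E -/(D h) -ge0_muleDl ?lee_fin// -EFinD.
  by congr (_%:E * _)%E; lra.
apply: ge0_le_integral => //.
- by move=> x _; rewrite lee_fin.
- exact/measurable_EFinP.
- by apply/measurable_EFinP; apply: measurable_funD; exact: measurable_funM.
- move=> x _; rewrite lee_fin /Q /= addA.
  set a := w (add (add x h) h); set b := w (add x h); set c := w x.
  have := sqr_ge0 (a - b - (b - c)); lra.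
Qed.

Let D_dyadic j h : (D h <= (4 ^+ j)%:E * D (scale (2^-1 ^+ j) h))%E.
Proof.
elim: j => [|j IH]; first by rewrite !expr0 scale1 mul1e.
apply: (le_trans IH).
have -> : 2^-1 ^+ j = 2 * 2^-1 ^+ j.+1 :> R.
  by rewrite exprS mulrA divff ?mul1r.
rewrite scale_double (exprSr 4) EFinM -muleA lee_pmul2l//.
Qed.

Lemma integral_cube_ge (rho : R) : 0 < rho ->
  (mu [set x | (w x != 0)%R] <= (rho ^+ N / 2)%:E)%E ->
  ((rho ^+ N / 2)%:E * \int[mu]_x (w x ^+ 2)%:E <=
   \int[mu]_h ((\1_(cube rho) h)%:E * D h))%E.
Proof.
move=> rho0 small.
have mnz : measurable [set x | (w x != 0)%R].
  rewrite (_ : [set _ | _] = setT `&` w @^-1` (~` [set 0])).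
    by apply: mw => //; exact: measurableC.
  by apply/seteqP; split => x /=; [move/eqP|move=> [_ /eqP]].
have m1 : measurable_fun setT (\1_(cube rho) : T -> R) by exact: measurable_indic.
have mF : measurable_fun setT (fun p : T * T => ((\1_(cube rho) p.2 * Q p)%:E : \bar R)).
  apply/measurable_EFinP; apply: measurable_funM => //.
  exact: (measurableT_comp m1 measurable_snd).
have F0 (p : T * T) : (0 <= (\1_(cube rho) p.2 * Q p)%:E)%E.
  by rewrite lee_fin mulr_ge0.
have -> : (\int[mu]_h ((\1_(cube rho) h)%:E * D h) =
    \int[mu]_x \int[mu]_h (\1_(cube rho) h * Q (x, h))%:E)%E.
  rewrite (fubini_tonelli (fun p : T * T => (\1_(cube rho) p.2 * Q p)%:E))//.
  apply: eq_integral => h _ /=.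
  by rewrite ge0_integralMl_EFin.
have rN0 : 0 <= rho ^+ N / 2 by rewrite divr_ge0// exprn_ge0 ?ltW.
have mw2 : measurable_fun setT (fun x => w x ^+ 2) by exact: measurable_funX.
rewrite -ge0_integralMl_EFin//; last by move=> x _; exact: sqr_ge0.
apply: ge0_le_integral => //.
- by move=> x _; rewrite lee_fin mulr_ge0// sqr_ge0.
- by apply/measurable_EFinP; exact: measurable_funM.
- exact: (@measurable_fun_fubini_tonelli_F _ _ T T R mu
    (fun p => (\1_(cube rho) p.2 * Q p)%:E)).
move=> x _.
have maddx : measurable_fun setT (add x).
  exact: (measurableT_comp madd (measurable_pair1 x)).
pose Z := [set h | w (add x h) = 0].
have mZ : measurable Z.
  rewrite (_ : Z = setT `&` (w \o add x) @^-1` [set 0]).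
    by apply: (measurableT_comp mw maddx) => //; exact: measurable_set1.
  by apply/seteqP; split => y //= [].
(* For fixed [x], the shifts [h] with [w (add x h) != 0] form a translate of the set where [w != 0],
   of measure at most half that of the cube. For all other [h] the squared increment is
   [w x ^+ 2]. *)
have muZ : ((rho ^+ N / 2)%:E <= mu (cube rho `&` Z))%E.
  have h1 : (mu (~` Z) <= (rho ^+ N / 2)%:E)%E.
    apply: le_trans small; set NZ := [set x | _].
    have E1 : (\int[mu]_y (\1_NZ (add y x))%:E = \int[mu]_y (\1_NZ y)%:E)%E.
      apply: (@integral_shift x (fun y => (\1_NZ y)%:E)).
        by apply/measurable_EFinP; exact: measurable_indic.
      by move=> y; rewrite lee_fin.
    have E2 : (\int[mu]_y (\1_NZ y)%:E = mu NZ)%E by rewrite integral_indic// setIT.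
    have E3 : (\int[mu]_y (\1_NZ (add y x))%:E = mu (~` Z))%E.
      rewrite -(setIT (~` Z)) -integral_indic//; last exact: measurableC.
      apply: eq_integral => y _; congr EFin; rewrite !indicE; congr (_%:R).
      by apply: congr1; apply/idP/idP; rewrite !inE /NZ /Z /= addC => /eqP.
    by rewrite -E3 E1 E2.
  have h2 : (mu (cube rho) <= mu (cube rho `&` Z) + mu (~` Z))%E.
    have mcZ := measurableI _ _ (mcube rho) mZ; have mnZ := measurableC mZ.
    apply: (@le_trans _ _ (mu ((cube rho `&` Z) `|` ~` Z))).
      apply: le_measure; rewrite ?inE//; first exact: measurableU.
      by move=> y cy; case: (pselect (Z y)) => Zy; [left|right].
    exact: measureU2.
  have := le_trans h2 (leeD2l _ h1); rewrite (mu_cube (ltW rho0)) => h3.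
  rewrite -(@leeD2rE _ (rho ^+ N / 2)%:E)// -EFinD.
  by rewrite (_ : rho ^+ N / 2 + _ = rho ^+ N)//; field.
apply: (@le_trans _ _ (\int[mu]_h ((w x ^+ 2)%:E * (\1_(cube rho `&` Z) h)%:E))%E).
  have mcZ := measurableI _ _ (mcube rho) mZ.
  have m1Z : measurable_fun setT (\1_(cube rho `&` Z) : T -> R).
    exact: measurable_indic.
  under eq_integral do rewrite -EFinM.
  rewrite ge0_integralMl_EFin ?sqr_ge0//.
  rewrite integral_indic// setIT EFinM muleC.
  by apply: lee_wpmul2l => //; rewrite lee_fin sqr_ge0.
under eq_integral do rewrite -EFinM.
apply: ge0_le_integral_EFin => //.
- apply: measurable_funM => //.
  by apply: measurable_indic; exact: measurableI.
- by apply: measurable_funM => //; exact: mQx.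
- by move=> h _; rewrite mulr_ge0 ?sqr_ge0.
- move=> h _; rewrite !indicE in_setI.
  case: (boolP (h \in cube rho)) => hc /=; last by rewrite mulr0 mul0r.
  case: (boolP (h \in Z)) => [/set_mem hZ|_] /=; last by rewrite mulr0 mul1r.
  by rewrite mulr1 mul1r /Q /= hZ sub0r sqrrN.
Qed.

(** The factor 1/4 collects the half cube of shifts that reach a zero of [w] and the bound 1/2 for
    the scale factors. [K] enters because a shift in the cube of scale [rho] has length at most
    [K * rho], which bounds the kernel from below. *)
Lemma fractional_energy_ge (al kap rho : R) : al < 2 -> 0 <= al -> 0 <= kap ->
  0 < rho -> (mu [set x | (w x != 0)%R] <= (rho ^+ N / 2)%:E)%E ->
  ((kap / (2 - al) * (K `^ (- (N%:R + al)) * rho `^ (- al) / 4))%:E *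
     \int[mu]_x (w x ^+ 2)%:E <=
   \int[mu]_x \int[mu]_y
     ((w y - w x) ^+ 2 * (kap * dist y x `^ (- (N%:R + al))))%:E)%E.
Proof.
move=> al2 al0 kap0 rho0 small.
set p := N%:R + al; have p0 : 0 <= p by rewrite addr_ge0.
(* [J >= 1 / (2 - al)], while [2^(-j (2 - al)) >= 1 / 2] for all [j < J]. *)
set J := (Num.truncn (2 - al)^-1).+1.
have K0 : 0 < K by exact: lt_le_trans K1.
pose c j : R := 2^-1 ^+ j; have c0 j : 0 < c j by rewrite exprn_gt0.
pose b j : R := kap * (K * (c j * rho)) `^ (- p).
have b0 j : 0 <= b j by rewrite mulr_ge0 ?powR_ge0.
pose ind j (h : T) : R := \1_(cube (c j * rho)) h.
have mind j : measurable_fun setT (ind j) by exact: measurable_indic.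
pose G (q : T * T) : R := (\sum_(j < J) b j * ind j q.2) * Q q.
have G0 q : 0 <= G q.
  by rewrite mulr_ge0// sumr_ge0// => j _; rewrite mulr_ge0.
have mG : measurable_fun setT G.
  apply: measurable_funM => //; apply: measurable_sum => j.
  by apply: measurable_funM => //; exact: (measurableT_comp (mind j) measurable_snd).
pose H (q : T * T) : R := Q q * (kap * dist (add q.1 q.2) q.1 `^ (- p)).
have H0 q : 0 <= H q.
  by apply: mulr_ge0 => //; apply: mulr_ge0 => //; exact: powR_ge0.
have mH : measurable_fun setT H.
  apply: measurable_funM => //; apply: measurable_funM => //.
  apply: (measurableT_comp (measurable_powR _)).
  have mpair : measurable_fun setT (fun q : T * T => (add q.1 q.2, q.1)).
    by apply/measurable_fun_pairP; split; [exact: madd|exact: measurable_fst].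
  exact: (measurableT_comp mdist mpair).
have step1 : (\int[mu]_x \int[mu]_y
     ((w y - w x) ^+ 2 * (kap * dist y x `^ (- p)))%:E =
     \int[(mu \x mu)%E]_q (H q)%:E)%E.
  rewrite [RHS](tonelli_EFin mu mH H0); apply: eq_integral => x _.
  rewrite /H /=; transitivity (\int[mu]_h ((w (add h x) - w x) ^+ 2 *
      (kap * dist (add h x) x `^ (- p)))%:E)%E; last first.
    by apply: eq_integral => h _; rewrite (addC h x).
  apply/esym/(@integral_shift x (fun y =>
     ((w y - w x) ^+ 2 * (kap * dist y x `^ (- p)))%:E)).
  - apply/measurable_EFinP; apply: measurable_funM.
      by apply: measurable_funX; apply: measurable_funB.
    apply: measurable_funM => //.
    apply: (measurableT_comp (measurable_powR _)).
    exact: (measurableT_comp mdist (measurable_pair2 x)).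
  - by move=> y; rewrite lee_fin mulr_ge0 ?sqr_ge0// mulr_ge0// powR_ge0.
have step2 : (\int[(mu \x mu)%E]_q (G q)%:E <= \int[(mu \x mu)%E]_q (H q)%:E)%E.
  apply: ge0_le_integral_EFin => // -[x h] _.
  rewrite /G /H mulrC ler_wpM2l//=.
  (* The cubes are disjoint, so at most one term of the sum in [G] survives at [h]; outside all of
     them [G] vanishes. *)
  have [[j hj]|hno] := pselect (exists j : 'I_J, cube (c j * rho) h).
    rewrite (bigD1 j)//= big1 => [|i ij]; last first.
      rewrite /ind indicE memNset ?mulr0// => hi.
      have := cube_disjoint hi hj; have := cube_disjoint hj hi.
      have [ltij|ltji|/val_inj eij] := ltngtP i j; last by rewrite eij eqxx in ij.
      - move=> + _; rewrite mulrA ltr_pM2r// => /lt_geF.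
        rewrite /c -(subnK ltij) -addSnnS addSn exprS mulrA divff// mul1r.
        rewrite exprD ler_piMl ?exprn_ge0//.
        by rewrite exprn_ile1// invf_le1// ler1n.
      - move=> _; rewrite mulrA ltr_pM2r// => /lt_geF.
        rewrite /c -(subnK ltji) -addSnnS addSn exprS mulrA divff// mul1r.
        rewrite exprD ler_piMl ?exprn_ge0//.
        by rewrite exprn_ile1// invf_le1// ler1n.
    rewrite addr0 /ind indicE mem_set// mulr1 ler_wpM2l//.
    have /andP[d1 d2] := dist_cube x (mulr_gt0 (c0 j) rho0) hj.
    exact: ler_powRN.
  rewrite big1 ?mulr_ge0 ?powR_ge0// => j _.
  by rewrite /ind indicE memNset ?mulr0// => hj; apply: hno; exists j.
have mindD j : measurable_fun setT (fun h => (ind j h)%:E * D h)%E.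
  by apply: emeasurable_funM => //; exact/measurable_EFinP.
have indD0 j h : (0 <= (ind j h)%:E * D h)%E by rewrite mule_ge0// lee_fin.
have step3 : (\int[(mu \x mu)%E]_q (G q)%:E =
   \sum_(j < J) (b j)%:E * \int[mu]_h ((ind j h)%:E * D h))%E.
  rewrite (tonelli_EFin_sym mu mG G0).
  transitivity (\int[mu]_h (\sum_(j < J) (b j)%:E * ((ind j h)%:E * D h)))%E.
    apply: eq_integral => h _; rewrite /G /=.
    rewrite ge0_integralMl_EFin//; last first.
      by rewrite sumr_ge0// => j _; rewrite mulr_ge0.
    rewrite -sumEFin ge0_sume_distrl; last first.
      by move=> j _; rewrite lee_fin mulr_ge0.
    by apply: eq_bigr => j _; rewrite EFinM muleA.
  rewrite ge0_integral_sum//; last 2 first.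
  - by move=> j; apply: emeasurable_funM.
  - by move=> j h _; rewrite mule_ge0// lee_fin.
  by apply: eq_bigr => j _; rewrite ge0_integralZl_EFin.
(* Dilating to the cube of scale [rho] costs the Jacobian [c j ^+ N], and [D_dyadic] costs
   [c j ^+ 2]. Against the exponent [-(N + al)] of the kernel weight [b j], the power [2 - al] of
   [c j] remains. *)
have step4 j : ((c j ^+ N * c j ^+ 2 * (rho ^+ N / 2))%:E * \int[mu]_x (w x ^+ 2)%:E
    <= \int[mu]_h ((ind j h)%:E * D h))%E.
  have mf2 : measurable_fun setT (fun h => (ind j (scale (c j) h))%:E * D (scale (c j) h))%E.
    exact: (measurableT_comp (mindD j) (mscale (c j))).
  have m1D : measurable_fun setT (fun h => (\1_(cube rho) h)%:E * D h)%E.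
    apply: emeasurable_funM => //; apply/measurable_EFinP; exact: measurable_indic.
  have -> : (\int[mu]_h ((ind j h)%:E * D h) =
      (c j ^+ N)%:E * \int[mu]_h ((ind j (scale (c j) h))%:E * D (scale (c j) h)))%E.
    rewrite (@integral_scale (c j) _ (c0 j) (mindD j) (indD0 j)) muleA -EFinM.
    by rewrite -exprMn divff ?expr1n ?mul1e// gt_eqF.
  rewrite -mulrA EFinM -muleA lee_wpmul2l ?lee_fin ?exprn_ge0 ?(ltW (c0 j))//.
  apply: (@le_trans _ _ ((c j ^+ 2)%:E * \int[mu]_h ((\1_(cube rho) h)%:E * D h))%E).
    rewrite EFinM -muleA lee_wpmul2l ?lee_fin ?exprn_ge0 ?(ltW (c0 j))//.
    exact: integral_cube_ge.
  rewrite -ge0_integralZl_EFin ?exprn_ge0 ?(ltW (c0 j))//; last first.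
    by move=> h _; rewrite mule_ge0// lee_fin.
  apply: ge0_le_integral => //.
  - by move=> h _; rewrite !mule_ge0// lee_fin ?exprn_ge0 ?(ltW (c0 j)).
  - exact: emeasurable_funM.
  move=> h _; rewrite /ind !indicE.
  have -> : (scale (c j) h \in cube (c j * rho)) = (h \in cube rho).
    by apply/idP/idP; rewrite !inE => /(cube_scale _ _ (c0 j)).
  case: (h \in cube rho); last by rewrite !mul0e mule0.
  rewrite !mul1e; apply: (le_trans (lee_wpmul2l _ (D_dyadic j h))).
    by rewrite lee_fin exprn_ge0 ?(ltW (c0 j)).
  rewrite muleA -EFinM -/(c j) /c -exprM mulnC exprM -exprMn.
  by rewrite (_ : 2^-1 ^+ 2 * 4 = 1 :> R) ?expr1n ?mul1e//; field.
rewrite step1; apply: le_trans step2; rewrite step3.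
have W0 : (0 <= \int[mu]_x (w x ^+ 2)%:E)%E.
  by apply: integral_ge0 => x _; rewrite lee_fin sqr_ge0.
apply: (@le_trans _ _ (\sum_(j < J) (b j * (c j ^+ N * c j ^+ 2 * (rho ^+ N / 2)))%:E *
   \int[mu]_x (w x ^+ 2)%:E)%E); last first.
  by apply: lee_sum => j _; rewrite EFinM -muleA lee_wpmul2l ?lee_fin.
set B0 := kap * (K `^ (- p) * rho `^ (- al) / 4).
have B00 : 0 <= B0 by rewrite mulr_ge0// divr_ge0// mulr_ge0 ?powR_ge0.
have /truncn_itv/andP[Jle' /ltW Jge] : 0 <= (2 - al)^-1.
  by rewrite invr_ge0 subr_ge0 ltW.
have Jle j : (j < J)%N -> j%:R <= (2 - al)^-1.
  by move=> jJ; apply: le_trans Jle'; rewrite ler_nat.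
have bE j : (j < J)%N -> B0 <= b j * (c j ^+ N * c j ^+ 2 * (rho ^+ N / 2)).
  move=> jJ.
  have cp : c j `^ (- p) * (c j ^+ N * c j ^+ 2) = c j `^ (2 - al).
    rewrite -exprD -powR_mulrn ?(ltW (c0 j))// -powRD; last first.
      by rewrite (gt_eqF (c0 j)) implybT.
    by congr (_ `^ _); rewrite natrD /p; ring.
  have rp : rho `^ (- p) * rho ^+ N = rho `^ (- al).
    rewrite -powR_mulrn ?(ltW rho0)// -powRD; last by rewrite (gt_eqF rho0) implybT.
    by congr (_ `^ _); rewrite /p; ring.
  have -> : b j * (c j ^+ N * c j ^+ 2 * (rho ^+ N / 2)) =
      kap * (K `^ (- p) * rho `^ (- al) / 2 * c j `^ (2 - al)).
    rewrite /b powRM ?(ltW K0) ?mulr_ge0 ?(ltW (c0 j)) ?(ltW rho0)//.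
    rewrite powRM ?(ltW (c0 j)) ?(ltW rho0)// -cp -rp; by field.
  have half : 2^-1 <= c j `^ (2 - al).
    rewrite /c powR_exprn// -powR_mulrn ?powR_ge0// -powRrM.
    rewrite -[leLHS]powRr1//; apply: ger_powR.
      by rewrite invr_gt0 ltr0n/= invf_le1// ler1n.
    have := Jle j jJ; have : 0 < 2 - al by rewrite subr_gt0.
    by move=> a0 h; rewrite mulrC -ler_pdivlMr// mul1r.
  rewrite /B0 ler_wpM2l//.
  have := powR_ge0 K (- p); have := powR_ge0 rho (- al).
  set A := K `^ _; set B := rho `^ _ => B1 A1.
  have : A * B / 2 * 2^-1 <= A * B / 2 * c j `^ (2 - al).
    by rewrite ler_wpM2l// divr_ge0// mulr_ge0.
  lra.
rewrite -ge0_sume_distrl; last by move=> j _; rewrite lee_fin (le_trans B00)// bE.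
rewrite lee_wpmul2r// sumEFin lee_fin.
apply: (@le_trans _ _ (\sum_(j < J) B0)); last by apply: ler_sum => j _; exact: bE.
rewrite sumr_const card_ord -[leRHS]mulr_natl.
rewrite (_ : kap / (2 - al) * _ = (2 - al)^-1 * B0); last by rewrite /B0; ring.
by rewrite ler_wpM2r.
Qed.

End FaberKrahn.

(** * Caccioppoli inequality and the tail *)

Definition excess (R : realType) (T : Type) (u : T -> R) (l : R) (x : T) : R :=
  Num.max (u x - l) 0.

Section Caccioppoli.
Context (R : realType) (dd : measure_display) (T : measurableType dd).
Variable mu : {sigma_finite_measure set T -> \bar R}.
Variables (dist : T -> T -> R) (k : T -> T -> R) (M : R).
Local Notation mu2 := (mu \x mu)%E.
Hypothesis dist_ge0 : forall x y, 0 <= dist x y.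
Hypothesis mdist : measurable_fun setT (fun p : T * T => dist p.1 p.2).
Hypothesis mk : measurable_fun setT (fun p : T * T => k p.1 p.2).
Hypothesis k0 : forall x y, 0 <= k x y.
Hypothesis levy : forall x,
  (\int[mu]_y (Num.min 1 (dist y x ^+ 2) * k x y)%:E <= M%:E)%E.

Definition energy (u v : T -> R) : \bar R :=
  (\int[mu]_x \int[mu]_y ((u y - u x) * (v y - v x) * k x y)%:E)%E.

Lemma measurable_increment (f : T -> R) : measurable_fun setT f ->
  measurable_fun setT (fun p : T * T => f p.2 - f p.1).
Proof.
move=> mf; apply: measurable_funB.
- exact: (measurableT_comp mf measurable_snd).
- exact: (measurableT_comp mf measurable_fst).
Qed.

Let mE (f : T -> R) : measurable_fun setT f ->
  measurable_fun setT (fun p : T * T => (f p.2 - f p.1) ^+ 2 * k p.1 p.2).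
Proof.
by move=> mf; apply: measurable_funM => //; apply: measurable_funX;
  exact: measurable_increment.
Qed.

Let E0 (f : T -> R) p : 0 <= (f p.2 - f p.1) ^+ 2 * k p.1 p.2.
Proof. by rewrite mulr_ge0// sqr_ge0. Qed.

Lemma energyE (f : T -> R) : measurable_fun setT f ->
  energy f f = (\int[mu2]_p ((f p.2 - f p.1) ^+ 2 * k p.1 p.2)%:E)%E.
Proof.
by move=> mf; rewrite (tonelli_EFin mu (mE mf) (@E0 f)).
Qed.

(** Makes truncations with a cutoff admissible test functions. The increment of [g * w] is
    [g y (w y - w x) + w x (g y - g x)], and the square of the increment of [g] is at most [1 + L^2]
    times [min(1, dist^2)]. The bound [M] serves finiteness only and enters no estimate. *)
Lemma energy_cutoff_lty (u w g : T -> R) (L : R) :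
  measurable_fun setT u -> (\int[mu]_x (u x ^+ 2)%:E < +oo)%E ->
  (energy u u < +oo)%E ->
  measurable_fun setT w -> (forall x, 0 <= w x) -> (forall x, w x ^+ 2 <= u x ^+ 2) ->
  (forall x y, (w y - w x) ^+ 2 <= (u y - u x) ^+ 2) ->
  measurable_fun setT g -> (forall x, 0 <= g x <= 1) -> 0 <= L ->
  (forall x y, `|g y - g x| <= L * dist y x) ->
  (energy (fun x => g x * w x)%R (fun x => g x * w x)%R < +oo)%E.
Proof.
move=> mu_ u2 uE mw w0 wu dwu mg g01 L0 gL.
set Lm := 1 + L ^+ 2; have Lm0 : 0 <= Lm by rewrite addr_ge0// sqr_ge0.
have mphi : measurable_fun setT (fun x => g x * w x) by exact: measurable_funM.
rewrite (energyE mphi).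
pose m (p : T * T) := Num.min 1 (dist p.2 p.1 ^+ 2) * k p.1 p.2.
have m0 p : 0 <= m p by rewrite mulr_ge0// le_min ler01 sqr_ge0.
have mm : measurable_fun setT m.
  apply: measurable_funM => //; apply: measurable_minr => //.
  apply: measurable_funX.
  have mswap : measurable_fun setT (fun p : T * T => (p.2, p.1)).
    by apply/measurable_fun_pairP; split; [exact: measurable_snd|exact: measurable_fst].
  exact: (measurableT_comp mdist mswap).
pose W (p : T * T) := w p.1 ^+ 2 * m p.
have W0 p : 0 <= W p by rewrite mulr_ge0// sqr_ge0.
have mW : measurable_fun setT W.
  apply: measurable_funM => //; apply: measurable_funX.
  exact: (measurableT_comp mw measurable_fst).
apply: (@le_lt_trans _ _ (\int[mu2]_p
   (2 * ((u p.2 - u p.1) ^+ 2 * k p.1 p.2) + 2 * Lm * W p)%:E)%E).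
  apply: ge0_le_integral_EFin => //.
  - exact: (mE mphi).
  - apply: measurable_funD; apply: measurable_funM => //; exact: mE.
  - by move=> p _; exact: (@E0 (fun x => g x * w x)).
  move=> [x y] _ /=; rewrite /W /m /=.
  have h1 : (g y - g x) ^+ 2 <= Lm * Num.min 1 (dist y x ^+ 2).
    have /andP[gx0 gx1] := g01 x; have /andP[gy0 gy1] := g01 y.
    rewrite /Num.min; case: ifPn => _.
      rewrite mulr1 /Lm; have := sqr_ge0 L.
      suff : (g y - g x) ^+ 2 <= 1 by lra.
      by rewrite -[leRHS](expr1n _ 2) -real_normK ?num_real// ler_sqr ?nnegrE// ler_norml; lra.
    rewrite /Lm mulrDl mul1r -exprMn; apply: (@le_trans _ _ ((L * dist y x) ^+ 2)).
      by rewrite -real_normK ?num_real// ler_sqr ?nnegrE// mulr_ge0.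
    by rewrite lerDr sqr_ge0.
  have h2 := dwu x y.
  have h3 : (g y * w y - g x * w x) ^+ 2 <=
      2 * (w y - w x) ^+ 2 + 2 * (w x ^+ 2 * (g y - g x) ^+ 2).
    have /andP[gy0 gy1] := g01 y.
    have -> : g y * w y - g x * w x = g y * (w y - w x) + w x * (g y - g x) by ring.
    set a := w y - w x; set b := w x * (g y - g x).
    have -> : w x ^+ 2 * (g y - g x) ^+ 2 = b ^+ 2 by rewrite exprMn.
    apply: (@le_trans _ _ (2 * (g y * a) ^+ 2 + 2 * b ^+ 2)).
      have := sqr_ge0 (g y * a - b); lra.
    rewrite lerD2r ler_pM2l// exprMn ler_piMl ?sqr_ge0//.
    by rewrite exprn_ile1.
  have h4 : w x ^+ 2 * (g y - g x) ^+ 2 <= w x ^+ 2 * (Lm * Num.min 1 (dist y x ^+ 2)).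
    by rewrite ler_wpM2l// sqr_ge0.
  rewrite (_ : _ + _ = (2 * (u y - u x) ^+ 2 +
     2 * (w x ^+ 2 * (Lm * Num.min 1 (dist y x ^+ 2)))) * k x y); last by ring.
  by rewrite ler_wpM2r//; lra.
rewrite ge0_integralD_EFin//; last 4 first.
- by apply: measurable_funM => //; exact: mE.
- exact: measurable_funM.
- by move=> p _; rewrite mulr_ge0// (@E0 u).
- by move=> p _; apply: mulr_ge0 => //; exact: mulr_ge0.
have Lm2 : 0 <= 2 * Lm by rewrite mulr_ge0.
rewrite (ge0_integralMl_EFin mu2 measurableT mW (fun p _ => W0 p) Lm2).
rewrite (ge0_integralMl_EFin mu2 measurableT (mE mu_) (fun p _ => @E0 u p) (ler0n _ 2)).
rewrite -(energyE mu_) (tonelli_EFin mu mW W0) lte_add_pinfty//.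
  by apply: lte_mul_pinfty.
apply: lte_mul_pinfty; [by rewrite lee_fin|by []|].
apply: (@le_lt_trans _ _ (\int[mu]_x ((w x ^+ 2)%:E * M%:E))%E).
  apply: ge0_le_integral => //.
  - by move=> x _; apply: integral_ge0 => y _; rewrite lee_fin; exact: (W0 (x, y)).
  - exact: (measurable_tonelli_EFin mu mW W0).
  - by apply: emeasurable_funM => //; apply/measurable_EFinP; exact: measurable_funX.
  move=> x _.
  rewrite /W /= ge0_integralMl_EFin ?sqr_ge0//; last first.
    exact: (measurableT_comp mm (measurable_pair1 x)).
  by apply: lee_wpmul2l; [rewrite lee_fin sqr_ge0|exact: levy].
rewrite ge0_integralZr//; last 3 first.
- by apply/measurable_EFinP; exact: measurable_funX.
- by move=> x _; rewrite lee_fin sqr_ge0.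
- by apply: le_trans (levy point); apply: integral_ge0 => y _; rewrite lee_fin; exact: (m0 (point, y)).
apply: lte_mul_pinfty; last exact: ltry.
  by apply: integral_ge0 => x _; rewrite lee_fin sqr_ge0.
rewrite ge0_fin_numE; last by apply: integral_ge0 => x _; rewrite lee_fin sqr_ge0.
apply: le_lt_trans u2; apply: ge0_le_integral_EFin => //.
- exact: measurable_funX.
- exact: measurable_funX.
- by move=> x _; exact: sqr_ge0.
Qed.

(** [F] below is the integrand of the tested inequality and [H] that of the right-hand side.
    Pointwise, [F + H] dominates the energy density of [eta * (u - l)_+], while the integral of [F]
    is nonpositive. *)
Lemma caccioppoli (u eta : T -> R) (B : set T) (L l : R) :
  measurable_fun setT u -> (\int[mu]_x (u x ^+ 2)%:E < +oo)%E ->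
  (energy u u < +oo)%E ->
  (forall phi : T -> R, measurable_fun setT phi ->
    (\int[mu]_x (phi x ^+ 2)%:E < +oo)%E -> (energy phi phi < +oo)%E ->
    (forall x, ~ B x -> phi x = 0) -> (forall x, 0 <= phi x) ->
    (energy u phi <= 0)%E) ->
  measurable_fun setT eta -> (forall x, 0 <= eta x <= 1) -> 0 <= L ->
  (forall x y, `|eta y - eta x| <= L * dist y x) ->
  (forall x, ~ B x -> eta x = 0) -> 0 <= l ->
  (energy (fun x => eta x * excess u l x)%R (fun x => eta x * excess u l x)%R <=
   \int[mu2]_p (excess u l p.1 * excess u l p.2 *
                 (eta p.2 - eta p.1) ^+ 2 * k p.1 p.2)%:E)%E.
Proof.
move=> mu_ u2 uE test meta eta01 L0 etaL etaB l0; set w := excess u l.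
have mw : measurable_fun setT w.
  by apply: measurable_maxr => //; exact: measurable_funB.
have w0 x : 0 <= w x by rewrite /w /excess le_max lexx orbT.
have wu x : w x ^+ 2 <= u x ^+ 2.
  rewrite /w /excess /Num.max; case: ifPn => h; first by rewrite expr0n sqr_ge0.
  by rewrite -leNgt in h; rewrite ler_sqr ?nnegrE; lra.
have dwu x y : (w y - w x) ^+ 2 <= (u y - u x) ^+ 2.
  rewrite -(real_normK (num_real (w y - w x))) -(real_normK (num_real (u y - u x))).
  rewrite ler_sqr ?nnegrE//.
  have := ler_norm (u y - u x); have := ler_norm (- (u y - u x)); rewrite normrN.
  rewrite ler_norml /w /excess /Num.max; case: ifPn => h1; case: ifPn => h2;
    rewrite -?leNgt in h1 h2 => n1 n2; apply/andP; split; lra.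
pose g x := eta x ^+ 2.
have mg : measurable_fun setT g by exact: measurable_funX.
have g01 x : 0 <= g x <= 1.
  by have /andP[e0 e1] := eta01 x; rewrite sqr_ge0 exprn_ile1.
have gL x y : `|g y - g x| <= (2 * L) * dist y x.
  have /andP[a0 a1] := eta01 x; have /andP[b0 b1] := eta01 y.
  rewrite /g subr_sqr normrM mulrC -mulrA ler_pM//.
  by rewrite ger0_norm; lra.
have L20 : 0 <= 2 * L by rewrite mulr_ge0.
pose phi x := g x * w x.
have mphi : measurable_fun setT phi by exact: measurable_funM.
have phiE : (energy phi phi < +oo)%E.
  exact: (energy_cutoff_lty mu_ u2 uE mw w0 wu dwu mg g01 L20 gL).
have phi0 x : 0 <= phi x by rewrite mulr_ge0//; have /andP[] := g01 x.
have phi2 : (\int[mu]_x (phi x ^+ 2)%:E < +oo)%E.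
  apply: le_lt_trans u2; apply: ge0_le_integral_EFin => //.
  - exact: measurable_funX.
  - exact: measurable_funX.
  - by move=> x _; exact: sqr_ge0.
  - move=> x _; apply: le_trans (wu x); rewrite exprMn.
    rewrite ler_piMl ?sqr_ge0// exprn_ile1//; by have /andP[] := g01 x.
have phiB x : ~ B x -> phi x = 0.
  by move=> /etaB h; rewrite /phi /g h expr0n/= mul0r.
have := test _ mphi phi2 phiE phiB phi0.
pose F (p : T * T) := (u p.2 - u p.1) * (phi p.2 - phi p.1) * k p.1 p.2.
pose H (p : T * T) := w p.1 * w p.2 * (eta p.2 - eta p.1) ^+ 2 * k p.1 p.2.
pose psi x := eta x * w x.
have mpsi : measurable_fun setT psi by exact: measurable_funM.
have mF : measurable_fun setT F.
  apply: measurable_funM => //.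
  by apply: measurable_funM; exact: measurable_increment.
have mH : measurable_fun setT H.
  apply: measurable_funM => //; apply: measurable_funM; last first.
    by apply: measurable_funX; exact: measurable_increment.
  apply: measurable_funM.
  - exact: (measurableT_comp mw measurable_fst).
  - exact: (measurableT_comp mw measurable_snd).
have H0 p : 0 <= H p.
  by rewrite mulr_ge0// mulr_ge0 ?sqr_ge0// mulr_ge0.
(* [F] changes sign, so identifying the iterated with the product integral requires integrability;
   the energy densities of [u] and [phi] dominate it. *)
have iF : mu2.-integrable setT (EFin \o F).
  apply/integrableP; split; first exact/measurable_EFinP.
  apply: (@le_lt_trans _ _ (\int[mu2]_p ((u p.2 - u p.1) ^+ 2 * k p.1 p.2 +
     (phi p.2 - phi p.1) ^+ 2 * k p.1 p.2)%:E)%E).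
    apply: (@ge0_le_integral_EFin _ _ _ mu2 _ (fun p => `|F p|)) => //.
    - exact: measurableT_comp.
    - by apply: measurable_funD; exact: mE.
    - move=> p _; rewrite /F normrM (ger0_norm (k0 _ _)) -mulrDl ler_wpM2r//.
      set a := u p.2 - u p.1; set b := phi p.2 - phi p.1.
      have := sqr_ge0 (`|a| - `|b|); rewrite normrM -(real_normK (num_real a)) -(real_normK (num_real b)).
      have := normr_ge0 a; have := normr_ge0 b; nra.
  rewrite (@ge0_integralD_EFin _ _ _ mu2 setT _ _ measurableT (mE mu_) (mE mphi)
     (fun p _ => @E0 u p) (fun p _ => @E0 phi p)).
  rewrite -(energyE mu_) -(energyE mphi).
  by apply: lte_add_pinfty; [exact: uE|exact: phiE].
have -> : energy u phi = (\int[mu2]_p (F p)%:E)%E.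
  exact: (@integral12_prod_meas1 _ _ T T R mu mu (EFin \o F)).
move=> F_le0.
rewrite (energyE mpsi) -/H.
have [Hoo|Hfin] := eqVneq (\int[mu2]_p (H p)%:E)%E +oo%E.
  by rewrite Hoo leey.
have iH : mu2.-integrable setT (EFin \o H).
  apply/integrableP; split; first exact/measurable_EFinP.
  under eq_integral do rewrite /= ger0_norm//.
  by rewrite ltey.
apply: (@le_trans _ _ (\int[mu2]_p (F p + H p)%:E)%E).
  apply: (@ge0_le_integral_EFin _ _ _ mu2 setT
    (fun p => (psi p.2 - psi p.1) ^+ 2 * k p.1 p.2) (fun p => F p + H p)).
  - exact: measurableT.
  - exact: (mE mpsi).
  - exact: measurable_funD.
  - by move=> p _; exact: (@E0 psi p).
  move=> [x y] _; rewrite /F /H -mulrDl ler_wpM2r//= /psi /phi /g.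
  have /andP[a0 a1] := eta01 x; have /andP[b0 b1] := eta01 y.
  (* If both values of [u] exceed [l], the increments of [u] and [w] agree. If just one does, the
     second factor has the sign of the increment of [u], which is at least as large in modulus as
     that of [w]. If neither does, the second factor is 0. *)
  have key : (w y - w x) * (eta y ^+ 2 * w y - eta x ^+ 2 * w x) <=
      (u y - u x) * (eta y ^+ 2 * w y - eta x ^+ 2 * w x).
    have ex0 := sqr_ge0 (eta x); have ey0 := sqr_ge0 (eta y).
    move: ex0 ey0; rewrite /w /excess /Num.max.
    set ex := eta x ^+ 2; set ey := eta y ^+ 2 => ex0 ey0.
    case: ifPn => h1; case: ifPn => h2; rewrite -?leNgt in h1 h2.
    - lra.
    - have h1' : 0 <= l - u y by lra.
      have := mulr_ge0 (mulr_ge0 ex0 h2) h1'; lra.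
    - have h2' : 0 <= l - u x by lra.
      have := mulr_ge0 (mulr_ge0 ey0 h1) h2'; lra.
    - lra.
  apply: le_trans (lerD key (lexx _)).
  by rewrite le_eqVlt; apply/orP; left; apply/eqP; ring.
under eq_integral do rewrite EFinD.
rewrite (integralD_EFin measurableT iF iH) -[leRHS]add0e.
exact: leeD2r.
Qed.

End Caccioppoli.

Lemma integral_indicM (R : realType) (dd : measure_display) (T : measurableType dd)
    (mu : {measure set T -> \bar R}) (D : set T) (f : T -> R) :
  (\int[mu]_x (\1_D x * f x)%:E = \int[mu]_(x in D) (f x)%:E)%E.
Proof.
rewrite [RHS]integral_mkcond; apply: eq_integral => x _.
by rewrite patchE indicE; case: (x \in D); rewrite ?mul1r ?mul0r.
Qed.

(** * The cutoff term: a local L^2 part and a tail *)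

Section CrossTerm.
Context (R : realType) (dd : measure_display) (T : measurableType dd).
Variable mu : {sigma_finite_measure set T -> \bar R}.
Variables (N : nat) (dist : T -> T -> R) (k : T -> T -> R) (cK al : R).
Local Notation mu2 := (mu \x mu)%E.
Hypothesis N2 : (2 <= N)%N.
Hypothesis dist_ge0 : forall x y, 0 <= dist x y.
Hypothesis distC : forall x y, dist x y = dist y x.
Hypothesis dist_triangle : forall x y z, dist x z <= dist x y + dist y z.
Hypothesis mdist : measurable_fun setT (fun p : T * T => dist p.1 p.2).
Hypothesis vol : forall x s, 0 < s ->
  (mu [set y | (dist y x < s)%R] <= (2 ^+ N * s ^+ N)%:E)%E.
Hypothesis mk : measurable_fun setT (fun p : T * T => k p.1 p.2).
Hypothesis k0 : forall x y, 0 <= k x y.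
Hypothesis cK0 : 0 < cK.
Hypothesis al0 : 0 < al.
Hypothesis al2 : al < 2.
Hypothesis upper : {ae mu2, forall p : T * T,
  k p.1 p.2 <= cK * (2 - al) * dist p.2 p.1 `^ (- (N%:R + al))}.

Lemma measurable_dist_fst x : measurable_fun setT (fun y => dist y x).
Proof. exact: (measurableT_comp mdist (measurable_pair2 x)). Qed.

Lemma measurable_dist_ball x s : measurable [set y | dist y x < s].
Proof.
rewrite -[X in measurable X]setTI.
by apply: measurable_fun_ltr => //; exact: measurable_dist_fst.
Qed.

(** The exponent [p = N + al - 2] falls short of [N] by [2 - al], whence the denominator. Bounding
    [2^p] by [2^N] and [2^(2 - al)] by 4 keeps the numerical constant free of [al]. *)
Lemma integral_sq_dist_le x (r : R) : 0 < r ->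
  (\int[mu]_(y in [set y | (dist y x < 2 * r)%R])
     (dist y x ^+ 2 * dist y x `^ (- (N%:R + al)))%:E <=
   (16 / ln 2 * 4 ^+ N * r `^ (2 - al) / (2 - al))%:E)%E.
Proof.
move=> r0; have al0' := al0; have al2' := al2.
have l0 : 0 < ln 2 :> R by rewrite ln_gt0// ltr1n.
have a2 : 0 < 2 - al by rewrite subr_gt0.
set p := N%:R + al - 2.
have N2' : 2 <= N%:R :> R by rewrite ler_nat.
have p0 : 0 < p by rewrite /p; lra.
have r20 : 0 < 2 * r by rewrite mulr_gt0.
have Np : N%:R - p = 2 - al by rewrite /p; ring.
have := @dyadic_integral_le R _ T mu (fun y => dist y x) (2 ^+ N) p N (2 * r)
  (measurable_dist_fst x) (fun y => dist_ge0 y x) (exprn_ge0 _ (ler0n _ 2)) r20 p0.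
rewrite Np => /(_ _ _ (vol x)) H.
apply: (le_trans _ (le_trans (H _ _) _)).
- rewrite le_eqVlt; apply/orP; left; apply/eqP; apply: eq_integral => y _.
  congr EFin; have := dist_ge0 y x; rewrite le_eqVlt => /predU1P[<-|d0].
    by rewrite expr0n/= mul0r powR0// oppr_eq0 gt_eqF.
  rewrite -powR_mulrn ?(ltW d0)// -powRD ?(gt_eqF d0) ?implybT//.
  by congr (_ `^ _); rewrite /p; ring.
- by rewrite /p; lra.
- lra.
- rewrite lee_fin ler_pM2r ?invr_gt0// powRM ?(ltW r0)//.
  have h1 : 2 `^ p <= 2 ^+ N.
    by rewrite -powR_mulrn// ler_powR ?ler1n//; lra.
  have h2 : 2 `^ (2 - al) <= 4.
    have -> : 4 = 2 `^ 2 :> R by rewrite powR_mulrn//; lra.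
    by rewrite ler_powR ?ler1n//; lra.
  have r1 := powR_ge0 r (2 - al).
  rewrite mulrA ler_wpM2r//.
  have -> : 16 / ln 2 * 4 ^+ N = 4 / ln 2 * 2 ^+ N * 2 ^+ N * 4 :> R.
    have -> : 4 ^+ N = 2 ^+ N * 2 ^+ N :> R by rewrite -exprMn; congr (_ ^+ _); lra.
    by ring.
  set Z := 4 / ln 2 * 2 ^+ N.
  have Z0 : 0 <= Z by rewrite mulr_ge0// ?exprn_ge0// divr_ge0// ltW.
  apply: ler_pM => //; rewrite ?powR_ge0//; last by rewrite ler_wpM2l.
  by rewrite mulr_ge0// powR_ge0.
Qed.

(** Pairs are sorted by the ball [B] of radius [rho]. Inside, [w x * w y] is at most the mean of the
    squares and the Lipschitz bound on [eta] compensates the kernel. A mixed pair counts only if its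
    inner point is within [rho''] of [x0]; it is then separated from the outer one, [k] compares
    with the kernel centred at [x0], and the double integral becomes a product. Outer pairs
    contribute 0. The majorant [up] frees the tail from the level. *)
Lemma cross_term_le (w up eta : T -> R) (x0 : T) (L r rho rho'' : R) :
  measurable_fun setT w -> (forall x, 0 <= w x) ->
  measurable_fun setT up -> (forall x, w x <= up x) ->
  measurable_fun setT eta -> (forall x, 0 <= eta x <= 1) -> 0 <= L ->
  (forall x y, `|eta y - eta x| <= L * dist y x) ->
  0 < rho'' -> rho'' < rho -> rho <= r -> r / 2 <= rho ->
  (forall x, rho'' <= dist x x0 -> eta x = 0) ->
  (\int[mu2]_p (w p.1 * w p.2 * (eta p.2 - eta p.1) ^+ 2 * k p.1 p.2)%:E <=
   (16 / ln 2 * 4 ^+ N * cK * L ^+ 2 * r `^ (2 - al))%:E *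
     \int[mu]_(x in [set x | (dist x x0 < rho)%R]) (w x ^+ 2)%:E +
   (2 * cK * (2 - al) * (1 - rho'' / rho) `^ (- (N%:R + al)))%:E *
     (\int[mu]_(x in [set x | (dist x x0 < rho)%R]) (w x)%:E *
      \int[mu]_(y in ~` [set x | (dist x x0 < r / 2)%R])
         (up y / dist y x0 `^ (N%:R + al))%:E))%E.
Proof.
move=> mw w0 mup wup meta eta01 L0 etaL r''0 r''r rr r2 etaB.
have l0 : 0 < ln 2 :> R by rewrite ln_gt0// ltr1n.
have a2 : 0 < 2 - al by rewrite subr_gt0.
have rho0 : 0 < rho by exact: lt_trans r''r.
have r0 : 0 < r by exact: lt_le_trans rr.
set tau := 1 - rho'' / rho.
have tau0 : 0 < tau by rewrite /tau subr_gt0 ltr_pdivrMr// mul1r.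
set P := N%:R + al; have P0 : 0 < P by rewrite addr_gt0// ltr0n; exact: leq_trans N2.
set B := [set x | (dist x x0 < rho)%R].
set C := ~` [set x | (dist x x0 < r / 2)%R].
have mB : measurable B by exact: measurable_dist_ball.
have mC : measurable C by apply: measurableC; exact: measurable_dist_ball.
have up0 x : 0 <= up x by exact: le_trans (w0 x) (wup x).
pose H1 x : R := \1_B x * w x.
pose H2 y : R := \1_C y * (up y / dist y x0 `^ P).
have H10 x : 0 <= H1 x by rewrite mulr_ge0.
have H20 x : 0 <= H2 x by rewrite mulr_ge0// divr_ge0// powR_ge0.
have mH1 : measurable_fun setT H1.
  by apply: measurable_funM => //; exact: measurable_indic.
have mH2 : measurable_fun setT H2.
  apply: measurable_funM; first exact: measurable_indic.
  apply: measurable_funM => //.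
  rewrite (_ : (fun y => _) = (fun y => dist y x0 `^ (- P))); last first.
    by apply/funext => y; rewrite powRN.
  by apply: (measurableT_comp (measurable_powR _)); exact: measurable_dist_fst.
set c2 := cK * (2 - al) * tau `^ (- P).
have c20 : 0 <= c2 by rewrite !mulr_ge0 ?powR_ge0 ?ltW.
pose h (p : T * T) := c2 * (H1 p.1 * H2 p.2).
have h0 p : 0 <= h p by rewrite mulr_ge0// mulr_ge0.
have mh : measurable_fun setT h.
  apply: measurable_funM => //; apply: measurable_funM.
  - exact: (measurableT_comp mH1 measurable_fst).
  - exact: (measurableT_comp mH2 measurable_snd).
set c1 := L ^+ 2 * (cK * (2 - al)).
have c10 : 0 <= c1.
  by apply: mulr_ge0; [exact: sqr_ge0|apply: mulr_ge0; exact: ltW].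
have mswap : measurable_fun setT (fun p : T * T => (p.2, p.1)).
  by apply/measurable_fun_pairP; split; [exact: measurable_snd|exact: measurable_fst].
have md2 : measurable_fun setT (fun p : T * T => dist p.2 p.1).
  exact: (measurableT_comp mdist mswap).
pose V (p : T * T) : R := \1_[set p : T * T | (dist p.2 p.1 < 2 * r)%R] p *
   (dist p.2 p.1 ^+ 2 * dist p.2 p.1 `^ (- P)).
have V0 p : 0 <= V p by rewrite mulr_ge0// mulr_ge0 ?sqr_ge0 ?powR_ge0.
have mV : measurable_fun setT V.
  apply: measurable_funM.
    apply: measurable_indic; rewrite -[X in measurable X]setTI.
    exact: measurable_fun_ltr.
  apply: measurable_funM; first exact: measurable_funX.
  exact: (measurableT_comp (measurable_powR _) md2).
pose g (p : T * T) := c1 * (\1_B p.1 * w p.1 ^+ 2 * V p).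
have g0 p : 0 <= g p.
  by rewrite mulr_ge0// mulr_ge0// mulr_ge0// sqr_ge0.
have mw2 : measurable_fun setT (fun x => \1_B x * w x ^+ 2 : R).
  by apply: measurable_funM; [exact: measurable_indic|exact: measurable_funX].
have mg : measurable_fun setT g.
  apply: measurable_funM => //; apply: measurable_funM => //.
  exact: (measurableT_comp mw2 measurable_fst).
have half0 : 0 <= 2^-1 :> R by rewrite invr_ge0.
have hg0 p : 0 <= 2^-1 * g p by exact: mulr_ge0.
have aux x y k' : B x -> ~ B y -> 0 <= k' ->
    k' <= cK * (2 - al) * dist y x `^ (- P) ->
    w x * w y * (eta y - eta x) ^+ 2 * k' <= h (x, y).
  move=> Bx By k'0 k'le; have Dy : rho <= dist y x0 by rewrite leNgt; exact/negP.
  have D0 : 0 < dist y x0 by exact: lt_le_trans Dy.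
  have ey : eta y = 0 by apply: etaB; apply: le_trans Dy; exact: ltW.
  rewrite ey sub0r sqrrN.
  have [ex|ex] := leP rho'' (dist x x0).
    by rewrite (etaB _ ex) expr0n/= mulr0 mul0r.
  rewrite /h /H1 /H2 /= !indicE mem_set// mem_set; last first.
    by rewrite /C /=; apply/negP; rewrite -leNgt (le_trans r2).
  rewrite !mul1r.
  (* Here [dist y x >= dist y x0 - rho''], and [rho'' <= rho'' / rho * dist y x0] because [y] lies
     outside the ball of radius [rho]. *)
  have dtau : tau * dist y x0 <= dist y x.
    have := dist_triangle y x x0; suff : tau * dist y x0 <= dist y x0 - rho'' by lra.
    rewrite /tau mulrBl mul1r lerD2l lerN2 mulrAC -mulrA ler_peMr ?(ltW r''0)//.
    by rewrite ler_pdivlMr// mul1r.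
  have kle : k' <= c2 / dist y x0 `^ P.
    apply: (le_trans k'le).
    have -> : c2 / dist y x0 `^ P = cK * (2 - al) * (tau * dist y x0) `^ (- P).
      by rewrite powRM ?(ltW tau0)// (powRN (dist y x0)) /c2 mulrA.
    rewrite ler_wpM2l ?mulr_ge0 ?(ltW cK0) ?(ltW a2)//.
    by apply: ler_powRN; rewrite ?(ltW P0) ?mulr_gt0.
  have /andP[e0 e1] := eta01 x.
  have e2 : eta x ^+ 2 <= 1 by rewrite exprn_ile1.
  have -> : c2 * (w x * (up y / dist y x0 `^ P)) = w x * up y * 1 * (c2 / dist y x0 `^ P).
    by ring.
  apply: ler_pM => //; first by apply: mulr_ge0; [exact: mulr_ge0|exact: sqr_ge0].
  by apply: ler_pM => //; rewrite ?sqr_ge0 ?mulr_ge0// ler_wpM2l.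
have mgs : measurable_fun setT (fun p : T * T => g (p.2, p.1)).
  exact: (measurableT_comp mg mswap).
have mhs : measurable_fun setT (fun p : T * T => h (p.2, p.1)).
  exact: (measurableT_comp mh mswap).
have mg1 : measurable_fun setT (fun p => 2^-1 * g p) by exact: measurable_funM.
have mg2 : measurable_fun setT (fun p : T * T => 2^-1 * g (p.2, p.1)) by exact: measurable_funM.
(* Exchanging the two points turns each reflected term back into the original: the halves of [g] add
   up to one [g], the two copies of [h] give the factor 2 of the tail term. *)
have main : (\int[mu2]_p (w p.1 * w p.2 * (eta p.2 - eta p.1) ^+ 2 * k p.1 p.2)%:E <=
   \int[mu2]_p ((2^-1 * g p + 2^-1 * g (p.2, p.1)) + (h p + h (p.2, p.1)))%:E)%E.
  apply: ae_ge0_le_integral => //.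
  - move=> p _; rewrite lee_fin.
    exact: mulr_ge0 (mulr_ge0 (mulr_ge0 (w0 _) (w0 _)) (sqr_ge0 _)) (k0 _ _).
  - apply/measurable_EFinP; apply: measurable_funM => //; apply: measurable_funM.
      apply: measurable_funM.
      - exact: (measurableT_comp mw measurable_fst).
      - exact: (measurableT_comp mw measurable_snd).
    by apply: measurable_funX; exact: measurable_increment.
  - by move=> p _; rewrite lee_fin; apply: addr_ge0; apply: addr_ge0.
  - by apply/measurable_EFinP; apply: measurable_funD; apply: measurable_funD.
  apply: filterS upper => -[x y] /= kxy _; rewrite lee_fin.
  have [Bx|Bx] := pselect (B x); have [By|By] := pselect (B y).
  - apply: (@le_trans _ _ (2^-1 * g (x, y) + 2^-1 * g (y, x))); last first.
      by rewrite lerDl; exact: addr_ge0.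
    have d2r : dist y x < 2 * r.
      have := dist_triangle y x0 x; rewrite (distC x0 x).
      by move: Bx By; rewrite /B /= => ? ?; lra.
    rewrite /g /V /= !indicE (mem_set Bx) (mem_set By) mem_set//.
    rewrite mem_set; last by rewrite /= distC.
    rewrite !mul1r (distC x y).
    set v := dist y x ^+ 2 * dist y x `^ (- P).
    have v0 : 0 <= v by rewrite mulr_ge0 ?sqr_ge0 ?powR_ge0.
    have e1 : (eta y - eta x) ^+ 2 * k x y <= c1 * v.
      have -> : c1 * v = (L * dist y x) ^+ 2 * (cK * (2 - al) * dist y x `^ (- P)).
        by rewrite /c1 /v; ring.
      apply: ler_pM; rewrite ?sqr_ge0//.
      by rewrite -real_normK ?num_real// ler_sqr ?nnegrE// mulr_ge0.
    have e2 : w x * w y <= 2^-1 * w x ^+ 2 + 2^-1 * w y ^+ 2.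
      have := sqr_ge0 (w x - w y); lra.
    rewrite -mulrA; apply: (@le_trans _ _ ((2^-1 * w x ^+ 2 + 2^-1 * w y ^+ 2) * (c1 * v))).
      by apply: ler_pM => //; rewrite mulr_ge0 ?sqr_ge0.
    by rewrite le_eqVlt; apply/orP; left; apply/eqP; ring.
  - apply: (le_trans (aux x y (k x y) Bx By (k0 _ _) kxy)).
    by rewrite addrA addrAC lerDr; do 2 apply: addr_ge0 => //.
  - have := aux y x (k x y) By Bx (k0 _ _); rewrite (distC x y) => /(_ kxy).
    rewrite (mulrC (w y)) -sqrrN opprB => /le_trans; apply.
    by rewrite addrA lerDr; do 2 apply: addr_ge0 => //.
  - have ex : eta x = 0.
      by apply: etaB; apply: (le_trans (ltW r''r)); rewrite leNgt; exact/negP.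
    have ey : eta y = 0.
      by apply: etaB; apply: (le_trans (ltW r''r)); rewrite leNgt; exact/negP.
    by rewrite ex ey subrr expr0n/= mulr0 mul0r; apply: addr_ge0; apply: addr_ge0.
apply: (le_trans main).
rewrite (@ge0_integralD_EFin _ _ _ mu2 setT (fun p => 2^-1 * g p + 2^-1 * g (p.2, p.1))
   (fun p => h p + h (p.2, p.1)) measurableT (measurable_funD mg1 mg2)
   (measurable_funD mh mhs) (fun p _ => addr_ge0 (mulr_ge0 half0 (g0 _)) (mulr_ge0 half0 (g0 _)))
   (fun p _ => addr_ge0 (h0 _) (h0 _))).
rewrite (@ge0_integralD_EFin _ _ _ mu2 setT _ _ measurableT mg1 mg2
   (fun p _ => mulr_ge0 half0 (g0 _)) (fun p _ => mulr_ge0 half0 (g0 _))).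
rewrite (@ge0_integralD_EFin _ _ _ mu2 setT _ _ measurableT mh mhs
   (fun p _ => h0 _) (fun p _ => h0 _)).
rewrite (ge0_integral_swap mu mh h0).
rewrite (@ge0_integralMl_EFin _ _ _ mu2 setT 2^-1 _ measurableT mg (fun p _ => g0 p) half0).
rewrite (@ge0_integralMl_EFin _ _ _ mu2 setT 2^-1 _ measurableT mgs (fun p _ => g0 _) half0).
rewrite (ge0_integral_swap mu mg g0).
have int_g : (\int[mu2]_p (g p)%:E <=
   (16 / ln 2 * 4 ^+ N * cK * L ^+ 2 * r `^ (2 - al))%:E * \int[mu]_(x in B) (w x ^+ 2)%:E)%E.
  rewrite (tonelli_EFin mu mg g0) -(integral_indicM mu B (fun x => w x ^+ 2)).
  set c3 := 16 / ln 2 * 4 ^+ N * cK * L ^+ 2 * r `^ (2 - al).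
  have c30 : 0 <= c3.
    by rewrite !mulr_ge0 ?powR_ge0 ?sqr_ge0 ?exprn_ge0 ?invr_ge0 ?(ltW l0) ?(ltW cK0).
  have w20 x : 0 <= \1_B x * w x ^+ 2 by rewrite mulr_ge0 ?sqr_ge0.
  rewrite -(@ge0_integralMl_EFin _ _ _ mu setT c3 _ measurableT mw2 (fun x _ => w20 x) c30).
  apply: ge0_le_integral => //.
  - by move=> x _; apply: integral_ge0 => y _; rewrite lee_fin.
  - exact: (measurable_tonelli_EFin mu mg g0).
  - by apply/measurable_EFinP; exact: measurable_funM.
  move=> x _.
  have -> : (\int[mu]_y (g (x, y))%:E = \int[mu]_y (c1 * (\1_B x * w x ^+ 2) * V (x, y))%:E)%E.
    by apply: eq_integral => y _; rewrite /g /= mulrA.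
  have mVx := measurableT_comp mV (measurable_pair1 x).
  rewrite (@ge0_integralMl_EFin _ _ _ mu setT (c1 * (\1_B x * w x ^+ 2)) _ measurableT mVx
    (fun y _ => V0 _) (mulr_ge0 c10 (w20 x))).
  have -> : (\int[mu]_y (V (x, y))%:E = \int[mu]_(y in [set y | (dist y x < 2 * r)%R])
     (dist y x ^+ 2 * dist y x `^ (- P))%:E)%E.
    rewrite -[RHS]integral_indicM; apply: eq_integral => y _; rewrite /V !indicE.
    by congr ((_%:R * _)%:E).
  apply: (le_trans (lee_wpmul2l _ (integral_sq_dist_le x r0))).
    by rewrite lee_fin mulr_ge0.
  rewrite -EFinM lee_fin le_eqVlt; apply/orP; left; apply/eqP.
  by rewrite /c1 /c3; field; rewrite !gt_eqF.
have int_h : (\int[mu2]_p (h p)%:E =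
    c2%:E * (\int[mu]_(x in B) (w x)%:E * \int[mu]_(y in C) (up y / dist y x0 `^ P)%:E))%E.
  rewrite (tonelli_EFin mu mh h0) -(integral_indicM mu B w).
  rewrite -(integral_indicM mu C (fun y => up y / dist y x0 `^ P)).
  have IH20 : (0 <= \int[mu]_y (H2 y)%:E)%E by apply: integral_ge0 => y _; rewrite lee_fin.
  transitivity (\int[mu]_x ((c2 * H1 x)%:E * \int[mu]_y (H2 y)%:E))%E.
    apply: eq_integral => x _.
    rewrite -(@ge0_integralMl_EFin _ _ _ mu setT (c2 * H1 x) _ measurableT mH2
      (fun y _ => H20 y) (mulr_ge0 c20 (H10 x))).
    by apply: eq_integral => y _; rewrite /h /= mulrA.
  rewrite ge0_integralZr//; last 2 first.
  - by apply/measurable_EFinP; exact: measurable_funM.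
  - by move=> x _; rewrite lee_fin mulr_ge0.
  by rewrite (@ge0_integralMl_EFin _ _ _ mu setT c2 _ measurableT mH1 (fun y _ => H10 y) c20) muleA.
apply: leeD.
  apply: le_trans int_g.
  rewrite -ge0_muleDl ?lee_fin// -EFinD (_ : 2^-1 + 2^-1 = 1); last by field.
  by rewrite mul1e.
rewrite int_h -ge0_muleDl ?lee_fin// -EFinD.
by rewrite (_ : c2 + c2 = 2 * cK * (2 - al) * tau `^ (- P))// /c2; ring.
Qed.

End CrossTerm.

(** * De Giorgi iteration *)

Section DeGiorgiIteration.
Context (R : realType) (dd : measure_display) (T : measurableType dd).
Variable mu : {measure set T -> \bar R}.
Variables (N : nat) (dist : T -> T -> R) (al : R) (u : T -> R) (x0 : T) (r tail A : R).
Local Notation ball s := [set x | (dist x x0 < s)%R].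
Hypothesis mball : forall s, measurable (ball s).
Hypothesis mu_ : measurable_fun setT u.
Hypothesis r0 : 0 < r.
Hypothesis A0 : 0 <= A.
Hypothesis tail0 : 0 <= tail.
Hypothesis step : forall l l' a b rho th X : R,
  0 <= l -> l < l' -> r / 2 <= a -> 0 < th -> th <= 1 -> b - a = th * r -> b <= r ->
  0 < rho -> 0 <= X ->
  (\int[mu]_(x in ball b) (excess u l x ^+ 2)%:E <= X%:E)%E ->
  X / (l' - l) ^+ 2 <= rho ^+ N / 2 ->
  (\int[mu]_(x in ball a) (excess u l' x ^+ 2)%:E <=
   (A * (rho / r) `^ al * th^-1 ^+ (N + 2) * (1 + tail / (l' - l)) * X)%:E)%E.

Let mexcess l : measurable_fun setT (excess u l).
Proof. by apply: measurable_maxr => //; exact: measurable_funB. Qed.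

(** How the constants fit: [E^j = 2^(-j (N + 3))] pays for [N + 2] powers of the radius gap and one
    of the level gap. The rate [lam = E^(m N) / 4] keeps the smallness condition of [step] an
    equality for every [j], with [E^(m N)] following [rho^N] and 1/4 the squared level gap. Finally
    [t] is such that one step multiplies by at most [lam]. *)
Lemma de_giorgi (s s' de lev A3 t : R) (m : nat) :
  2^-1 <= s -> s < s' -> s' <= 1 -> 0 < de -> de <= 1 -> 0 < lev ->
  de * tail <= lev -> 1 <= m%:R * al -> 1 <= A3 -> A * 2 ^+ (N + 4) <= A3 ->
  0 < t -> t * (A3 * (de^-1 * (s' - s)^-1 ^+ (N + 2))) =
    (2^-1 ^+ (N + 3)) ^+ (m * N) / 4 ->
  (\int[mu]_(x in ball (s' * r)) (excess u 0 x ^+ 2)%:E <=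
    (t ^+ (m * N) * lev ^+ 2 * r ^+ N / 8)%:E)%E ->
  {ae mu, forall x, ball (s * r) x -> u x <= lev}.
Proof.
move=> s12 ss' s'1 de0 de1 lev0 delev mal A31 AA3 t0.
set lam := _ / 4; set D := s' - s; set G := de^-1 * _ => tlam.
set X0 := t ^+ (m * N) * lev ^+ 2 * r ^+ N / 8 => start.
have D0 : 0 < D by rewrite subr_gt0.
have D1 : D <= 1 by rewrite /D; lra.
set E := 2^-1 ^+ (N + 3) in lam tlam *; have E0 : 0 < E by exact: exprn_gt0.
have half1 : (2^-1 : R) <= 1 by rewrite invf_le1// ler1n.
have half0 : 0 <= (2^-1 : R) by rewrite invr_ge0.
have E1 : E <= 1 by rewrite exprn_ile1.
have lam0 : 0 < lam by rewrite divr_gt0// exprn_gt0.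
have lam4 : lam <= 4^-1.
  by rewrite /lam -[leRHS]mul1r ler_pM2r// exprn_ile1// exprn_ge0.
have G1 : 1 <= G.
  by rewrite -[leLHS]mul1r ler_pM// ?invf_ge1// exprn_ege1// invf_ge1.
have G0 : 0 < G by exact: lt_le_trans G1.
have A30 : 0 < A3 by exact: lt_le_trans A31.
have t1 : t <= 1.
  have AG1 : 1 <= A3 * G by rewrite -[leLHS]mul1r ler_pM.
  apply: (@le_trans _ _ (t * (A3 * G))); first by rewrite ler_peMr// ltW.
  by rewrite tlam (le_trans lam4)// invf_le1// ler1n.
have X00 : 0 < X0.
  by rewrite /X0 divr_gt0// mulr_gt0 ?exprn_gt0// mulr_gt0 ?exprn_gt0.
pose c j : R := 2^-1 ^+ j.
have c0 j : 0 < c j by exact: exprn_gt0.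
have c1 j : c j <= 1 by rewrite exprn_ile1.
have cS j : c j.+1 = c j / 2 by rewrite /c exprS mulrC.
(* The FK radius is [r y^m] with [y = t 2^(-(N + 3) j)]: since [m al >= 1], the
   factor [y] absorbs the [2^((N + 3) j)] lost in each step. *)
have claim j : (\int[mu]_(x in ball (r * (s + c j * D)))
   (excess u (lev * (1 - c j)) x ^+ 2)%:E <= (X0 * lam ^+ j)%:E)%E.
  elim: j => [|j IH].
    rewrite /c expr0 subrr mulr0 mulr1 mul1r.
    by rewrite (_ : r * (s + D) = s' * r)//; rewrite /D; ring.
  have cj0 := c0 j; have cj1 := c1 j.
  set cj := c j in cj0 cj1 IH *.
  have cD : 0 < cj * D by exact: mulr_gt0.
  have cD1 : cj * D <= D by rewrite ler_piMl// ltW.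
  have y0 : 0 < t * E ^+ j by rewrite mulr_gt0// exprn_gt0.
  have y1 : t * E ^+ j <= 1.
    by rewrite -[leRHS]mul1r ler_pM ?exprn_ge0 ?exprn_ile1 ?(ltW t0) ?(ltW E0).
  set y := t * E ^+ j in y0 y1 *.
  have rr : r * (s + cj * D) <= r by rewrite ler_piMr ?(ltW r0)//; rewrite /D in cD1 *; lra.
  have lc : lev * (1 - cj) < lev * (1 - c j.+1).
    by rewrite ltr_pM2l// cS -/cj; lra.
  have EE : E ^+ j = cj ^+ (N + 3) by rewrite /cj /c -!exprM mulnC.
  have ldiff : lev * (1 - c j.+1) - lev * (1 - cj) = lev * cj / 2.
    by rewrite cS -/cj; field.
  have lam4c : lam ^+ j = (E ^+ j) ^+ (m * N) * cj ^+ 2.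
    have -> : (E ^+ j) ^+ (m * N) = (E ^+ (m * N)) ^+ j by exact: exprAC.
    have -> : cj ^+ 2 = 4^-1 ^+ j.
      by rewrite /cj /c exprAC; congr (_ ^+ _); field.
    by rewrite /lam exprMn.
  have := @step (lev * (1 - cj)) (lev * (1 - c j.+1)) (r * (s + c j.+1 * D))
    (r * (s + cj * D)) (r * y ^+ m) (cj / 2 * D) (X0 * lam ^+ j).
  rewrite ldiff => /(_ _ lc _ _ _ _ rr _ _ IH _) H.
  apply: (le_trans (H _ _ _ _ _ _ _ _)).
  - by rewrite mulr_ge0 ?(ltW lev0)// subr_ge0.
  - rewrite ler_pM2l//; have := mulr_gt0 (c0 j.+1) D0; lra.
  - by rewrite mulr_gt0// divr_gt0.
  - have : cj / 2 * D <= 1 * 1 by rewrite ler_pM ?divr_ge0 ?(ltW cj0) ?(ltW D0)//; lra.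
    by rewrite mulr1.
  - by rewrite cS -/cj; field.
  - by rewrite mulr_gt0// exprn_gt0.
  - by rewrite mulr_ge0 ?exprn_ge0 ?(ltW X00) ?(ltW lam0).
  - rewrite le_eqVlt; apply/orP; left; apply/eqP.
    have -> : (r * y ^+ m) ^+ N = r ^+ N * (t ^+ (m * N) * (E ^+ j) ^+ (m * N)).
      by rewrite exprMn -(exprM y m N) /y exprMn.
    rewrite lam4c /X0; set e1 := (E ^+ j) ^+ _; set e2 := t ^+ _.
    by field; rewrite !gt_eqF.
  have e1 : (r * y ^+ m / r) `^ al <= y.
    rewrite mulrAC divff ?gt_eqF// mul1r -powR_mulrn ?(ltW y0)// -powRrM.
    by rewrite -[leRHS]powRr1 ?(ltW y0)//; apply: ger_powR => //; rewrite y0.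
  set z := (de * cj)^-1; have z1 : 1 <= z.
    rewrite invf_ge1 ?mulr_gt0// -[leRHS]mul1r.
    by apply: ler_pM => //; exact: ltW.
  (* This is where [de * tail <= lev] acts: the quotient of the tail by the level gap is at most
     [2 / (de * cj)], however large the tail is. *)
  have e2 : 1 + tail / (lev * cj / 2) <= 4 * z.
    have : tail / lev <= de^-1 by rewrite ler_pdivrMr// ler_pdivlMl.
    move=> tl; have -> : tail / (lev * cj / 2) = tail / lev * (2 * cj^-1).
      by field; rewrite !gt_eqF.
    have : tail / lev * (2 * cj^-1) <= de^-1 * (2 * cj^-1).
      by rewrite ler_pM2r// mulr_gt0// invr_gt0.
    have -> : de^-1 * (2 * cj^-1) = 2 * z by rewrite /z invfM; ring.
    lra.
  have q0 : 0 <= (cj / 2 * D)^-1 ^+ (N + 2).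
    by rewrite exprn_ge0// invr_ge0 mulr_ge0 ?divr_ge0 ?(ltW cj0) ?(ltW D0).
  rewrite lee_fin (exprS lam j) [leRHS]mulrCA ler_pM2r; last by rewrite mulr_gt0// exprn_gt0.
  apply: (@le_trans _ _ (A * y * (cj / 2 * D)^-1 ^+ (N + 2) * (4 * z))).
    apply: ler_pM => //.
    - by rewrite mulr_ge0// mulr_ge0// powR_ge0.
    - by rewrite addr_ge0// divr_ge0// divr_ge0// mulr_ge0 ?(ltW lev0) ?(ltW cj0).
    - by rewrite ler_wpM2r// ler_wpM2l.
  have -> : A * y * (cj / 2 * D)^-1 ^+ (N + 2) * (4 * z) = A * 2 ^+ (N + 4) * (t * G).
    rewrite /y EE /z /G !invfM invrK !exprMn (_ : (N + 4 = N + 2 + 2)%N); last by rewrite -addnA.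
    rewrite (_ : (N + 3 = (N + 2).+1)%N); last by rewrite addnS.
    rewrite (exprS cj) (exprD 2) !exprVn.
    by field; rewrite !gt_eqF ?exprn_gt0.
  rewrite -tlam [leRHS]mulrCA.
  by apply: ler_wpM2r => //; exact: ltW (mulr_gt0 t0 G0).
have small j : (\int[mu]_(x in ball (s * r)) (excess u lev x ^+ 2)%:E <= (X0 * c j)%:E)%E.
  apply: (@le_trans _ _ (X0 * lam ^+ j)%:E).
    apply: le_trans (claim j).
    apply: (@le_trans _ _ (\int[mu]_(x in ball (s * r)) (excess u (lev * (1 - c j)) x ^+ 2)%:E)%E).
      apply: ge0_le_integral_EFin => //.
      - exact: measurable_funX.
      - exact: measurable_funX.
      - by move=> x _; exact: sqr_ge0.
      - move=> x _; have ex0 l : 0 <= excess u l x by rewrite /excess le_max lexx orbT.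
        rewrite ler_sqr ?nnegrE ?ex0// /excess.
        rewrite ge_max !le_max lexx orbT andbT; apply/orP; left.
        have : 0 <= lev * c j by rewrite mulr_ge0 ?(ltW lev0) ?(ltW (c0 j)).
        lra.
    apply: ge0_subset_integral => //.
    - by apply/measurable_EFinP/measurable_funTS; exact: measurable_funX.
    - by move=> x _; rewrite lee_fin sqr_ge0.
    - move=> x /= h; apply: (lt_le_trans h).
      rewrite mulrDr mulrC lerDl mulr_ge0 ?(ltW r0)// mulr_ge0 ?(ltW (c0 j)) ?(ltW D0)//.
  rewrite lee_fin ler_pM2l// /c lerXn2r ?nnegrE ?(ltW lam0)//.
  by apply: (le_trans lam4); lra.
have zero : (\int[mu]_(x in ball (s * r)) (excess u lev x ^+ 2)%:E = 0)%E.
  apply/eqP; rewrite eq_le; apply/andP; split; last first.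
    by apply: integral_ge0 => x _; rewrite lee_fin sqr_ge0.
  apply/lee_addgt0Pr => e e0; rewrite add0e.
  have [j hj] := expr_half_lt (divr_gt0 e0 X00).
  apply: (le_trans (small j)); rewrite lee_fin mulrC -ler_pdivlMr//; exact: ltW.
have mf : measurable_fun (ball (s * r)) (fun x => (excess u lev x ^+ 2)%:E).
  by apply/measurable_EFinP/measurable_funTS; exact: measurable_funX.
have [H _] := ae_eq_integral_abs mu (mball (s * r)) mf.
have : (\int[mu]_(x in ball (s * r)) `|(excess u lev x ^+ 2)%:E| = 0)%E.
  by rewrite -[RHS]zero; apply: eq_integral => x _; rewrite gee0_abs// lee_fin sqr_ge0.
move=> /H; apply: filterS => x /= h /h [] /eqP; rewrite sqrf_eq0 => /eqP.
rewrite /excess => h'; rewrite leNgt; apply/negP => h2.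
by move: h'; rewrite max_l ?subr_ge0 ?(ltW h2)// => /eqP; rewrite subr_eq0 gt_eqF.
Qed.
End DeGiorgiIteration.

(** * From L^2 to L^q: interpolation and absorption of the supremum *)

Section LocalBoundedness.
Context (R : realType) (dd : measure_display) (T : measurableType dd).
Variable mu : {measure set T -> \bar R}.
Variables (N n1 n2 : nat) (dist : T -> T -> R) (u : T -> R) (x0 : T) (r tail K : R).
Local Notation ball s := [set x | (dist x x0 < s)%R].
Local Notation up x := (excess u 0 x).
Hypothesis mball : forall s, measurable (ball s).
Hypothesis vol : (mu (ball r) <= (2 ^+ N * r ^+ N)%:E)%E.
Hypothesis mu_ : measurable_fun setT u.
Hypothesis u2 : (\int[mu]_x (u x ^+ 2)%:E < +oo)%E.
Hypothesis r0 : 0 < r.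
Hypothesis tail0 : 0 <= tail.
Hypothesis K1 : 1 <= K.
Hypothesis sup_le : forall s s' de lev : R,
  2^-1 <= s -> s < s' -> s' <= 1 -> 0 < de -> de <= 1 -> 0 < lev ->
  de * tail <= lev ->
  (\int[mu]_(x in ball (s' * r)) (up x ^+ 2)%:E <=
    (lev ^+ 2 * r ^+ N / (K * (de^-1 * (s' - s)^-1 ^+ n1) ^+ n2))%:E)%E ->
  {ae mu, forall x, ball (s * r) x -> u x <= lev}.

(** With [de = 1/2] and radius gap [2^-(i + 3)], as in the absorption argument, the denominator
    constant in [sup_le] equals [Z0 * B ^+ i]. *)
Let Z0 := K * 2 ^+ (n2 * (1 + 3 * n1)).
Let B : R := 2 ^+ (n1 * n2).

(** The factor [2 ^+ N + 1] is the loss from L^2 to L^q for [q >= 2]; [4 * Z0 * B] is [2 * Z0 / th]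
    at [th = 1 / (2 B)], reached for [q < 2]. *)
Definition sup_const := (2 ^+ N + 1) * (4 * Z0 * B).

Let Z01 : 1 <= Z0.
Proof. by rewrite -[leLHS]mul1r ler_pM// exprn_ege1// ler1n. Qed.

Let B1 : 1 <= B. Proof. by rewrite exprn_ege1// ler1n. Qed.

Let mup : measurable_fun setT (excess u 0).
Proof. by apply: measurable_maxr => //; exact: measurable_funB. Qed.

Let up0 x : 0 <= up x. Proof. by rewrite /excess le_max lexx orbT. Qed.

Let up_le x : up x <= `|u x|.
Proof. by rewrite /excess subr0 ge_max ler_norm normr_ge0. Qed.

Let rN0 : 0 < r ^+ N. Proof. exact: exprn_gt0. Qed.

(** Here [x] stands for the supremum over a larger ball and must carry the small coefficient [th].
    If [S <= x], the left side is at most [Z * x * S], half the cross term of the square; otherwise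
    it is at most [Z * S^2]. *)
Lemma powR_interpolation (q x S Z th : R) : 1 <= q -> q <= 2 -> 0 < x -> 0 < S ->
  1 <= Z -> 0 < th -> th <= 1 ->
  Z * (x `^ (2 - q) * S `^ q) <= (th * x + Z / th * S) ^+ 2.
Proof.
move=> q1 q2 x0' S0 Z1 th0 th1; have Z0' : 0 < Z by exact: lt_le_trans Z1.
have thx : 0 <= th * x by rewrite mulr_ge0 ?ltW.
have ZS : 0 <= Z / th * S by rewrite mulr_ge0 ?divr_ge0 ?ltW.
have [Sx|xS] := leP S x.
  apply: (@le_trans _ _ (Z * (x * S))).
    rewrite ler_pM2l//.
    have -> : S `^ q = S `^ (q - 1) * S.
      by rewrite -{3}(powRr1 (ltW S0)) -powRD ?subrK// (gt_eqF S0) implybT.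
    rewrite mulrA ler_pM2r//.
    apply: (@le_trans _ _ (x `^ (2 - q) * x `^ (q - 1))).
      rewrite ler_wpM2l ?powR_ge0//; apply: ge0_ler_powR => //; rewrite ?nnegrE ?(ltW S0) ?(ltW x0')//.
      by rewrite subr_ge0.
    rewrite -powRD ?(gt_eqF x0') ?implybT//.
    by rewrite (_ : 2 - q + (q - 1) = 1) ?powRr1 ?(ltW x0')//; ring.
  have -> : Z * (x * S) = th * x * (Z / th * S) by field; rewrite gt_eqF.
  rewrite sqrrD; have := sqr_ge0 (th * x); have := sqr_ge0 (Z / th * S).
  have := mulr_ge0 thx ZS; lra.
apply: (@le_trans _ _ (Z * S ^+ 2)).
  rewrite ler_pM2l//.
  apply: (@le_trans _ _ (S `^ (2 - q) * S `^ q)).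
    rewrite ler_wpM2r ?powR_ge0//; apply: ge0_ler_powR; rewrite ?nnegrE ?subr_ge0 ?(ltW S0) ?(ltW x0') ?(ltW xS)//.
  by rewrite -powRD ?(gt_eqF S0) ?implybT// subrK powR_mulrn ?(ltW S0).
apply: (@le_trans _ _ ((Z / th * S) ^+ 2)); last by rewrite ler_sqr ?nnegrE ?addr_ge0// lerDr.
rewrite exprMn ler_wpM2r ?sqr_ge0//.
have ZZ : Z <= Z / th by rewrite ler_peMr ?(ltW Z0')// invf_ge1.
by rewrite expr2 -[leLHS]mul1r ler_pM ?(ltW Z0')// (le_trans Z1).
Qed.

(** Absorbing a supremum requires that it be finite beforehand. This [M] depends on [u], but
    [sup_bound] multiplies it by [th ^+ n] with [n] arbitrarily large. *)
Lemma sup_bound_finite : exists M, 0 < M /\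
  {ae mu, forall x, ball (3 / 4 * r) x -> u x <= M}.
Proof.
set U := fine (\int[mu]_x (u x ^+ 2)%:E).
have U0 : 0 <= U by apply: fine_ge0; apply: integral_ge0 => x _; rewrite lee_fin sqr_ge0.
set Z := K * (1^-1 * (1 - 3 / 4)^-1 ^+ n1) ^+ n2.
have Z0' : 0 < Z.
  rewrite mulr_gt0 ?(lt_le_trans ltr01 K1)// exprn_gt0// invr1 mul1r exprn_gt0// invr_gt0; lra.
set M := 1 + tail + Z * U / r ^+ N.
have ZU : 0 <= Z * U / r ^+ N.
  by apply: divr_ge0; [apply: mulr_ge0 => //; exact: ltW|exact: ltW].
have M1 : 1 <= M by rewrite /M -addrA lerDl addr_ge0.
exists M; split; first exact: lt_le_trans M1.
have h34 : 2^-1 <= 3 / 4 :> R by lra.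
have h34' : 3 / 4 < 1 :> R by lra.
apply: (@sup_le (3 / 4) 1 1 M) => //.
- exact: lt_le_trans M1.
- by rewrite mul1r /M addrAC lerDr addr_ge0.
- rewrite -/Z mul1r; apply: (@le_trans _ _ U%:E).
    rewrite /U fineK; last first.
      by rewrite ge0_fin_numE//; apply: integral_ge0 => x _; rewrite lee_fin sqr_ge0.
    apply: ge0_le_integral_setT => //.
    - exact: measurable_funX.
    - exact: measurable_funX.
    - by move=> x _; exact: sqr_ge0.
    - by move=> x; exact: sqr_ge0.
    - by move=> x _; rewrite -[leRHS]real_normK ?num_real// ler_sqr ?nnegrE.
  rewrite lee_fin ler_pdivlMr// mulrC -ler_pdivrMr//.
  apply: (@le_trans _ _ M); first by rewrite /M lerDr addr_ge0.
  by rewrite expr2 ler_peMr// (le_trans ler01).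
Qed.

Lemma sup_bound (q S eps : R) : 1 < q -> 0 < S -> 0 < eps ->
  (\int[mu]_(x in ball r) (up x `^ q)%:E <= (S `^ q * r ^+ N)%:E)%E ->
  {ae mu, forall x, ball (r / 2) x -> u x <= sup_const * S + tail + eps}.
Proof.
move=> q1 S0 eps0 intq.
have Z0' : 0 < Z0 by exact: lt_le_trans Z01.
have B0 : 0 < B by exact: lt_le_trans B1.
have mupq : measurable_fun setT (fun x => up x `^ q).
  exact: (measurableT_comp (measurable_powR _) mup).
have N1 : 1 <= 2 ^+ N + 1 :> R by rewrite lerDr exprn_ge0.
(* For [q >= 2], comparing [up] with [S] gives [up^2 <= S^2 + S^(2 - q) up^q], and a single use of
   [sup_le] with [de = 1] suffices. *)
have [q2|q2] := leP 2 q.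
  have sc0 : 0 < sup_const.
    apply: mulr_gt0; first exact: lt_le_trans N1.
    by apply: mulr_gt0 => //; exact: mulr_gt0.
  set lev := sup_const * S + tail + eps.
  have levS : sup_const * S <= lev by rewrite /lev -addrA lerDl addr_ge0// ltW.
  have lev0 : 0 < lev by apply: lt_le_trans levS; exact: mulr_gt0.
  rewrite mulrC; apply: (@sup_le 2^-1 1 1) => //.
  - by rewrite invf_lt1// ltr1n.
  - rewrite mul1r /lev addrAC lerDr addr_ge0//; last exact: ltW.
    by rewrite mulr_ge0 ?(ltW sc0) ?(ltW S0).
  rewrite mul1r.
  have -> : K * (1^-1 * (1 - 2^-1)^-1 ^+ n1) ^+ n2 = K * B.
    by rewrite invr1 mul1r (_ : 1 - 2^-1 = 2^-1) ?invrK -?exprM//; field.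
  set KB := K * B; have KB1 : 1 <= KB by rewrite -[leLHS]mul1r ler_pM.
  have KB0 : 0 < KB by exact: lt_le_trans KB1.
  apply: (@le_trans _ _ (S ^+ 2 * (2 ^+ N + 1) * r ^+ N)%:E).
    apply: (@le_trans _ _ (\int[mu]_(x in ball r) (S ^+ 2 + S `^ (2 - q) * up x `^ q)%:E)%E).
      apply: ge0_le_integral_EFin => //.
      - exact: measurable_funX.
      - by apply: measurable_funD => //; exact: measurable_funM.
      - by move=> x _; exact: sqr_ge0.
      - move=> x _; have [uS|Su] := leP (up x) S.
          apply: (@le_trans _ _ (S ^+ 2)); first by rewrite ler_sqr ?nnegrE ?(ltW S0).
          by rewrite lerDl mulr_ge0 ?powR_ge0.
        have ux0 : 0 < up x by exact: lt_trans Su.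
        apply: (@le_trans _ _ (S `^ (2 - q) * up x `^ q)); last by rewrite lerDr sqr_ge0.
        have -> : up x ^+ 2 = up x `^ (2 - q) * up x `^ q.
          by rewrite -powRD ?(gt_eqF ux0) ?implybT// subrK powR_mulrn.
        rewrite ler_wpM2r ?powR_ge0// -(opprB q 2).
        by apply: ler_powRN; rewrite ?subr_ge0 ?(ltW Su).
    rewrite ge0_integralD_EFin//; last 3 first.
    - exact: measurable_funM.
    - by move=> x _; exact: sqr_ge0.
    - by move=> x _; rewrite mulr_ge0 ?powR_ge0.
    rewrite (@ge0_integralMl_EFin _ _ _ mu (ball r) _ (fun x => up x `^ q) (mball r)
      mupq (fun x _ => powR_ge0 _ _) (powR_ge0 S (2 - q))).
    rewrite integral_cst// mulrDr mulr1 mulrDl EFinD; apply: leeD.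
      apply: (le_trans (lee_wpmul2l _ vol)); first by rewrite lee_fin sqr_ge0.
      by rewrite -EFinM mulrA.
    apply: (le_trans (lee_wpmul2l _ intq)); first by rewrite lee_fin powR_ge0.
    rewrite -EFinM mulrA -powRD ?(gt_eqF S0) ?implybT// subrK.
    by rewrite powR_mulrn// ltW.
  rewrite lee_fin ler_pdivlMr// mulrAC ler_pM2r//.
  apply: (@le_trans _ _ ((sup_const * S) ^+ 2)); last first.
    by rewrite ler_sqr ?nnegrE ?(ltW lev0)// mulr_ge0 ?(ltW sc0) ?(ltW S0).
  rewrite exprMn [leRHS]mulrC -mulrA ler_pM2l ?exprn_gt0//.
  have h : (2 ^+ N + 1) * KB <= sup_const.
    rewrite /sup_const ler_pM2l ?(lt_le_trans ltr01 N1)// /KB ler_pM2r//.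
    rewrite /Z0 mulrCA ler_peMr ?(le_trans ler01 K1)//.
    by rewrite -[leLHS]mul1r ler_pM ?ler1n// exprn_ege1// ler1n.
  apply: (le_trans h).
  by rewrite expr2 ler_peMr ?(ltW sc0)// (le_trans _ h)// -[leLHS]mul1r ler_pM.
have [M [M0 aeM]] := sup_bound_finite.
set th := (2 * B)^-1.
have th0 : 0 < th by rewrite invr_gt0 mulr_gt0.
have B2 : 2 <= 2 * B by rewrite -[leLHS]mulr1 ler_pM2l.
have th12 : th <= 2^-1 by rewrite lef_pV2 ?posrE ?mulr_gt0.
have th1 : th <= 1 by apply: (le_trans th12); lra.
(* The radii increase from [1/2] at [i = 0] towards [3/4], where [M] is an upper bound. *)
pose s i : R := 3 / 4 - 2^-1 ^+ i.+2.
(* [2 th B = 1] makes this bound reproduce itself from [i.+1] to [i]. *)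
have claim n i : {ae mu, forall x, ball (s i * r) x ->
    u x <= th ^+ n * M + B ^+ i * (2 * Z0 / th) * S + tail}.
  have rest0 j : 0 <= B ^+ j * (2 * Z0 / th) * S.
    exact: (mulr_ge0 (mulr_ge0 (exprn_ge0 _ (ltW B0))
      (divr_ge0 (mulr_ge0 (ler0n _ 2) (ltW Z0')) (ltW th0))) (ltW S0)).
  elim: n i => [|n IH] i.
    apply: filterS aeM => x h bx; apply: (le_trans (h _)).
      move: bx => /= /lt_le_trans; apply; rewrite ler_pM2r// /s lerBlDr lerDl.
      by rewrite exprn_ge0.
    by rewrite expr0 mul1r -addrA lerDl addr_ge0.
  set Mx := th ^+ n * M + B ^+ i.+1 * (2 * Z0 / th) * S + tail.
  have Mx0 : 0 < Mx.
    by rewrite /Mx -addrA ltr_wpDr ?addr_ge0// mulr_gt0// exprn_gt0.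
  set Zi := Z0 * B ^+ i.
  have Bi1 : 1 <= B ^+ i by rewrite exprn_ege1.
  have Zi1 : 1 <= Zi by rewrite -[leLHS]mul1r ler_pM.
  have Zi0 : 0 < Zi by exact: lt_le_trans Zi1.
  set lev := th * Mx + Zi / th * S + tail / 2.
  have ZiS : 0 <= Zi / th * S.
    exact: mulr_ge0 (divr_ge0 (ltW Zi0) (ltW th0)) (ltW S0).
  have lev0 : 0 < lev.
    by rewrite /lev -addrA ltr_wpDr ?addr_ge0 ?divr_ge0// mulr_gt0.
  (* The inherited tail comes back with factor [th <= 1/2] and the choice [de = 1/2] adds another
     half, so the coefficient of the tail never exceeds 1. *)
  have levle : lev <= th ^+ n.+1 * M + B ^+ i * (2 * Z0 / th) * S + tail.
    have -> : lev = th ^+ n.+1 * M + B ^+ i * (2 * Z0 / th) * S + (th + 2^-1) * tail.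
      by rewrite /lev /Mx /Zi !exprS /th; field; rewrite gt_eqF.
    rewrite lerD2l ler_piMl//; lra.
  suff : {ae mu, forall x, ball (s i * r) x -> u x <= lev}.
    by apply: filterS => x h /h /le_trans; apply.
  have p0 : 0 < 2^-1 ^+ i.+2 :> R by exact: exprn_gt0.
  have pS : 2^-1 ^+ i.+3 = 2^-1 ^+ i.+2 / 2 :> R by rewrite exprS mulrC.
  have p1 : 2^-1 ^+ i.+2 <= 4^-1 :> R.
    rewrite 2!exprS mulrA (_ : 2^-1 / 2 = 4^-1 :> R); last by field.
    by rewrite ler_piMr ?invr_ge0// exprn_ile1// invf_le1// ler1n.
  apply: (@sup_le (s i) (s i.+1) 2^-1) => //.
  - rewrite /s; lra.
  - rewrite /s pS; lra.
  - rewrite /s pS; lra.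
  - lra.
  - rewrite /lev; have := mulr_gt0 th0 Mx0; lra.
  have -> : K * (2^-1^-1 * (s i.+1 - s i)^-1 ^+ n1) ^+ n2 = Zi.
    have -> : s i.+1 - s i = 2^-1 ^+ i.+3 by rewrite /s pS; field.
    have -> : (2^-1 ^+ i.+3)^-1 = 2 ^+ i.+3 :> R by rewrite exprVn invrK.
    rewrite invrK; have -> : 2 * (2 ^+ i.+3) ^+ n1 = 2 ^+ (1 + i.+3 * n1) :> R.
      by rewrite exprD expr1 exprM.
    rewrite -exprM /Zi /Z0 /B -(exprM _ (n1 * n2) i) -mulrA -exprD.
    by congr (_ * _ ^+ _); rewrite -(addn3 i); ring.
  apply: (@le_trans _ _ (\int[mu]_(x in ball (s i.+1 * r)) (Mx `^ (2 - q) * up x `^ q)%:E)%E).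
    apply: ae_ge0_le_integral => //.
    - by move=> x _; rewrite lee_fin sqr_ge0.
    - by apply/measurable_EFinP/measurable_funTS; exact: measurable_funX.
    - by move=> x _; rewrite lee_fin mulr_ge0 ?powR_ge0.
    - by apply/measurable_EFinP/measurable_funTS; exact: measurable_funM.
    apply: filterS (IH i.+1) => x h /h ux; rewrite lee_fin.
    have upM : up x <= Mx by rewrite /excess subr0 ge_max ux (ltW Mx0).
    have := up0 x; rewrite le_eqVlt => /predU1P[<-|ux0].
      by rewrite expr0n/= mulr_ge0 ?powR_ge0.
    have -> : up x ^+ 2 = up x `^ (2 - q) * up x `^ q.
      by rewrite -powRD ?(gt_eqF ux0) ?implybT// subrK powR_mulrn.
    rewrite ler_wpM2r ?powR_ge0//; apply: ge0_ler_powR; rewrite ?nnegrE ?(ltW Mx0)//.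
    by rewrite subr_ge0 ltW.
  rewrite (@ge0_integralMl_EFin _ _ _ mu _ _ (fun x => up x `^ q) (mball _)
    mupq (fun x _ => powR_ge0 _ _) (powR_ge0 Mx (2 - q))).
  apply: (@le_trans _ _ ((Mx `^ (2 - q))%:E * (S `^ q * r ^+ N)%:E)%E).
    apply: lee_wpmul2l; first by rewrite lee_fin powR_ge0.
    apply: le_trans intq; apply: ge0_subset_integral => //.
    - by apply/measurable_EFinP/measurable_funTS.
    - by move=> x _; rewrite lee_fin powR_ge0.
    - move=> x /= /lt_le_trans; apply; rewrite ler_piMl ?(ltW r0)//.
      rewrite /s pS; lra.
  rewrite -EFinM lee_fin ler_pdivlMr//.
  rewrite (_ : _ * Zi = Zi * (Mx `^ (2 - q) * S `^ q) * r ^+ N); last by ring.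
  rewrite ler_pM2r//.
  apply: (le_trans (powR_interpolation (ltW q1) (ltW q2) Mx0 S0 Zi1 th0 th1)).
  rewrite ler_sqr ?nnegrE ?(ltW lev0)//; last by rewrite addr_ge0// mulr_ge0 ?(ltW th0) ?(ltW Mx0).
  by rewrite /lev lerDl divr_ge0.
have [n hn] := expr_half_lt (divr_gt0 eps0 M0).
apply: filterS (claim n 0) => x h bx; apply: (le_trans (h _)).
  by rewrite /s; move: bx => /=; rewrite (_ : 3 / 4 - _ = 2^-1) 1?mulrC//; field.
rewrite expr0 mul1r [leRHS]addrC -addrA.
have : th ^+ n * M <= eps.
  rewrite -ler_pdivlMr//; apply: le_trans (ltW hn).
  by rewrite lerXn2r ?nnegrE ?(ltW th0).
have : 2 * Z0 / th * S <= sup_const * S.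
  rewrite ler_pM2r// /sup_const /th invrK (_ : 2 * Z0 * (2 * B) = 4 * Z0 * B); last by ring.
  rewrite ler_peMl//.
  exact: mulr_ge0 (mulr_ge0 (ler0n _ 4) (ltW Z0')) (ltW B0).
lra.
Qed.

End LocalBoundedness.

(** [64 = 4 * 16], the 4 coming from the squared cutoff slope [2 / (th r)]; [2 ^+ (N + 4)] combines
    [2 (2 - al) <= 4] with the separation bound [(2 / th)^(N + 2)]. *)
Definition step_const (R : realType) (N : nat) (cF cK : R) : R :=
  cF^-1 * (64 / ln 2 * 4 ^+ N * cK + 2 ^+ (N + 4) * cK).

(** The last argument is [8 (A3 / lam)^(m N)], obtained by solving the starting condition of
    [de_giorgi] for [t = lam / (A3 G)]. Nothing in it depends on [al]. *)
Definition local_const (R : realType) (N m : nat) (cF cK : R) : R :=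
  sup_const N (N + 2) (m * N)
    (8 * ((1 + step_const N cF cK * 2 ^+ (N + 4)) /
          ((2^-1 ^+ (N + 3)) ^+ (m * N) / 4)) ^+ (m * N)).

(** * One step of the iteration, and the bound for subsolutions *)

Section DeGiorgi.
Context (R : realType) (dd : measure_display) (T : measurableType dd).
Variable mu : {sigma_finite_measure set T -> \bar R}.
Variables (N : nat) (dist : T -> T -> R) (k : T -> T -> R) (cK al M cF : R).
Local Notation mu2 := (mu \x mu)%E.
Hypothesis N2 : (2 <= N)%N.
Hypothesis dist_ge0 : forall x y, 0 <= dist x y.
Hypothesis distC : forall x y, dist x y = dist y x.
Hypothesis dist_triangle : forall x y z, dist x z <= dist x y + dist y z.
Hypothesis mdist : measurable_fun setT (fun p : T * T => dist p.1 p.2).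
Hypothesis vol : forall x s, 0 < s ->
  (mu [set y | (dist y x < s)%R] <= (2 ^+ N * s ^+ N)%:E)%E.
Hypothesis mk : measurable_fun setT (fun p : T * T => k p.1 p.2).
Hypothesis k0 : forall x y, 0 <= k x y.
Hypothesis levy : forall x,
  (\int[mu]_y (Num.min 1 (dist y x ^+ 2) * k x y)%:E <= M%:E)%E.
Hypothesis cK0 : 0 < cK.
Hypothesis al0 : 0 < al.
Hypothesis al2 : al < 2.
Hypothesis upper : {ae mu2, forall p : T * T,
  k p.1 p.2 <= cK * (2 - al) * dist p.2 p.1 `^ (- (N%:R + al))}.
Hypothesis cF0 : 0 < cF.
Hypothesis faber_krahn : forall (w : T -> R) (rho : R),
  measurable_fun setT w -> (\int[mu]_x (w x ^+ 2)%:E < +oo)%E -> 0 < rho ->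
  (mu [set x | (w x != 0)%R] <= (rho ^+ N / 2)%:E)%E ->
  ((cF * rho `^ (- al))%:E * \int[mu]_x (w x ^+ 2)%:E <= energy mu k w w)%E.

Variables (u : T -> R) (x0 : T) (r tail : R).
Local Notation ball s := [set x | (dist x x0 < s)%R].
Hypothesis r0 : 0 < r.
Hypothesis mu_ : measurable_fun setT u.
Hypothesis u2 : (\int[mu]_x (u x ^+ 2)%:E < +oo)%E.
Hypothesis uE : (energy mu k u u < +oo)%E.
Hypothesis subsolution : forall phi : T -> R, measurable_fun setT phi ->
  (\int[mu]_x (phi x ^+ 2)%:E < +oo)%E -> (energy mu k phi phi < +oo)%E ->
  (forall x, ~ ball r x -> phi x = 0) -> (forall x, 0 <= phi x) ->
  (energy mu k u phi <= 0)%E.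
Hypothesis tail0 : 0 <= tail.
Hypothesis tail_le : ((r `^ al)%:E * \int[mu]_(y in ~` ball (r / 2))
   (Num.max (u y) 0 / dist y x0 `^ (N%:R + al))%:E <= tail%:E)%E.

Definition cutoff (a b : R) (x : T) : R :=
  Num.max 0 (Num.min 1 ((b - dist x x0) / (b - a))).

Lemma cutoff01 a b x : 0 <= cutoff a b x <= 1.
Proof. by rewrite /cutoff le_max lexx/= ge_max ler01 ge_min lexx. Qed.

Lemma cutoff1 a b x : a < b -> dist x x0 <= a -> cutoff a b x = 1.
Proof.
move=> ab xa; rewrite /cutoff min_l ?max_r//.
by rewrite ler_pdivlMr ?subr_gt0// mul1r lerD2l lerN2.
Qed.

Lemma cutoff0 a b x : a < b -> b <= dist x x0 -> cutoff a b x = 0.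
Proof.
move=> ab xb; rewrite /cutoff max_l// ge_min; apply/orP; right.
by rewrite ler_pdivrMr ?subr_gt0// mul0r subr_le0.
Qed.

Lemma cutoff_lipschitz a b x y : a < b ->
  `|cutoff a b y - cutoff a b x| <= (b - a)^-1 * dist y x.
Proof.
move=> ab; have ba : 0 < (b - a)^-1 by rewrite invr_gt0 subr_gt0.
have h1 := dist_triangle y x x0; have h2 := dist_triangle x y x0.
rewrite (distC x y) in h2; rewrite /cutoff.
set s := (b - dist y x0) / (b - a); set t := (b - dist x x0) / (b - a).
set D := _ * dist y x.
have st1 : s - t <= D.
  rewrite /s /t /D -mulrBl mulrC ler_pM2l//; lra.
have st2 : t - s <= D.
  rewrite /s /t /D -mulrBl mulrC ler_pM2l//; lra.
have D0 : 0 <= D by rewrite mulr_ge0// ltW.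
clearbody s t D.
rewrite ler_norml /Num.max /Num.min.
case: (ltP 1 s) => a1; case: (ltP 1 t) => a2; rewrite ?ltr01;
  try case: (ltP 0 s) => a3; try case: (ltP 0 t) => a4;
  apply/andP; split; lra.
Qed.

Lemma measurable_cutoff a b : measurable_fun setT (cutoff a b).
Proof.
apply: measurable_maxr => //; apply: measurable_minr => //.
apply: measurable_funM => //; apply: measurable_funB => //.
exact: (measurable_dist_fst mdist).
Qed.

Lemma measurable_excess l : measurable_fun setT (excess u l).
Proof. by apply: measurable_maxr => //; exact: measurable_funB. Qed.

Let mball s : measurable (ball s).
Proof. exact: (measurable_dist_ball mdist). Qed.

(** Faber-Krahn is applied to [eta * w'], with [w] and [w'] the truncations at [l] and [l']. Where
    [w' > 0] one has [w >= l' - l]; this yields both the smallness of the support and the L^1 bound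
    [w' <= w^2 / (l' - l)] required by the tail term. [l >= 0] gives [w' <= u_+]. *)
Lemma de_giorgi_step (l l' a b rho th X : R) :
  0 <= l -> l < l' -> r / 2 <= a -> 0 < th -> th <= 1 -> b - a = th * r -> b <= r ->
  0 < rho -> 0 <= X ->
  (\int[mu]_(x in ball b) (excess u l x ^+ 2)%:E <= X%:E)%E ->
  X / (l' - l) ^+ 2 <= rho ^+ N / 2 ->
  (\int[mu]_(x in ball a) (excess u l' x ^+ 2)%:E <=
   (step_const N cF cK * (rho / r) `^ al *
     th^-1 ^+ (N + 2) * (1 + tail / (l' - l)) * X)%:E)%E.
Proof.
move=> l_ge0 ll' ra th0 th1 bath br rho0 X0 intX XN.
have l0 : 0 < ln 2 :> R by rewrite ln_gt0// ltr1n.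
have thr : 0 < th * r by rewrite mulr_gt0.
have ab : a < b by lra.
have r20 : 0 < r / 2 by rewrite divr_gt0.
have a_gt0 : 0 < a by lra.
have b_gt0 : 0 < b by lra.
(* The cutoff descends between [a] and the midpoint [c]; the other half of the gap separates its
   support from the exterior of the ball of radius [b]. *)
set c := (a + b) / 2.
have ac : a < c by rewrite /c; lra.
have cb : c < b by rewrite /c; lra.
pose w := excess u l; pose w' := excess u l'; pose eta := cutoff a c.
have mw := measurable_excess l; have mw' := measurable_excess l'.
have meta : measurable_fun setT eta by exact: measurable_cutoff.
set de := l' - l; have de0 : 0 < de by rewrite subr_gt0.
have w0 x : 0 <= w x by rewrite /w /excess le_max lexx orbT.
have w'0 x : 0 <= w' x by rewrite /w' /excess le_max lexx orbT.
have w'w x : w' x <= w x.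
  by rewrite /w /w' /excess ge_max !le_max lexx orbT andbT; apply/orP; left; lra.
have w'de x : 0 < w' x -> de <= w x.
  by rewrite /w /w' /excess lt_max ltxx orbF le_max => h; apply/orP; left; rewrite /de; lra.
have w'2 x : w' x ^+ 2 <= w x ^+ 2 by rewrite ler_sqr ?nnegrE.
have int_w'2 : (\int[mu]_(x in ball b) (w' x ^+ 2)%:E <= X%:E)%E.
  apply: le_trans intX; apply: ge0_le_integral_EFin => //.
  - exact: measurable_funX.
  - exact: measurable_funX.
  - by move=> x _; exact: sqr_ge0.
have int_w' : (\int[mu]_(x in ball b) (w' x)%:E <= (X / de)%:E)%E.
  apply: (@le_trans _ _ (\int[mu]_(x in ball b) (de^-1 * w x ^+ 2)%:E)%E).
    apply: ge0_le_integral_EFin => //.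
    - by apply: measurable_funM => //; exact: measurable_funX.
    - move=> x _; have := w'0 x; rewrite le_eqVlt => /predU1P[<-|h].
        by rewrite mulr_ge0 ?invr_ge0 ?(ltW de0)// sqr_ge0.
      have := w'de _ h; have := w'w x; rewrite ler_pdivlMl// => h1 h2.
      by rewrite expr2; apply: ler_pM => //; exact: ltW.
  rewrite ge0_integralMl_EFin//; last 3 first.
  - exact: measurable_funX.
  - by move=> x _; exact: sqr_ge0.
  - by rewrite invr_ge0 ltW.
  by rewrite mulrC EFinM lee_wpmul2l// lee_fin invr_ge0 ltW.
have eta01 := cutoff01 a c.
pose psi x := eta x * w' x.
have mpsi : measurable_fun setT psi by exact: measurable_funM.
have w'u x : w' x ^+ 2 <= u x ^+ 2.
  rewrite /w' /excess /Num.max; case: ifPn => h; first by rewrite expr0n sqr_ge0.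
  by rewrite -leNgt in h; rewrite ler_sqr ?nnegrE; lra.
have psi2 : (\int[mu]_x (psi x ^+ 2)%:E < +oo)%E.
  apply: le_lt_trans u2; apply: ge0_le_integral_EFin => //.
  - exact: measurable_funX.
  - exact: measurable_funX.
  - by move=> x _; exact: sqr_ge0.
  - move=> x _; apply: le_trans (w'u x); rewrite exprMn.
    by rewrite ler_piMl ?sqr_ge0// exprn_ile1//; have /andP[] := eta01 x.
have mnz : measurable [set x | (psi x != 0)%R].
  rewrite (_ : [set _ | _] = setT `&` psi @^-1` (~` [set 0])).
    by apply: mpsi => //; exact: measurableC.
  by apply/seteqP; split => x /=; [move/eqP|move=> [_ /eqP]].
have small : (mu [set x | (psi x != 0)%R] <= (rho ^+ N / 2)%:E)%E.
  apply: (@le_trans _ _ (X / de ^+ 2)%:E); last by rewrite lee_fin.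
  have de20 : 0 < de ^+ 2 by rewrite exprn_gt0.
  rewrite mulrC EFinM lee_pdivlMl//.
  apply: le_trans intX; rewrite -integral_cst//.
  apply: (@le_trans _ _ (\int[mu]_(x in [set x | (psi x != 0)%R]) (w x ^+ 2)%:E)%E).
    apply: ge0_le_integral_EFin => //.
    - exact: measurable_funX.
    - by move=> x _; exact: sqr_ge0.
    - move=> x /= px; rewrite ler_sqr ?nnegrE ?(ltW de0)//; apply: w'de.
      by rewrite lt_neqAle w'0 andbT eq_sym; apply: contra px => /eqP h; rewrite /psi h mulr0.
  apply: ge0_subset_integral => //.
  - by apply/measurable_EFinP/measurable_funTS; exact: measurable_funX.
  - by move=> x _; rewrite lee_fin sqr_ge0.
  - move=> x /= px; rewrite ltNge; apply/negP => bx; move/negP: px; apply.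
    by rewrite /psi /eta cutoff0 ?mul0r// (le_trans (ltW cb)).
have FK := faber_krahn mpsi psi2 rho0 small.
have etaB x : c <= dist x x0 -> eta x = 0 by exact: cutoff0.
have L0 : 0 <= (c - a)^-1 by rewrite invr_ge0 subr_ge0 ltW.
have cac : (energy mu k psi psi <=
   \int[mu2]_p (w' p.1 * w' p.2 * (eta p.2 - eta p.1) ^+ 2 * k p.1 p.2)%:E)%E.
  apply: (caccioppoli dist_ge0 mdist mk k0 levy mu_ u2 uE subsolution meta eta01 L0) => //.
  - by move=> x y; exact: cutoff_lipschitz.
  - move=> x nb; apply: etaB; rewrite leNgt; apply/negP => xc; apply: nb => /=.
    by apply: lt_le_trans br; exact: lt_trans cb.
  - lra.
have mup : measurable_fun setT (fun x => Num.max (u x) 0) by exact: measurable_maxr.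
have w'up x : w' x <= Num.max (u x) 0.
  by rewrite /w' /excess ge_max !le_max lexx orbT andbT; apply/orP; left; lra.
have cross := cross_term_le N2 dist_ge0 distC dist_triangle mdist vol mk k0 cK0 al0
  al2 upper mw' w'0 mup w'up meta eta01 L0 (fun x y => cutoff_lipschitz x y ac)
  (lt_trans a_gt0 ac) cb br (le_trans ra (ltW ab)) etaB.
set A1 := 16 / ln 2 * 4 ^+ N * cK; have A10 : 0 <= A1.
  by rewrite mulr_ge0 ?(ltW cK0)// mulr_ge0 ?exprn_ge0// divr_ge0 ?(ltW l0).
have ral0 : 0 < r `^ al by exact: powR_gt0.
have rhoal0 : 0 < rho `^ al by exact: powR_gt0.
have tailI : (\int[mu]_(y in ~` ball (r / 2))
   (Num.max (u y) 0 / dist y x0 `^ (N%:R + al))%:E <= (tail / r `^ al)%:E)%E.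
  by rewrite (mulrC tail) EFinM lee_pdivlMl.
set tI := th^-1; have tI1 : 1 <= tI by rewrite invf_ge1.
have tI0 : 0 <= tI by exact: le_trans tI1.
have LE : (c - a)^-1 ^+ 2 * r `^ (2 - al) = 4 * tI ^+ 2 / r `^ al.
  have -> : c - a = th * r / 2 by rewrite /c; lra.
  rewrite powRB ?(gt_eqF r0) ?implybT// powR_mulrn ?(ltW r0)// /tI.
  by field; rewrite !gt_eqF.
have tauE : (1 - c / b) `^ (- (N%:R + al)) <= 2 ^+ (N + 2) * tI ^+ (N + 2).
  have th2 : th / 2 <= 1 - c / b.
    have -> : 1 - c / b = th * r / 2 / b.
      by rewrite -bath /c; field; rewrite gt_eqF.
    rewrite -[leLHS]mulr1 -!mulrA ler_pM2l// mulrCA ler_wpM2l ?invr_ge0//.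
    by rewrite ler_pdivlMr// mul1r.
  have N0 : 0 <= N%:R :> R by [].
  apply: (le_trans (ler_powRN _ _ th2)).
  - by rewrite addr_ge0// ltW.
  - by rewrite divr_gt0.
  have y1 : 1 <= (th / 2)^-1 by rewrite invf_ge1 ?divr_gt0//; lra.
  have -> : (th / 2) `^ (- (N%:R + al)) = (th / 2)^-1 `^ (N%:R + al).
    by rewrite -[in RHS]powR_inv1 ?divr_ge0 ?(ltW th0)// -powRrM mulN1r.
  have -> : 2 ^+ (N + 2) * tI ^+ (N + 2) = (th / 2)^-1 `^ (N + 2)%:R.
    by rewrite powR_mulrn ?invr_ge0 ?divr_ge0 ?(ltW th0)// invf_div exprMn.
  by rewrite ler_powR// natrD lerD2l ltW.
have Wle : (\int[mu]_x (psi x ^+ 2)%:E <= (cF^-1 * rho `^ al *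
   (A1 * (4 * tI ^+ 2 / r `^ al) * X +
    2 * cK * (2 - al) * (2 ^+ (N + 2) * tI ^+ (N + 2)) * (X / de * (tail / r `^ al))))%:E)%E.
  have cr0 : 0 < cF * rho `^ (- al) by rewrite mulr_gt0// powR_gt0.
  have -> : cF^-1 * rho `^ al = (cF * rho `^ (- al))^-1.
    by rewrite invfM powRN invrK.
  rewrite EFinM lee_pdivlMl//.
  apply: (le_trans FK); apply: (le_trans cac); apply: (le_trans cross).
  rewrite EFinD; apply: leeD.
    rewrite (_ : (A1 * _ * X)%:E = (A1 * (c - a)^-1 ^+ 2 * r `^ (2 - al))%:E * X%:E)%E;
      last by rewrite -LE -EFinM mulrA.
    apply: lee_wpmul2l => //.
    by rewrite lee_fin mulr_ge0 ?powR_ge0// mulr_ge0// sqr_ge0.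
  rewrite [leRHS]EFinM; apply: lee_pmul.
  - by rewrite lee_fin mulr_ge0 ?powR_ge0// !mulr_ge0 ?(ltW cK0)// subr_ge0 ltW.
  - apply: mule_ge0; apply: integral_ge0 => x _; rewrite lee_fin//.
    by rewrite divr_ge0 ?powR_ge0// le_max lexx orbT.
  - rewrite lee_fin ler_wpM2l// !mulr_ge0 ?(ltW cK0)// subr_ge0 ltW//.
  rewrite [leRHS]EFinM; apply: lee_pmul => //.
  - by apply: integral_ge0 => x _; rewrite lee_fin.
  - by apply: integral_ge0 => x _; rewrite lee_fin divr_ge0 ?powR_ge0// le_max lexx orbT.
apply: (@le_trans _ _ (\int[mu]_x (psi x ^+ 2)%:E)%E).
  apply: ge0_le_integral_setT => //.
  - exact: measurable_funX.
  - exact: measurable_funX.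
  - by move=> x _; exact: sqr_ge0.
  - by move=> x; exact: sqr_ge0.
  - by move=> x /= xa; rewrite /psi /eta cutoff1 ?mul1r// ltW.
apply: (le_trans Wle); rewrite lee_fin.
have -> : (rho / r) `^ al = rho `^ al / r `^ al.
  by rewrite powRM ?invr_ge0 ?(ltW r0) ?(ltW rho0)// -powR_inv1 ?(ltW r0)// -powRrM mulN1r powRN.
have t2 : tI ^+ 2 <= tI ^+ (N + 2) by rewrite ler_weXn2l// leq_addl.
set Q := tI ^+ (N + 2) in t2 *; set q := tI ^+ 2 in t2 *.
have Q0 : 0 <= Q by exact: exprn_ge0.
have q0 : 0 <= q by exact: sqr_ge0.
set S := tail / de; have S0 : 0 <= S by rewrite divr_ge0// ltW.
set Z := cF^-1 * (rho `^ al / r `^ al) * X.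
have Z0 : 0 <= Z by rewrite !mulr_ge0 ?invr_ge0 ?powR_ge0 ?(ltW cF0).
have -> : cF^-1 * rho `^ al * (A1 * (4 * q / r `^ al) * X +
   2 * cK * (2 - al) * (2 ^+ (N + 2) * Q) * (X / de * (tail / r `^ al))) =
   Z * (4 * A1 * q + 2 * cK * (2 - al) * 2 ^+ (N + 2) * (Q * S)).
  by rewrite /Z /S; field; rewrite !gt_eqF.
have -> : step_const N cF cK *
   (rho `^ al / r `^ al) * Q * (1 + S) * X =
   Z * ((4 * A1 + 4 * cK * 2 ^+ (N + 2)) * (Q * (1 + S))).
  rewrite /step_const /Z /A1 (_ : (N + 4 = N + 2 + 2)%N) ?[in LHS](exprD _ (N + 2) 2);
    last by rewrite -addnA.
  by field; rewrite !gt_eqF.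
rewrite ler_wpM2l//.
set P2 := cK * 2 ^+ (N + 2); have P20 : 0 <= P2 by rewrite mulr_ge0 ?(ltW cK0)// exprn_ge0.
have QS : 0 <= Q * S by exact: mulr_ge0.
have e1 : A1 * q <= A1 * Q by rewrite ler_wpM2l.
have e2 : 0 <= A1 * (Q * S) by exact: mulr_ge0.
have e3 : 0 <= P2 * (Q * S) by exact: mulr_ge0.
have e4 : 0 <= P2 * Q by exact: mulr_ge0.
have e5 : 0 <= al * (P2 * (Q * S)) by apply: mulr_ge0 => //; exact: ltW.
rewrite (_ : 2 * cK * (2 - al) * 2 ^+ (N + 2) * (Q * S) =
   4 * (P2 * (Q * S)) - 2 * (al * (P2 * (Q * S)))); last by rewrite /P2; ring.
rewrite (_ : (4 * A1 + 4 * cK * 2 ^+ (N + 2)) * (Q * (1 + S)) =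
   4 * (A1 * Q) + 4 * (A1 * (Q * S)) + 4 * (P2 * Q) + 4 * (P2 * (Q * S))); last by rewrite /P2; ring.
lra.
Qed.

Lemma local_sup_bound (m : nat) (q S eps : R) : 1 <= m%:R * al ->
  1 < q -> 0 < S -> 0 < eps ->
  (\int[mu]_(x in ball r) (excess u 0 x `^ q)%:E <= (S `^ q * r ^+ N)%:E)%E ->
  {ae mu, forall x, ball (r / 2) x ->
    u x <= local_const N m cF cK * S + tail + eps}.
Proof.
move=> mal; set lam := (2^-1 ^+ (N + 3)) ^+ (m * N) / 4 : R.
have l0 : 0 < ln 2 :> R by rewrite ln_gt0// ltr1n.
have half1 : (2^-1 : R) <= 1 by rewrite invf_le1// ler1n.
have half0 : 0 <= (2^-1 : R) by rewrite invr_ge0.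
have E0 : 0 < (2^-1 ^+ (N + 3) : R) by exact: exprn_gt0.
have lam0 : 0 < lam by rewrite divr_gt0// exprn_gt0.
have lam1 : lam <= 1.
  rewrite /lam ler_pdivrMr// mul1r; apply: (@le_trans _ _ 1); last by rewrite ler1n.
  by rewrite exprn_ile1 ?exprn_ile1 ?(ltW E0).
have A0 : 0 <= step_const N cF cK.
  rewrite /step_const mulr_ge0 ?invr_ge0 ?(ltW cF0)// addr_ge0// mulr_ge0 ?(ltW cK0) ?exprn_ge0//.
  by rewrite mulr_ge0 ?exprn_ge0// divr_ge0 ?(ltW l0).
set A3 := 1 + step_const N cF cK * 2 ^+ (N + 4).
have A31 : 1 <= A3 by rewrite lerDl mulr_ge0// exprn_ge0.
have A30 : 0 < A3 by exact: lt_le_trans A31.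
apply: (sup_bound mball (vol x0 r0) mu_ u2 r0 tail0).
  rewrite -[leLHS]mul1r ler_pM ?ler1n// exprn_ege1// ler_pdivlMr// mul1r.
  exact: le_trans lam1 A31.
move=> s s' de lev s12 ss' s'1 de0 de1 lev0 delev start.
have D0 : 0 < s' - s by rewrite subr_gt0.
set G := de^-1 * (s' - s)^-1 ^+ (N + 2) in start *.
have G0 : 0 < G by rewrite mulr_gt0 ?invr_gt0// exprn_gt0// invr_gt0.
have AA3 : step_const N cF cK * 2 ^+ (N + 4) <= A3 by rewrite lerDr.
have t0 : 0 < lam / (A3 * G) by rewrite divr_gt0// mulr_gt0.
have tE : lam / (A3 * G) * (A3 * G) = lam by rewrite divfK// gt_eqF// mulr_gt0.
apply: (de_giorgi mball mu_ r0 A0 tail0 de_giorgi_step s12 ss' s'1 de0 de1 lev0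
  delev mal A31 AA3 t0 tE).
apply: (le_trans start); rewrite lee_fin le_eqVlt; apply/orP; left; apply/eqP.
rewrite -/A3 -/lam.
have -> : (lam / (A3 * G)) ^+ (m * N) = ((A3 / lam) ^+ (m * N))^-1 / G ^+ (m * N).
  by rewrite -!exprVn -exprMn; congr (_ ^+ _); field; rewrite !gt_eqF.
set e1 := (A3 / lam) ^+ _; set e2 := G ^+ _.
have e10 : 0 < e1 by rewrite exprn_gt0// divr_gt0.
have e20 : 0 < e2 by rewrite exprn_gt0.
by field; rewrite !gt_eqF.
Qed.

End DeGiorgi.

(** * The Euclidean case *)

Section Exhaustion.
Context (R : realType) (dd : measure_display) (T : measurableType dd).
Variable mu : {sigma_finite_measure set T -> \bar R}.
Local Notation mu2 := (mu \x mu)%E.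

Lemma iterated_integral_setX (D : set T) (f : T * T -> R) : measurable D ->
  measurable_fun setT f -> (forall p, 0 <= f p) ->
  (\int[mu]_(x in D) \int[mu]_(y in D) (f (x, y))%:E =
   \int[mu2]_(p in D `*` D) (f p)%:E)%E.
Proof.
move=> mD mf f0.
pose g (p : T * T) : R := \1_(D `*` D) p * f p.
have mg : measurable_fun setT g.
  by apply: measurable_funM => //; apply: measurable_indic; exact: measurableX.
have g0 p : 0 <= g p by rewrite mulr_ge0.
rewrite -integral_indicM -/g (tonelli_EFin mu mg g0).
rewrite [LHS]integral_mkcond; apply: eq_integral => x _.
rewrite patchE; case: ifPn => xD.
  rewrite -integral_indicM; apply: eq_integral => y _.
  by rewrite /g !indicE in_setX xD.
rewrite integral0_eq// => y _.
by rewrite /g indicE in_setX (negbTE xD) mul0r.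
Qed.

(** Monotone convergence along the squares [B n * B n], for passing from inequalities on balls to
    the whole space. *)
Lemma energy_exhaustion_le (B : nat -> set T) (f : T * T -> R) (c : \bar R) :
  (forall n, measurable (B n)) -> (forall n m, (n <= m)%N -> B n `<=` B m) ->
  (forall x, exists n, B n x) ->
  measurable_fun setT f -> (forall p, 0 <= f p) ->
  (forall n, \int[mu]_(x in B n) \int[mu]_(y in B n) (f (x, y))%:E <= c)%E ->
  (\int[mu]_x \int[mu]_y (f (x, y))%:E <= c)%E.
Proof.
move=> mB ndB Bcover mf f0 le_c.
rewrite -(tonelli_EFin mu mf f0).
have ndF : {homo (fun n => B n `*` B n) : n m / (n <= m)%N >-> (n <= m)%O}.
  move=> n m nm; apply/subsetPset => -[x y] [/= Bx By].
  by split; exact: (ndB n m nm).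
have cover : \bigcup_n (B n `*` B n) = setT.
  apply/seteqP; split => // -[x y] _; have [n Bx] := Bcover x; have [m By] := Bcover y.
  exists (maxn n m) => //; split => /=.
    exact: (ndB _ _ (leq_maxl n m)).
  exact: (ndB _ _ (leq_maxr n m)).
have := @ge0_nondecreasing_set_cvg_integral _ _ R (fun n => B n `*` B n)
  (fun p => (f p)%:E) mu2 ndF.
move=> /(_ (fun n => measurableX (mB n) (mB n))) H.
have {H} := H (fun n => measurable_funTS ((measurable_EFinP _ _).2 mf)).
rewrite cover => /(_ (fun n p _ => f0 p)) H.
rewrite -(cvg_lim _ H)//; apply: lime_le; first by apply/cvg_ex; eexists; exact: H.
by apply: nearW => n; rewrite -iterated_integral_setX.
Qed.

End Exhaustion.

(** * Instantiation on Euclidean space and conclusion *)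

Section EuclideanInstance.
Variables (R : realType) (n : nat).
Local Notation X := (Rsp R n.+1).
Local Notation mu := (leb R n.+1).
Local Notation dist := (@eudist R n.+1).

Lemma eudist_ge0 (x y : X) : 0 <= dist x y.
Proof. exact: sqrtr_ge0. Qed.

Lemma eudistC (x y : X) : dist x y = dist y x.
Proof. by rewrite /eudist sqdistC. Qed.

Lemma eudist_triangle (x y z : X) : dist x z <= dist x y + dist y z.
Proof. exact: sqdist_triangle. Qed.

Lemma measurable_eudist : measurable_fun setT (fun p : X * X => dist p.1 p.2).
Proof.
apply: (measurableT_comp (@measurable_sqrt R)).
by apply: (@measurable_sqdist R n).
Qed.

Lemma eudist_lt (x y : X) s : 0 < s -> (dist x y < s) = (sqdist x y < s ^+ 2).
Proof.
move=> s0; rewrite /eudist -ltr_sqr ?nnegrE ?sqrtr_ge0 ?(ltW s0)//.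
by rewrite sqr_sqrtr// sqdist_ge0.
Qed.

Lemma measurable_eball (x : X) s : measurable (eball x s).
Proof. exact: (measurable_dist_ball measurable_eudist). Qed.

Lemma leb_eball_le (x : X) s : 0 < s ->
  (mu (eball x s) <= (2 ^+ n.+1 * s ^+ n.+1)%:E)%E.
Proof.
move=> s0; rewrite -exprMn -(@lebd_pbox R n x s (ltW s0)).
apply: le_measure; rewrite ?inE.
- exact: measurable_eball.
- exact: measurable_pbox.
- by move=> y /=; rewrite /eball /= eudist_lt//; exact: sqdist_lt_pbox.
Qed.

Lemma leb_eball_gt0 (x : X) s : 0 < s -> (0 < mu (eball x s))%E.
Proof.
move=> s0; have t0 : 0 < s / n.+1%:R by rewrite divr_gt0.
apply: (@lt_le_trans _ _ (mu (pbox x (s / n.+1%:R)))).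
  have := @lebd_pbox R n x _ (ltW t0) => E.
  suff : (0 < lebd R n (pbox x (s / n.+1%:R)))%E by [].
  by rewrite E lte_fin exprn_gt0// mulr_gt0.
apply: le_measure; rewrite ?inE.
- exact: measurable_pbox.
- exact: measurable_eball.
- move=> y /(pbox_sqdist t0) h; rewrite /eball /= eudist_lt//.
  apply: (lt_le_trans h).
  have E (a : R) : a != 0 -> a * (s / a) ^+ 2 = a^-1 * s ^+ 2 by move=> a0; field.
  by rewrite E ?pnatr_eq0// ler_piMl ?sqr_ge0// invf_le1 ?ler1n.
Qed.

Lemma padd0 (x : pt R n) : padd x (pcst 0 n) = x.
Proof.
elim: n x => [|m IH] x /=; first by rewrite addr0.
by rewrite IH addr0; case: x.
Qed.


(** The factor [2 - al] in the lower bound for the kernel constant cancels the [1 / (2 - al)] of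
    [fractional_energy_ge]. Replacing the exponent [n.+1 + al] of [K >= 1] by [n.+1 + 2] then leaves
    a constant free of [al]. *)
Lemma faber_krahn_euclidean (cl c0 al : R) (k : X -> X -> R) (w : X -> R) (rho : R) :
  0 < cl -> 0 < al -> al < 2 ->
  0 <= c0 -> c0 * (2 - al) <= (powR 2 al * Gamma ((n.+1%:R + al) / 2)) /
    (powR pi (n.+1%:R / 2) * `|Gamma (- al / 2)|) ->
  measurable_fun setT (fun p : X * X => k p.1 p.2) -> (forall x y, 0 <= k x y) ->
  E_ge cl al k ->
  measurable_fun setT w -> (\int[mu]_x (w x ^+ 2)%:E < +oo)%E -> 0 < rho ->
  (mu [set x | (w x != 0)%R] <= (rho ^+ n.+1 / 2)%:E)%E ->
  ((cl * (c0 * (2 * n.+1%:R) `^ (- (n.+1%:R + 2)) / 4) * rho `^ (- al))%:E *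
    \int[mu]_x (w x ^+ 2)%:E <= energy mu k w w)%E.
Proof.
move=> cl0 al0 al2 c00; set kc := _ / (_ * _) => kcge mk k0 Ege mw w2 rho0 small.
set K := 2 * n.+1%:R : R.
have n1 : 1 <= n.+1%:R :> R by rewrite ler1n.
have K1 : 1 <= K by rewrite /K; lra.
have a2 : 0 < 2 - al by rewrite subr_gt0.
have kc0 : 0 <= kc by apply: le_trans kcge; rewrite mulr_ge0// ltW.
have mpadd : measurable_fun setT (fun p : X * X => (padd p.1 p.2 : X)).
  by apply: (@measurable_padd R n).
have mpscale c : measurable_fun setT (fun x : X => (pscale c x : X)).
  by apply: (@measurable_pscale R c n).
have dist_cube rh (x h : X) : 0 < rh -> @pcube R n rh h ->
    0 < dist (padd x h : X) x <= K * rh.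
  move=> rh0 /(sqdist_padd_pcube x rh0)/andP[h1 h2].
  rewrite /eudist sqrtr_gt0 h1/= -(ger0_norm (mulr_ge0 (le_trans ler01 K1) (ltW rh0))).
  rewrite -sqrtr_sqr ler_wsqrtr//; apply: (le_trans h2).
  have -> : (K * rh) ^+ 2 = n.+1%:R ^+ 2 * (2 * rh) ^+ 2 by rewrite /K; ring.
  rewrite ler_wpM2r ?sqr_ge0//.
  by rewrite expr2 ler_peMr// (le_trans ler01).
have shift (b : X) (f : X -> \bar R) : measurable_fun setT f ->
    (forall x, 0 <= f x)%E -> (\int[mu]_x f (padd x b : X) = \int[mu]_x f x)%E.
  exact: (@integral_lebd_shift R n b f).
have scal c (f : X -> \bar R) : 0 < c -> measurable_fun setT f ->
    (forall x, 0 <= f x)%E ->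
    (\int[mu]_x f (pscale c x : X) = ((c^-1) ^+ n.+1)%:E * \int[mu]_x f x)%E.
  move=> c_gt0 mf f0; have <- := @integral_lebd_affine R n c (pcst 0 n) f c_gt0 mf f0.
  by apply: eq_integral => x _; rewrite padd0.
have FK := @fractional_energy_ge R _ X mu n.+1 dist (@padd R n) (fun c => @pscale R c n)
  (@pcube R n) K measurable_eudist mpadd mpscale (@measurable_pcube R n) (@paddA R n)
  (@paddC R n) (@pscale1 R n) (@pscale_double R n) (@lebd_pcube R n)
  (@pcube_scale R n) (@pcube_disjoint R n) dist_cube K1 shift scal w mw al kc rho
  al2 (ltW al0) kc0 rho0 small.
pose f (p : X * X) : R := (w p.2 - w p.1) ^+ 2 *
  (kc * dist p.2 p.1 `^ (- (n.+1%:R + al))).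
have f0 p : 0 <= f p by rewrite mulr_ge0 ?sqr_ge0// mulr_ge0// powR_ge0.
have mswap : measurable_fun setT (fun p : X * X => (p.2, p.1)).
  by apply/measurable_fun_pairP; split; [exact: measurable_snd|exact: measurable_fst].
have mf : measurable_fun setT f.
  apply: measurable_funM.
    by apply: measurable_funX; exact: measurable_increment.
  apply: measurable_funM => //; apply: (measurableT_comp (measurable_powR _)).
  exact: (measurableT_comp measurable_eudist mswap).
pose g (p : X * X) : R := (w p.2 - w p.1) ^+ 2 * k p.1 p.2.
have g0 p : 0 <= g p by rewrite mulr_ge0 ?sqr_ge0.
have mg : measurable_fun setT g.
  by apply: measurable_funM => //; apply: measurable_funX; exact: measurable_increment.
have glob : (\int[mu]_x \int[mu]_y (f (x, y))%:E <= (cl^-1)%:E * energy mu k w w)%E.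
  pose B m := eball (pcst 0 n : X) m.+1%:R.
  have mB m : measurable (B m) by exact: measurable_eball.
  apply: (@energy_exhaustion_le R _ X mu B f) => //.
  - move=> i j ij x; rewrite /B /eball /= => /lt_le_trans; apply.
    by rewrite ler_nat.
  - move=> x; exists (Num.truncn (dist x (pcst 0 n : X))).
    by have /truncn_itv/andP[_] := eudist_ge0 x (pcst 0 n : X).
  move=> m; rewrite lee_pdivlMl; last exact: cl0.
  have L2 : L2on (B m) w.
    split; first exact: measurable_funTS.
    apply: le_lt_trans w2; apply: ge0_le_integral_setT => //.
    - exact: measurable_funX.
    - exact: measurable_funX.
    - by move=> x _; exact: sqr_ge0.
    - by move=> x; exact: sqr_ge0.
  have := Ege (pcst 0 n : X) m.+1%:R (ltr0Sn _ _) w L2.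
  move=> /le_trans; apply.
  have -> : Eform k (B m) w w = (\int[mu]_(x in B m) \int[mu]_(y in B m) (g (x, y))%:E)%E by [].
  rewrite (iterated_integral_setX mu (mB m) mg g0) (@energyE R _ X mu k mk k0 w mw).
  apply: ge0_subset_integral => //.
  - exact: measurableX.
  - exact/measurable_EFinP.
  - by move=> p _; rewrite lee_fin; exact: (g0 p).
have W0 : (0 <= \int[mu]_x (w x ^+ 2)%:E)%E.
  by apply: integral_ge0 => x _; rewrite lee_fin sqr_ge0.
rewrite lee_pdivlMl in glob; last exact: cl0.
apply: le_trans glob; rewrite -(mulrA cl) EFinM -muleA lee_pmul2l//.
apply: le_trans FK; apply: lee_wpmul2r => //; rewrite lee_fin.
have KK : K `^ (- (n.+1%:R + 2)) <= K `^ (- (n.+1%:R + al)).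
  by rewrite ler_powR// lerN2 lerD2l ltW.
rewrite (_ : kc / _ * _ = kc / (2 - al) * (K `^ (- (n.+1%:R + al)) / 4) * rho `^ (- al)); last by ring.
rewrite ler_wpM2r ?powR_ge0// -mulrA.
apply: ler_pM => //; first by rewrite divr_ge0 ?powR_ge0.
- by rewrite ler_pdivlMr.
- by rewrite ler_pM2r.
Qed.

End EuclideanInstance.

Theorem mainTheorem13 (R : realType) (d : nat) (alpha0 cl cK q : R) :
  (3 <= d)%N -> 0 < alpha0 -> 0 < cl -> 0 < cK -> 1 < q ->
  exists C : R, 0 < C /\
  forall (alpha : R) (k : Rsp R d -> Rsp R d -> R),
    alpha0 <= alpha -> alpha < 2 ->
    admissible_kernel k -> E_ge cl alpha k -> U2 cK alpha k ->
  forall (x0 : Rsp R d) (r : R) (u : Rsp R d -> R),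
    0 < r -> inH k u ->
    (forall phi : Rsp R d -> R, inH_on k (eball x0 r) phi ->
       (forall x, 0 <= phi x) -> (Eform k setT u phi <= 0)%E) ->
    (esssup_on (eball x0 (r / 2)) u <=
       C%:E * poweR
         (((fine (leb R d (eball x0 r)))^-1)%R%:E *
           \int[leb R d]_(x in eball x0 r) (powR (Num.max (u x) 0) q)%R%:E)
         q^-1
     + (powR r alpha)%:E *
       \int[leb R d]_(y in ~` eball x0 (r / 2))
          (Num.max (u y) 0 / powR (eudist y x0) (d%:R + alpha))%R%:E)%E.
Proof.
move=> d3 a00 cl0 cK0 q1; case: d d3 => [//|n] d3.
have [c0 [c00 kge]] := @kalpha_const_ge R n.+1 alpha0 (ltnW d3) a00.
(* Fixed by [alpha0] alone, so the same exponent [m * N] serves every [alpha >= alpha0]. *)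
set m := Num.bound alpha0^-1.
have mal0 : 1 <= m%:R * alpha0.
  by rewrite -ler_pdivrMr// mul1r ltW// archi_boundP// invr_ge0 ltW.
set cF := cl * (c0 * (2 * n.+1%:R) `^ (- (n.+1%:R + 2)) / 4).
have cF0 : 0 < cF by rewrite mulr_gt0// divr_gt0// mulr_gt0// powR_gt0// mulr_gt0.
(* The extra 1 absorbs the second error term: [Cl * e + e <= C1 * e = eps] for [e = eps / C1]. *)
set Cl := local_const n.+1 m cF cK; set C1 := `|Cl| + 1.
have C10 : 0 < C1 by rewrite ltr_wpDl.
exists (C1 * 2 ^+ n.+1); split; first by rewrite mulr_gt0// exprn_gt0.
move=> al k a0al al2 [mk k0 ksym [M levy]] Ege upper x0 r u r0 [mu_ u2 uE] sub.
have al0 : 0 < al by exact: lt_le_trans a0al.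
have q0 : 0 < q by exact: lt_trans q1.
set mu := leb R n.+1.
set TI := (\int[mu]_(y in ~` _) _)%E; set Iq := (\int[mu]_(x in _) _)%E.
have TI0 : (0 <= TI)%E.
  by apply: integral_ge0 => y _; rewrite lee_fin divr_ge0 ?powR_ge0// le_max lexx orbT.
have Iq0 : (0 <= Iq)%E by apply: integral_ge0 => y _; rewrite lee_fin powR_ge0.
have Vfin : mu (eball x0 r) \is a fin_num.
  rewrite ge0_fin_numE//; apply: le_lt_trans (leb_eball_le x0 r0) _; exact: ltry.
set V := fine (mu (eball x0 r)).
have V0 : 0 < V.
  by rewrite fine_gt0//; apply/andP; split; [exact: leb_eball_gt0|rewrite -ge0_fin_numE].
have Vle : V <= 2 ^+ n.+1 * r ^+ n.+1.
  by rewrite -lee_fin fineK//; exact: leb_eball_le.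
have C20 : 0 < C1 * 2 ^+ n.+1 by rewrite mulr_gt0// exprn_gt0.
have ral0 : 0 < r `^ al by exact: powR_gt0.
have rhs0 : (0 <= (C1 * 2 ^+ n.+1)%:E * ((V^-1)%:E * Iq) `^ q^-1)%E.
  by rewrite mule_ge0 ?poweR_ge0// lee_fin ltW.
have rhs1 : (0 <= (r `^ al)%:E * TI)%E by rewrite mule_ge0// lee_fin ltW.
(* An infinite tail or an infinite L^q integral makes the right-hand side [+oo]; from there on both
   are real numbers. *)
have [TIoo|TIfin] := eqVneq TI +oo%E.
  rewrite [X in (_ + X)%E](_ : _ = +oo%E); last by rewrite TIoo gt0_muley// lte_fin.
  by rewrite addey ?leey// -ltNye (lt_le_trans _ rhs0).
have [Iqoo|Iqfin] := eqVneq Iq +oo%E.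
  rewrite [X in (X + _)%E](_ : _ = +oo%E); last first.
    rewrite Iqoo gt0_muley ?lte_fin ?invr_gt0// poweRyr ?invr_eq0 ?gt_eqF//.
    by rewrite gt0_muley// lte_fin.
  by rewrite addye ?leey// -ltNye (lt_le_trans _ rhs1).
have TIf : TI \is a fin_num by rewrite ge0_fin_numE// ltey.
have Iqf : Iq \is a fin_num by rewrite ge0_fin_numE// ltey.
set tail := r `^ al * fine TI.
have tail0 : 0 <= tail by rewrite mulr_ge0 ?powR_ge0 ?fine_ge0.
have tailE : ((r `^ al)%:E * TI = tail%:E)%E by rewrite -(fineK TIf).
set I := fine Iq; have I0 : 0 <= I by exact: fine_ge0.
have IE : Iq = I%:E by rewrite fineK.
set a := (V^-1 * I) `^ q^-1; have a0 : 0 <= a by exact: powR_ge0.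
have aE : (((V^-1)%:E * Iq) `^ q^-1 = a%:E)%E by rewrite IE -EFinM poweR_EFin.
rewrite tailE aE -EFinM -EFinD.
(* The average is taken over the volume [V] of the ball, the iteration uses [r^N]; since
   [V <= 2^N r^N], the factor [2^N] in front of [a] bridges the two. Adding [e] keeps [S] positive
   when [a = 0]. *)
have intS e : 0 < e -> (\int[mu]_(x in eball x0 r) (excess u 0 x `^ q)%:E <=
    ((2 ^+ n.+1 * a + e) `^ q * r ^+ n.+1)%:E)%E.
  move=> e0; rewrite (_ : (\int[mu]_(x in _) _)%E = Iq); last first.
    by apply: eq_integral => x _; rewrite /excess subr0.
  rewrite IE lee_fin.
  apply: (@le_trans _ _ ((2 ^+ n.+1 * a) `^ q * r ^+ n.+1)); last first.
    rewrite ler_wpM2r ?exprn_ge0 ?(ltW r0)//; apply: ge0_ler_powR.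
    - exact: ltW.
    - by rewrite nnegrE mulr_ge0// exprn_ge0.
    - by rewrite nnegrE addr_ge0 ?(ltW e0)// mulr_ge0// exprn_ge0.
    - by rewrite lerDl ltW.
  rewrite powRM ?exprn_ge0// /a -powRrM mulVf ?gt_eqF// powRr1; last first.
    by rewrite mulr_ge0// invr_ge0 ltW.
  apply: (@le_trans _ _ (2 ^+ n.+1 * (V^-1 * I) * r ^+ n.+1)); last first.
    rewrite !ler_wpM2r ?exprn_ge0 ?(ltW r0) ?mulr_ge0 ?invr_ge0 ?(ltW V0)//.
    by rewrite le1r_powR ?(ltW q1)// exprn_ege1// ler1n.
  rewrite (_ : 2 ^+ n.+1 * (V^-1 * I) * r ^+ n.+1 = 2 ^+ n.+1 * r ^+ n.+1 / V * I); last by ring.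
  by rewrite ler_peMl// ler_pdivlMr// mul1r.
have mal : 1 <= m%:R * al by apply: le_trans mal0 _; rewrite ler_wpM2l.
have FK w rho := @faber_krahn_euclidean R n cl c0 al k w rho cl0 al0 al2 (ltW c00)
  (kge al a0al al2) mk k0 Ege.
have subsolution (phi : Rsp R n.+1 -> R) : measurable_fun setT phi ->
    (\int[mu]_x (phi x ^+ 2)%:E < +oo)%E -> (energy mu k phi phi < +oo)%E ->
    (forall x, ~ [set x | (eudist x x0 < r)%R] x -> phi x = 0) ->
    (forall x, 0 <= phi x) -> (energy mu k u phi <= 0)%E.
  move=> mphi phi2 phiE phiB phi0; apply: sub => //.
  by split; [split|apply: aeW].
have tail_le : ((r `^ al)%:E * TI <= tail%:E)%E by rewrite tailE.
apply/lee_addgt0Pr => eps eps0; set e := eps / C1.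
have e0 : 0 < e by rewrite divr_gt0.
have Se : 0 < 2 ^+ n.+1 * a + e by rewrite ltr_wpDl// mulr_ge0// exprn_ge0.
have ae_le := @local_sup_bound R _ (Rsp R n.+1) mu n.+1 (@eudist R n.+1) k cK al M cF
  (ltnW d3) (@eudist_ge0 R n) (@eudistC R n) (@eudist_triangle R n)
  (@measurable_eudist R n) (@leb_eball_le R n) mk k0 levy cK0 al0 al2 upper cF0 FK
  u x0 r tail r0 mu_ u2 uE subsolution tail0 tail_le m q _ e mal q1 Se e0 (intS e e0).
apply: (@le_trans _ _ (Cl * (2 ^+ n.+1 * a + e) + tail + e)%:E).
  apply: ereal_inf_lbound; apply: filterS ae_le => x h bx.
  by rewrite lee_fin; exact: h.
rewrite -EFinD lee_fin.
have ClC : Cl <= C1 - 1 by rewrite /C1 addrK ler_norm.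
have e1 : Cl * (2 ^+ n.+1 * a + e) <= (C1 - 1) * (2 ^+ n.+1 * a + e).
  by rewrite ler_pM2r.
have e2 : C1 * e = eps by rewrite /e mulrC divfK// gt_eqF.
have e3 : 0 <= 2 ^+ n.+1 * a by rewrite mulr_ge0// exprn_ge0.
rewrite -e2; nra.
Qed.
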